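(* Let $d\geq 1$ and $k\geq 0$ be integers. There is a constant $C=C(d,k)$ such that for every integer $n\geq 1$ and every probability distribution $\tau$ on $S^{d-1}\times[-1,1]$ there exists a probability distribution $\tau'$ on $S^{d-1}\times[-1,1]$ supported on at most $n$ points such that for every multi-index $\alpha$ with $|\alpha|\leq k$, \[ \sup_{x\in B^d}\left|D_x^\alpha\left(\int_{S^{d-1}\times[-1,1]}\sigma_k(\omega\cdot x+b)\,d\tau(\omega,b) - \int_{S^{d-1}\times[-1,1]}\sigma_k(\omega\cdot x+b)\,d\tau'(\omega,b)\right)\right| \leq C n^{-\frac12-\frac{2(k-|\alpha|)+1}{2d}}. \]
   Context: $B^d=\{x\in\mathbb{R}^d:|x|\leq 1\}$ and $S^{d-1}$ is the unit sphere in $\mathbb{R}^d$. The ReLU$^k$ activation is $\sigma_k(t)=t^k$ for $t\geq 0$ and $\sigma_k(t)=0$ for $t<0$, with the convention $0^0=1$ (so $\sigma_0$ is the Heaviside function). $D_x^\alpha$ denotes the $\alpha$-th order partial derivative with respect to $x$; for a single atom, $D_x^\alpha\sigma_k(\omega\cdot x+b)$ is understood as $\frac{k!}{(k-|\alpha|)!}(\omega\cdot x+b)^{k-|\alpha|}\omega^\alpha$ when $\omega\cdot x+b\geq 0$ and $0$ otherwise. *)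

(* Defs.v *)
From HB Require Import structures.
From mathcomp Require Import all_boot all_order all_algebra.
From mathcomp Require Import all_classical all_reals all_analysis.
Set Implicit Arguments. Unset Strict Implicit. Unset Printing Implicit Defensive.
Import Order.TTheory GRing.Theory Num.Theory.
Import numFieldNormedType.Exports.
Local Open Scope classical_set_scope.
Local Open Scope ring_scope.

Definition param (R : realType) (d : nat) :=
  g_sigma_algebraType (@open ('rV[R]_d * R)%type).

Definition dotv (R : realType) (d : nat) (u v : 'rV[R]_d) : R :=
  \sum_(i < d) u ord0 i * v ord0 i.

Definition ball_d (R : realType) (d : nat) : set 'rV[R]_d :=
  [set x | dotv x x <= 1].
Definition sphere_d (R : realType) (d : nat) : set 'rV[R]_d :=
  [set w | dotv w w = 1].

Definition dict_set (R : realType) (d : nat) : set (param R d) :=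
  [set p | sphere_d p.1 /\ -1 <= p.2 <= 1].

Definition mi_abs (d : nat) (alpha : 'I_d -> nat) : nat := \sum_(i < d) alpha i.
Definition mi_pow (R : realType) (d : nat) (alpha : 'I_d -> nat) (w : 'rV[R]_d) : R :=
  \prod_(i < d) w ord0 i ^+ alpha i.

(* D_x^alpha sigma_k(omega . x + b), as fixed in the context:
   k!/(k-|alpha|)! (omega.x+b)^(k-|alpha|) omega^alpha if omega.x+b >= 0, else 0
   (with 0^0 = 1). *)
Definition datom (R : realType) (d k : nat) (alpha : 'I_d -> nat)
    (x : 'rV[R]_d) (p : param R d) : R :=
  let t := dotv p.1 x + p.2 in
  if 0 <= t then
    ((k`!)%:R / ((k - mi_abs alpha)`!)%:R) * t ^+ (k - mi_abs alpha) * mi_pow alpha p.1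
  else 0.

(* D_x^alpha of the integral representation x |-> \int sigma_k(omega.x+b) dtau,
   computed by differentiating under the integral sign (atom-wise). *)
Definition dint (R : realType) (d k : nat) (alpha : 'I_d -> nat)
    (tau : probability (param R d) R) (x : 'rV[R]_d) : R :=
  Rintegral tau setT (datom k alpha x).

(* Main.v *)
(* The empirical measure is thinned by repeated partial colouring: the light
   points of a discrete measure get colours chi in {-1, 0, 1}, a positive fraction
   of them nonzero, and the weights a are replaced by a (1 + chi), up to sign and
   normalisation. This removes a positive fraction of the points at the cost of the
   discrepancy of chi, which is kept of order N^(1/2 - (2(k-|alpha|)+1)/(2d))
   times the size of a weight; the errors sum geometrically down to n points.

   The discrepancy is controlled by chaining. At scale 4^-l the ball has a net of
   O(4^(ld)) points such that every x is within O(4^-l) of a net point from which it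
   is separated by at most N 4^-l of the hyperplanes omega.x + b = 0 (Haussler's
   packing lemma, applied to these hyperplanes and a grid of coordinate
   hyperplanes). Passing from one scale to the next changes sigma_k(omega.x + b),
   up to polynomials, only for the separated hyperplanes, where omega.x + b is
   O(4^-l). The entropy method gives chi with all these increments small: far below
   their standard deviation at the scales with fewer than N net points, and not
   much above it at the finer ones.

   A general tau is first replaced by a discrete measure, with arbitrarily small
   error uniformly in x; since sigma_0 is discontinuous and tau may charge
   hyperplanes, this needs a finite partition of the parameters that respects every
   half-space up to a set of small measure. *)
Require Import Defs.
From HB Require Import structures.
From mathcomp Require Import all_boot all_order all_algebra.
From mathcomp Require Import all_classical all_reals all_analysis.
From mathcomp Require Import measurable_realfun zify ring lra.
Set Implicit Arguments. Unset Strict Implicit. Unset Printing Implicit Defensive.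
Import Order.TTheory GRing.Theory Num.Theory.
Import numFieldNormedType.Exports.

(** * One-inclusion graphs and Haussler's packing lemma *)

(** The exponent comes from one Euclidean norm. With m = k - |alpha|, an increment at scale 4^-l has
    O(N 4^-l) nonzero entries of size O(4^-(lm)), so under random signs its standard deviation is of
    order sqrt(N) 2^-(l(2m+1)). At the critical level L, where 4^(Ld) is comparable to N, this is
    N^(1/2 - (2m+1)/(2d)).

    The widths granted to the levels must make two series converge: the errors, and the entropy
    costs weighted by the number 4^(ld) of tests. Below L a width smaller by a factor costs only its
    logarithm, so it may shrink geometrically in L - l while the number of tests falls by 4^d per
    level. Above L the cost is exponentially small in the width, so a width growing like (3/2)^(l-L)
    outweighs any geometric growth of the nets and still loses to the decay of the standard
    deviation.

    One colouring has to serve every order of derivative. The tests therefore run over all words of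
    length at most k; this family is also closed under re-expanding the polynomial factor around
    another point, which appends letters and lowers the power by as many. *)

Lemma leq_expn2r m n e : m <= n -> m ^ e <= n ^ e.
Proof. by case: e => // e mn; rewrite leq_exp2r. Qed.

Section VC.
(* The lemmas of finset and fintype are otherwise shadowed by classical_sets. *)
Import mathcomp.boot.fintype mathcomp.boot.finset.
Variable T : finType.
Implicit Types (S : {set {set T}}) (A B D : {set T}) (x : T).

Definition shatters S D := forall B, B \subset D -> exists2 A, A \in S & A :&: D = B.

(** The edges in direction [x] of the one-inclusion graph on [S], each represented by its endpoint
    without [x]. *)
Definition edges S x := [set A in S | (x \notin A) && (x |: A \in S)].

Definition drop_elt S x := [set A :\ x | A in S].

(** Let S0 be the members without [x], and S1 those with [x], stripped of it. Dropping [x] gives the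
    union of S0 and S1, and the edges are their intersection. *)
Lemma card_drop_elt S x : #|S| = #|drop_elt S x| + #|edges S x|.
Proof.
rewrite -(cardsID [set A : {set T} | x \in A] S).
have -> : S :\: [set A : {set T} | x \in A] = [set A in S | x \notin A].
  by apply/setP => A; rewrite !inE andbC.
have -> : #|S :&: [set A : {set T} | x \in A]| =
          #|[set A : {set T} | (x \notin A) && (x |: A \in S)]|.
  rewrite -(card_in_imset (f := fun A => A :\ x) (D := S :&: [set A : {set T} | x \in A])); last first.
    move=> A B; rewrite !inE => /andP[_ xA] /andP[_ xB] eAB.
    by rewrite -(setD1K xA) eAB setD1K.
  congr #|pred_of_set _|; apply/setP => B; rewrite !inE; apply/imsetP/andP.
    case=> A; rewrite !inE => /andP[AS xA] ->.
    by rewrite setD1K // !inE eqxx.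
  case=> xB BS; exists (x |: B); first by rewrite !inE BS eqxx.
  by rewrite setU1K.
have -> : drop_elt S x = [set A in S | x \notin A] :|:
      [set A : {set T} | (x \notin A) && (x |: A \in S)].
  apply/setP => B; rewrite !inE; apply/imsetP/idP.
    case=> A AS ->; case: (boolP (x \in A)) => xA.
      by rewrite setD1K // AS !inE eqxx orbT.
    by rewrite (setDidPl _) ?AS ?xA // disjoint_sym disjoints1.
  case/orP=> /andP[].
    move=> BS xB; exists B => //.
    by rewrite (setDidPl _) // disjoint_sym disjoints1.
  by move=> xB BS; exists (x |: B) => //; rewrite setU1K.
have -> : edges S x = [set A in S | x \notin A] :&:
      [set A : {set T} | (x \notin A) && (x |: A \in S)].
  by apply/setP => B; rewrite !inE; case: (x \in B); rewrite ?andbF ?andbT.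
by rewrite addnC -cardsUI.
Qed.

(** [card_drop_elt] is applied to the family of edges in direction [y]: dropping [x] leaves edges of
    the dropped family, and an edge between two of them is a square in directions [x] and [y], which
    can be read in either order. *)
Lemma card_edges_drop S x y : x != y ->
  #|edges S y| <= #|edges (drop_elt S x) y| + #|edges (edges S x) y|.
Proof.
move=> xy; rewrite (card_drop_elt _ x) leq_add //; apply: subset_leq_card.
  apply/subsetP => B /imsetP[A]; rewrite inE => /and3P[AS yA yAS] ->.
  rewrite inE; apply/and3P; split; first exact: (imset_f (fun A => A :\ x)).
    by rewrite !inE negb_and yA orbT.
  apply/imsetP; exists (y |: A) => //.
  by apply/setP => z; rewrite !inE; case: (z =P y) => // ->; rewrite eq_sym xy.
apply/subsetP => A; rewrite !inE => /and3P[/and3P[-> -> ->] xA /and3P[-> _]].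
by rewrite setUCA => ->; rewrite andbT negb_or xy /= xA.
Qed.

Lemma shatters_drop S x D : x \notin D -> shatters (drop_elt S x) D -> shatters S D.
Proof.
move=> xD sh B /sh[A /imsetP[A' A'S ->] <-]; exists A' => //.
apply/setP => z; rewrite !inE; case: eqP => // ->.
by rewrite (negbTE xD) !andbF.
Qed.

Lemma shatters_edges S x D : shatters (edges S x) D -> x \notin D /\ shatters S (x |: D).
Proof.
move=> sh.
have xD : x \notin D.
  apply/negP => xD; have [A] := sh D (subxx _).
  rewrite inE => /and3P[_ xA _] /setIidPr /subsetP /(_ _ xD) xA'.
  by rewrite xA' in xA.
split => // B BD; have [|A] := sh (B :\ x).
  by apply/subsetP => z; rewrite !inE => /andP[/negbTE zx /(subsetP BD)]; rewrite !inE zx.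
rewrite !inE => /and3P[AS xA xAS] eA.
have eB z : z != x -> (z \in A) && (z \in D) = (z \in B).
  by move/setP/(_ z): eA; rewrite !inE => -> ->.
case: (boolP (x \in B)) => xB; [exists (x |: A) => //|exists A => //].
  apply/setP => z; rewrite !inE; case: (eqVneq z x) => [->|zx]; first by rewrite xB.
  by rewrite -eB.
apply/setP => z; rewrite !inE; case: (eqVneq z x) => [->|zx] /=.
  by rewrite (negbTE xA) (negbTE xB).
by rewrite -eB.
Qed.

(* The common induction behind Sauer's bound and Haussler's bound on the number
   of edges of the one-inclusion graph: |S| = |drop| + |edges|, where passing to
   the edges in one direction lowers the VC dimension. *)
Lemma vc_bounds n : forall d D S, #|D| <= n -> (forall A, A \in S -> A \subset D) ->
  (forall B, shatters S B -> #|B| <= d) ->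
  #|S| <= n.+1 ^ d /\ \sum_(x in D) #|edges S x| <= d * #|S|.
Proof.
elim: n => [|n IHn] d D S.
  rewrite leqn0 cards_eq0 => /eqP -> SD vc; rewrite big_set0 exp1n; split => //.
  rewrite -(cards1 (set0 : {set T})); apply: subset_leq_card.
  by apply/subsetP => A /SD; rewrite subset0 inE.
move=> Dn SD vc.
case: (set_0Vmem D) => [D0|[x xD]].
  have [|||h1 h2] := IHn d D S => //; first by rewrite D0 cards0.
  by split => //; apply: leq_trans h1 _; apply: leq_expn2r.
have Dn' : #|D :\ x| <= n by move: Dn; rewrite (cardsD1 x) xD.
have dropD A : A \in drop_elt S x -> A \subset D :\ x.
  by case/imsetP => B /SD BD ->; apply: setSD.
have edgeD A : A \in edges S x -> A \subset D :\ x.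
  by rewrite inE => /and3P[/SD AD xA _]; rewrite subsetD1 AD.
have shD S' B : (forall A, A \in S' -> A \subset D :\ x) -> shatters S' B -> x \notin B.
  move=> h sh; apply/negP => xB; have [A /h /subsetP AS] := sh B (subxx _).
  by move/setIidPr/subsetP/(_ _ xB)/AS; rewrite !inE eqxx.
have [d1 d2] := IHn d _ (drop_elt S x) Dn' dropD (fun B h =>
  vc B (shatters_drop (shD _ _ dropD h) h)).
have sumE : \sum_(y in D) #|edges S y| <=
   #|edges S x| + (\sum_(y in D :\ x) #|edges (drop_elt S x) y|
                   + \sum_(y in D :\ x) #|edges (edges S x) y|).
  rewrite (big_setD1 x xD) /= leq_add2l -big_split /=; apply: leq_sum => y.
  by rewrite !inE => /andP[yx _]; apply: card_edges_drop; rewrite eq_sym.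
have cS := card_drop_elt S x.
(* Without edges in direction [x], dropping [x] is injective and the bound with the same [d]
   suffices. Otherwise an edge forces [d] to be positive, and the edges obey the bound with
   [d.-1]. *)
case: (set_0Vmem (edges S x)) => [E0|[A0 A0E]].
  rewrite E0 cards0 addn0 in cS; split.
    by rewrite cS; apply: leq_trans d1 _; apply: leq_expn2r.
  apply: leq_trans sumE _; rewrite {1}E0 cards0 add0n cS.
  rewrite [X in _ + X]big1 ?addn0 // => y _.
  by rewrite E0; apply/eqP; rewrite cards_eq0; apply/eqP/setP => A; rewrite !inE.
have vcE B : shatters (edges S x) B -> #|B| < d.
  by case/shatters_edges => xB /vc; rewrite cardsU1 xB.
have d0 : 0 < d.
  suff /vcE : shatters (edges S x) set0 by rewrite cards0.
  by move=> B; rewrite subset0 => /eqP ->; exists A0 => //; rewrite setI0.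
have vcE' B : shatters (edges S x) B -> #|B| <= d.-1.
  by move/vcE; rewrite -{1}(prednK d0) ltnS.
have [e1 e2] := IHn _ _ _ Dn' edgeD vcE'; split.
  rewrite cS -(prednK d0) [n.+2 ^ _]expnS.
  rewrite mulSn; apply: leq_trans (leq_add d1 e1) _; rewrite addnC; apply: leq_add.
    by apply: leq_expn2r.
  rewrite -{1}(prednK d0) expnS leq_mul2l /=.
  exact: leq_expn2r.
apply: leq_trans sumE _; apply: leq_trans (leq_add (leqnn _) (leq_add d2 e2)) _.
by rewrite addnCA -mulSn (prednK d0) -mulnDr -cS.
Qed.
End VC.

Lemma minn_sum_lt m a b : a <= m -> minn a b = \sum_(t < m) ((t < a) && (t < b)).
Proof.
move=> am; have {am} -> : minn a b = minn (minn a b) m by lia.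
elim: m => [|m IHm]; first by rewrite big_ord0 minn0.
by rewrite big_ord_recr -IHm /=; case: (ltnP m a); case: (ltnP m b); lia.
Qed.

Section WeightedEdges.
Import mathcomp.boot.fintype mathcomp.boot.finset.

(** Layer cake: the minimum of two weights counts the thresholds [t] whose superlevel set contains
    both endpoints. Each superlevel set inherits the VC bound, so the unweighted edge bound can be
    summed over [t]. *)
Lemma weighted_edges_bound (T : finType) (w : {set T} -> nat) d :
  (forall D, shatters [set A | 0 < w A] D -> #|D| <= d) ->
  \sum_(x : T) \sum_(A : {set T} | x \notin A) minn (w A) (w (x |: A))
    <= d * \sum_(A : {set T}) w A.
Proof.
move=> vc; pose m := \sum_(A : {set T}) w A.
have wm A : w A <= m by rewrite /m (bigD1 A) //= leq_addr.
pose S (t : 'I_m) := [set A | t < w A].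
have vcS t D : shatters (S t) D -> #|D| <= d.
  move=> sh; apply: vc => B /sh[A]; rewrite inE => tA <-; exists A => //.
  by rewrite inE (leq_ltn_trans _ tA).
have -> : \sum_(x : T) \sum_(A : {set T} | x \notin A) minn (w A) (w (x |: A))
    = \sum_(t < m) \sum_(x in [set: T]) #|edges (S t) x|.
  rewrite exchange_big /=; under [RHS]eq_bigl do rewrite inE.
  apply: eq_bigr => x _.
  under eq_bigr do rewrite (minn_sum_lt _ (wm _)).
  rewrite exchange_big /=; apply: eq_bigr => t _.
  rewrite -sum1_card [RHS]big_mkcond [LHS]big_mkcond; apply: eq_bigr => A _.
  by rewrite !inE; case: (x \notin A) => /=; case: (t < w A); case: (t < _).
have -> : \sum_A w A = \sum_(t < m) #|S t|.
  rewrite (eq_bigr (fun A => \sum_(t < m) (t < w A))); last first.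
    by move=> A _; rewrite -{1}(minnn (w A)) (minn_sum_lt _ (wm _)); apply: eq_bigr => t _; rewrite andbb.
  rewrite exchange_big; apply: eq_bigr => t _ /=.
  by rewrite -sum1_card big_mkcond [RHS]big_mkcond; apply: eq_bigr => A _; rewrite inE; case: ltnP.
rewrite big_distrr; apply: leq_sum => t _ /=.
by have [|A _|D|_] := @vc_bounds T #|T| d setT (S t); rewrite ?cardsT ?subsetT //; exact: vcS.
Qed.
End WeightedEdges.

Section Packing.
Import mathcomp.boot.fintype mathcomp.boot.finset.
Variables (X I : finType) (h : I -> X -> bool) (q d s : nat).
Hypothesis X0 : 0 < #|X|.
Hypothesis sep : forall i j, i != j -> #|X| <= q * #|[set x | h i x != h j x]|.
Implicit Types (f : {ffun 'I_s -> X}) (a : 'I_s) (z : X) (B : {set 'I_s}).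

Definition trace f i : {set 'I_s} := [set a | h i (f a)].
Definition weight f B := #|[set i | trace f i == B]|.
Definition upd f a z : {ffun 'I_s -> X} := [ffun b => if b == a then z else f b].
Definition edge_weight f a := \sum_(B : {set 'I_s} | a \notin B)
  minn (weight f B) (weight f (a |: B)).

Hypothesis vc : forall f D, shatters [set trace f i | i : I] D -> #|D| <= d.

Lemma sum_edge_weight f : \sum_a edge_weight f a <= d * #|I|.
Proof.
have -> : #|I| = \sum_B weight f B.
  rewrite -sum1_card (partition_big (trace f) predT) //=.
  by apply: eq_bigr => B _; rewrite /weight -sum1dep_card.
apply: weighted_edges_bound => D sh; apply: (vc (f := f)) => B /sh[A].
rewrite inE card_gt0 => /set0Pn[i]; rewrite inE => /eqP <- <-.
by exists (trace f i) => //; apply: imset_f.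
Qed.

(** A random [z] cuts a separated class into two parts of sizes p and r. The sum of 2 p r over [z]
    counts the ordered pairs of indices that are told apart, at least |X| b (b-1) / q by separation,
    while p r is at most b min(p, r). The additive |X| makes up for b - 1 in place of b. *)
Lemma upd_split (C : {set I}) : 0 < #|C| ->
  #|X| * #|C| <= 2 * q * (\sum_z minn #|[set i in C | ~~ h i z]| #|[set i in C | h i z]|) + #|X|.
Proof.
move=> C0; set b := #|C|.
pose p z := #|[set i in C | ~~ h i z]|; pose r z := #|[set i in C | h i z]|.
have pr z : p z * r z <= b * minn (p z) (r z).
  have pb : p z <= b by apply: subset_leq_card; apply/subsetP => i; rewrite inE => /andP[].
  have rb : r z <= b by apply: subset_leq_card; apply/subsetP => i; rewrite inE => /andP[].
  by case: (leqP (p z) (r z)) => _; [rewrite mulnC|]; rewrite leq_mul2r ?pb ?rb orbT.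
have e2 : \sum_(i in C) \sum_(j in C) #|[set x | h i x != h j x]| = 2 * \sum_z p z * r z.
  transitivity (\sum_z \sum_(i in C) \sum_(j in C) (h i z != h j z)).
    rewrite [RHS]exchange_big /=; apply: eq_bigr => i _; rewrite [RHS]exchange_big /=; apply: eq_bigr => j _.
    by rewrite -sum1_card big_mkcond; apply: eq_bigr => z _; rewrite inE; case: eqP.
  rewrite big_distrr; apply: eq_bigr => z _ /=.
  have cnt (P : pred I) : #|[set i in C | P i]| = \sum_(i in C) P i.
    by rewrite -sum1_card big_mkcond [RHS]big_mkcond; apply: eq_bigr => i _; rewrite inE; case: (i \in C); case: (P i).
  rewrite mul2n -addnn {2}[p z * r z]mulnC /p /r !cnt !big_distrlr -big_split /=.
  apply: eq_bigr => i _; rewrite -big_split; apply: eq_bigr => j _ /=.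
  by case: (h i z); case: (h j z).
have e3 : #|X| * (b * b.-1) <= q * \sum_(i in C) \sum_(j in C) #|[set x | h i x != h j x]|.
  have {1}-> : b = \sum_(i in C) 1 by rewrite sum1_card.
  rewrite big_distrl big_distrr big_distrr /=; apply: leq_sum => i iC.
  rewrite mul1n (bigD1 i) //= mulnDr; apply: leq_trans (leq_addl _ _).
  rewrite /b (cardD1 i) iC /= -[X in _ * X <= _]sum1_card !big_distrr /=.
  rewrite (eq_bigl (fun j => (j \in C) && (j != i))); last by move=> j; rewrite inE andbC.
  by apply: leq_sum => j /andP[_ ji]; rewrite muln1; apply: sep; rewrite eq_sym.
rewrite e2 in e3.
have e4 : #|X| * b.-1 <= 2 * q * \sum_z minn (p z) (r z).
  rewrite -(leq_pmul2l C0) -/b mulnCA (leq_trans e3) //.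
  have hpr : \sum_z p z * r z <= b * \sum_z minn (p z) (r z).
    by rewrite big_distrr; apply: leq_sum => z _; apply: pr.
  by rewrite [q * _]mulnCA [X in _ <= X]mulnC -!mulnA leq_mul2l leq_mul2l [_ * b]mulnC hpr !orbT.
have -> : #|X| * b = #|X| * b.-1 + #|X| by rewrite addnC -mulnS prednK.
by rewrite leq_add2r.
Qed.

Lemma trace_upd f a z i : trace (upd f a z) i =
  if h i z then a |: (trace f i :\ a) else trace f i :\ a.
Proof.
apply/setP => b; rewrite !inE ffunE; case: (eqVneq b a) => [->|ba]; case: ifP => // hz.
- by rewrite !inE eqxx.
- by rewrite !inE eqxx.
- by rewrite !inE (negbTE ba).
- by rewrite !inE ba.
Qed.

(** Indices are grouped by their trace outside [a]; resampling the point at [a] splits each class as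
    in [upd_split]. The additive terms are paid once per nonempty class, and there are no more
    classes than traces. *)
Lemma sum_upd_edge_weight f a : #|X| * #|I| <=
  2 * q * (\sum_z edge_weight (upd f a z) a) + #|X| * #|[set trace f i | i : I]|.
Proof.
pose cls B := [set i | trace f i :\ a == B].
have wE z B : a \notin B -> weight (upd f a z) B = #|[set i in cls B | ~~ h i z]|.
  move=> aB; apply: eq_card => i; rewrite !inE trace_upd; case: ifP => hz.
    by rewrite andbF; apply/negbTE; apply: contra aB => /eqP <-; rewrite !inE eqxx.
  by rewrite andbT.
have wE' z B : a \notin B -> weight (upd f a z) (a |: B) = #|[set i in cls B | h i z]|.
  move=> aB; apply: eq_card => i; rewrite !inE trace_upd; case: ifP => hz.
    rewrite andbT; apply/eqP/eqP => [|-> //] /setP e; apply/setP => b.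
    move: (e b); rewrite !inE; case: (eqVneq b a) => [->|//].
    by rewrite (negbTE aB).
  rewrite andbF; apply/negbTE/negP => /eqP/setP/(_ a).
  by rewrite !inE eqxx.
rewrite -[#|I|]sum1_card (partition_big (fun i => trace f i :\ a) (fun B => a \notin B)) /=; last first.
  by move=> i _; rewrite !inE eqxx.
have -> : \sum_z edge_weight (upd f a z) a = \sum_(B : {set 'I_s} | a \notin B)
   \sum_z minn #|[set i in cls B | ~~ h i z]| #|[set i in cls B | h i z]|.
  rewrite [RHS]exchange_big; apply: eq_bigr => z _; apply: eq_bigr => B aB.
  by rewrite wE ?wE'.
have card_le : \sum_(B : {set 'I_s} | a \notin B) (0 < #|cls B|) <= #|[set trace f i | i : I]|.
  rewrite -big_mkcondr sum1dep_card /=.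
  apply: leq_trans _ (leq_imset_card (fun A : {set 'I_s} => A :\ a) _); apply: subset_leq_card.
  apply/subsetP => B; rewrite inE card_gt0 => /andP[_ /set0Pn[i]].
  by rewrite inE => /eqP <-; apply: imset_f; apply: imset_f.
apply: leq_trans _ (leq_add (leqnn _) (leq_mul (leqnn _) card_le)).
rewrite !big_distrr -big_split /=; apply: leq_sum => B aB.
rewrite -/(cls B) sum1dep_card -/(cls B).
case: (posnP #|cls B|) => [->|C0]; first by rewrite muln0.
by rewrite muln1; apply: upd_split.
Qed.

(** Exchanging [f a] with a fresh [z] is an involution of the pairs (f, z): resampling one
    coordinate preserves the uniform distribution. *)
Lemma sum_upd (G : {ffun 'I_s -> X} -> nat) a :
  \sum_f \sum_z G (upd f a z) = #|X| * \sum_f G f.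
Proof.
pose phi (u : {ffun 'I_s -> X} * X) := (upd u.1 a u.2, u.1 a).
have phiK : involutive phi.
  case=> f z; rewrite /phi /=; congr pair; last by rewrite ffunE eqxx.
  by apply/ffunP => b; rewrite !ffunE; case: eqP => // ->.
rewrite pair_bigA /= (reindex_inj (inv_inj phiK)) /=.
rewrite -(pair_bigA _ (fun f z => G (upd (upd f a z) a (f a)))) /= big_distrr /=.
apply: eq_bigr => f _; rewrite -[#|X|]sum1_card big_distrl /=; apply: eq_bigr => z _.
by rewrite mul1n; congr G; apply/ffunP => b; rewrite !ffunE; case: eqP => // ->.
Qed.

(* Haussler's packing lemma, by Chazelle's argument: a random sample with
   replacement of size s is expected to give the one-inclusion graph of the
   traces a total edge weight that is both at most d |I| and proportional to s. *)
Lemma packing_sample : s * #|I| <= 2 * q * (d * #|I|) + s * s.+1 ^ d.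
Proof.
set F := \sum_(f : {ffun 'I_s -> X}) 1.
have F0 : 0 < F by rewrite /F sum1_card card_ffun expn_gt0 X0.
have traceB f : #|[set trace f i | i : I]| <= s.+1 ^ d.
  by have [|A _|D /vc|] := @vc_bounds _ s d setT [set trace f i | i : I]; rewrite ?cardsT ?card_ord ?subsetT.
have key a : F * #|I| <= 2 * q * (\sum_f edge_weight f a) + F * s.+1 ^ d.
  rewrite -(leq_pmul2l X0).
  have -> : #|X| * (F * #|I|) = \sum_(f : {ffun 'I_s -> X}) #|X| * #|I|.
    by rewrite mulnCA /F big_distrl /=; apply: eq_bigr => f _; rewrite mul1n.
  have /leq_trans-> // : \sum_(f : {ffun 'I_s -> X}) #|X| * #|I| <= \sum_f
      (2 * q * (\sum_z edge_weight (upd f a z) a) + #|X| * #|[set trace f i | i : I]|).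
    by apply: leq_sum => f _; apply: sum_upd_edge_weight.
  rewrite big_split /= -big_distrr /= (sum_upd (fun f => edge_weight f a) a) mulnDr mulnCA leq_add2l -big_distrr /= leq_mul2l.
  by rewrite /F big_distrl /= leq_sum ?orbT // => f _; rewrite mul1n.
rewrite -(leq_pmul2l F0) mulnCA.
have -> : s * (F * #|I|) = \sum_(a < s) F * #|I| by rewrite sum_nat_const card_ord.
have /leq_trans-> // : \sum_(a < s) F * #|I| <=
    \sum_(a < s) (2 * q * (\sum_f edge_weight f a) + F * s.+1 ^ d).
  by apply: leq_sum => a _; apply: key.
rewrite big_split /= sum_nat_const card_ord mulnDr [s * (F * _)]mulnCA leq_add2r.
rewrite -big_distrr /= [F * _]mulnCA leq_mul2l exchange_big /=.
by rewrite /F big_distrl /= leq_sum ?orbT // => f _; rewrite mul1n; apply: sum_edge_weight.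
Qed.
End Packing.

(** The sample size 4 q d is chosen so that the term 2 q d |I| of [packing_sample] is half of the
    left side and can be absorbed. *)
Lemma packing_bound (X I : finType) (h : I -> X -> bool) (q d : nat) :
  0 < #|X| -> 0 < q -> 0 < d ->
  (forall i j, i != j -> #|X| <= q * #|[set x | h i x != h j x]|) ->
  (forall s (f : {ffun 'I_s -> X}) D, shatters [set trace h f i | i : I] D -> #|D| <= d) ->
  #|I| <= 2 * (4 * q * d).+1 ^ d.
Proof.
move=> X0 q0 d0 sep vc; have := packing_sample X0 sep (vc (4 * q * d)).
set M := #|I|; set P := _ ^ d => hM.
have qd0 : 0 < 2 * (q * d) by rewrite !muln_gt0 q0 d0.
by rewrite -(leq_pmul2l qd0); move: hM; rewrite -!mulnA; lia.
Qed.

Local Open Scope classical_set_scope.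
Local Open Scope ring_scope.

(** * Partial colouring by the entropy method *)

Section PartialColouring.
Variables (R : realType) (I : finType).
Implicit Types (e : {ffun I -> bool}) (v : I -> R) (z w c lam s : R).

Definition signed_sum e v : R := \sum_i (-1) ^+ e i * v i.

(* Rounds to cells of width at most 1; the cell of 0 is centred, so that a sum much
   smaller than the width has code 0. *)
Definition code z : nat :=
  if `|z| < 2^-1 then 0%N else ((Num.truncn `|z|).*2 + (z < 0)%R).+1.

Lemma code_eq z z' : code z = code z' -> `|z - z'| < 1.
Proof.
rewrite /code; case: (ltP `|z|) => hz; case: (ltP `|z'|) => hz' //.
  by move=> _; rewrite (le_lt_trans (ler_normB _ _)) //; lra.
move=> e.
have [e1 e2] : (z < 0) = (z' < 0) /\ Num.truncn `|z| = Num.truncn `|z'|.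
  by move: e; case: (z < 0); case: (z' < 0); lia.
have /andP[a1 a2] := truncn_itv (normr_ge0 z).
have /andP[b1 b2] := truncn_itv (normr_ge0 z').
rewrite -e2 in b1 b2.
move: a1 a2 b1 b2; rewrite -natr1; set t := _%:R => a1 a2 b1 b2.
case: (ltP z 0) e1 => h1 /esym h2.
  have h2' : z' < 0 by rewrite h2.
  move: a1 a2 b1 b2; rewrite (ltr0_norm h1) (ltr0_norm h2') => *; rewrite ltr_norml; lra.
have h2' : 0 <= z' by rewrite leNgt h2.
by move: a1 a2 b1 b2; rewrite (ger0_norm h1) (ger0_norm h2') => *; rewrite ltr_norml; lra.
Qed.

Lemma code_le z : (code z)%:R <= 2 * `|z| + 2.
Proof.
rewrite /code; case: ltP => h; first by rewrite addr_ge0 // mulr_ge0.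
have /andP[a1 a2] := truncn_itv (normr_ge0 z).
have : ((Num.truncn `|z|).*2 + (z < 0)%R).+1%:R <= 2 * (Num.truncn `|z|)%:R + 2 :> R.
  by rewrite -natrM -natrD ler_nat; case: (z < 0); lia.
by move/le_trans; apply; lra.
Qed.

Lemma code_gt0 z : (0 < code z)%N -> 2^-1 <= `|z|.
Proof. by rewrite /code; case: ltP. Qed.

(* By Kraft's inequality kappa is a code length for the values of code; c bounds its
   average over all sign vectors. *)
Definition test_cost v w c := exists kappa : nat -> R,
  [/\ forall m, 0 <= kappa m,
      forall M, \sum_(m < M) expR (- kappa m) <= 1
    & \sum_e kappa (code (signed_sum e v / w)) <= c * 2 ^+ #|I|].

Lemma expR_neg_le z : (1 + z) * expR (- z) <= 1.
Proof.
apply: le_trans (ler_wpM2r (expR_ge0 _) (expR_ge1Dx z)) _.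
by rewrite expRxMexpNx_1.
Qed.

(** The constant 2 instead of the optimal 1/2 leaves room for a proof from [expR_ge1Dx]: for z^2 at
    most 1/2 the left side is at most 2/(1 - z^2), and otherwise |z| is at most 2 z^2. *)
Lemma cosh_le z : expR z + expR (- z) <= 2 * expR (2 * z ^+ 2).
Proof.
have [h|h] := lerP (z ^+ 2) (2^-1).
  have hp : 0 < 1 - z ^+ 2 by lra.
  have inv (x : R) : x < 1 -> expR x <= (1 - x)^-1.
    move=> x1; rewrite -[expR x]invrK lef_pV2 ?posrE ?subr_gt0 ?invr_gt0 ?expR_gt0 //.
    by rewrite -expRN; apply: expR_ge1Dx.
  have z1 : z < 1 by nra.
  have z2 : - z < 1 by nra.
  apply: le_trans (lerD (inv _ z1) (inv _ z2)) _.
  have -> : (1 - z)^-1 + (1 - - z)^-1 = 2 / (1 - z ^+ 2).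
    by field; rewrite !gt_eqF //; nra.
  rewrite ler_pM2l // -[expR _]invrK lef_pV2 ?posrE ?invr_gt0 ?expR_gt0 //.
  rewrite -expRN.
  have : (1 + 2 * z ^+ 2) * expR (- (2 * z ^+ 2)) <= 1 by apply: expR_neg_le.
  have := @expR_ge0 _ (- (2 * z ^+ 2)); set y := expR _; set x := z ^+ 2.
  have : 0 <= x by apply: sqr_ge0.
  rewrite -/x in h *; move=> x0 y0 hxy.
  nra.
have : expR z <= expR (2 * z ^+ 2) by rewrite ler_expR; nra.
have : expR (- z) <= expR (2 * z ^+ 2) by rewrite ler_expR; nra.
lra.
Qed.

Lemma exp_moment v z :
  \sum_e expR (z * signed_sum e v) <= 2 ^+ #|I| * expR (2 * z ^+ 2 * \sum_i v i ^+ 2).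
Proof.
have -> : \sum_e expR (z * signed_sum e v) =
    \prod_i \sum_(b : bool) expR (z * ((-1) ^+ b * v i)).
  rewrite bigA_distr_bigA; apply: eq_bigr => e _ /=.
  by rewrite /signed_sum mulr_sumr expR_sum.
rewrite mulr_sumr expR_sum -prodr_const -big_split /=.
apply: ler_prod => i _; rewrite big_bool /= addr_ge0 ?expR_ge0 //=.
rewrite expr1 expr0 mul1r mulN1r mulrN addrC; apply: le_trans (cosh_le _) _.
by rewrite exprMn mulrA.
Qed.

(** Here 18 is 2 * 3^2 from [exp_moment]. The rate 3 is what [cost_large] spends: 2 against the
    threshold |Z| >= lam/2, and 1 to dominate a linear term. *)
Lemma exp3_moment v s : 0 < s -> \sum_i v i ^+ 2 <= s ^+ 2 ->
  \sum_e expR (3 * `|signed_sum e v / s|) <= 2 * expR 18 * 2 ^+ #|I|.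
Proof.
move=> s0 vs.
have vs' : \sum_i (v i / s) ^+ 2 <= 1.
  under eq_bigr do rewrite expr_div_n.
  by rewrite -mulr_suml ler_pdivrMr ?exprn_gt0 // mul1r.
have sE e : signed_sum e v / s = signed_sum e (fun i => v i / s).
  by rewrite /signed_sum mulr_suml; apply: eq_bigr => i _; rewrite mulrA.
have hz z : z ^+ 2 = 9 -> \sum_e expR (z * (signed_sum e v / s)) <= expR 18 * 2 ^+ #|I|.
  move=> z3; under eq_bigr do rewrite sE.
  apply: le_trans (exp_moment _ _) _; rewrite mulrC ler_wpM2r ?exprn_ge0 // ler_expR z3.
  by lra.
have h1 : \sum_e expR (3 * (signed_sum e v / s)) <= expR 18 * 2 ^+ #|I| by apply: hz; lra.
have h2 : \sum_e expR (- 3 * (signed_sum e v / s)) <= expR 18 * 2 ^+ #|I| by apply: hz; lra.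
rewrite [2 * _ * _]mulrC mulrCA [_ * expR 18]mulrC -/(2 * _) mulrDl mul1r.
apply: le_trans (lerD h1 h2); rewrite -big_split /=; apply: ler_sum => e _.
have p1 := expR_ge0 (3 * (signed_sum e v / s)).
have p2 := expR_ge0 (- 3 * (signed_sum e v / s)).
have [h|h] := ger0P (signed_sum e v / s); first by lra.
have -> : 3 * - (signed_sum e v / s) = - 3 * (signed_sum e v / s) by ring.
by lra.
Qed.

Lemma geometric_code_sum lam M : 0 < lam -> \sum_(m < M) expR (- (lam * m%:R)) <= 1 + lam^-1.
Proof.
move=> l0; have x1 : expR (- lam) < 1 by rewrite expR_lt1 oppr_lt0.
under eq_bigr do rewrite -mulNr mulrC expRM_natl.
apply: (@le_trans _ _ (1 - expR (- lam))^-1).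
  rewrite -[X in _ <= X]mul1r ler_pdivlMr ?subr_gt0 //.
  have := subrX1 (expR (- lam)) M; rewrite -opprB => /eqP.
  rewrite -[_ - 1]opprB mulNr eqr_opp mulrC => /eqP <-.
  by rewrite gerBl exprn_ge0 // expR_ge0.
have : (1 + lam) * expR (- lam) <= 1 by apply: expR_neg_le.
move=> h; rewrite -[X in _ <= X]invrK lef_pV2 ?posrE ?subr_gt0 ?invr_gt0 ?addr_gt0 ?invr_gt0 //.
have -> : (1 + lam^-1)^-1 = lam / (1 + lam) by field; rewrite !gt_eqF //; lra.
by rewrite ler_pdivrMr; lra.
Qed.

(** A width [lam] below the standard deviation gives codes of typical size 1/[lam]. The lengths
    ln(2/[lam]) + [lam] m, those of a geometric law of that mean, cost ln(1/[lam]) + O(1) on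
    average. *)
Lemma cost_small lam v s : 0 < s -> \sum_i v i ^+ 2 <= s ^+ 2 -> 0 < lam -> lam <= 1 ->
  test_cost v (lam * s) (ln 2 + 2 + 4 * expR 18 - ln lam).
Proof.
move=> s0 vs l0 l1.
have l2 : 1 <= 2 / lam by rewrite ler_pdivlMr //; lra.
have ln0 : 0 <= ln (2 / lam) by apply: ln_ge0.
exists (fun m => ln (2 / lam) + lam * m%:R); split=> [m|M|].
- by rewrite addr_ge0 // mulr_ge0 // ltW.
- under eq_bigr do rewrite opprD expRD.
  rewrite -mulr_sumr expRN lnK ?posrE ?(lt_le_trans _ l2) // invf_div.
  rewrite mulrAC ler_pdivrMr // mul1r.
  apply: le_trans (ler_wpM2l (ltW l0) (geometric_code_sum M l0)) _.
  by rewrite mulrDr mulr1 mulfV ?gt_eqF //; lra.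
rewrite lnM ?posrE ?invr_gt0 // lnV ?posrE //.
have -> : (ln 2 + 2 + 4 * expR 18 - ln lam) * 2 ^+ #|I| =
    \sum_(e : {ffun I -> bool}) (ln 2 - ln lam + 2) + 2 * (2 * expR 18 * 2 ^+ #|I|).
  rewrite sumr_const card_ffun card_bool -[_ *+ (2 ^ _)%N]mulr_natr natrX; ring.
apply: le_trans (lerD (lexx _) (ler_wpM2l _ (exp3_moment s0 vs))) => //.
rewrite mulr_sumr -big_split /=; apply: ler_sum => e _.
rewrite -[X in _ <= X]addrA lerD2l invfM mulrA.
set Z := signed_sum e v / s; rewrite [_ / lam / s]mulrAC -/Z.
apply: le_trans (ler_wpM2l (ltW l0) (code_le _)) _.
rewrite normrM normfV (gtr0_norm l0) mulrDr mulrCA [lam * (_ / lam)]mulrC divfK ?gt_eqF //.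
have := expR_ge1Dx (3 * `|Z|); have := normr_ge0 Z; nra.
Qed.

(** At [lam] standard deviations the code is almost always 0, so 0 gets the tiny length 2
    exp(-[lam]), and Kraft's inequality leaves mass exp(-[lam]) for the others, of length [lam] + m.
    Those occur only for |Z| >= [lam]/2, so the exponential moment makes their expected length
    O(exp(-[lam])). *)
Lemma cost_large lam v s : 0 < s -> \sum_i v i ^+ 2 <= s ^+ 2 -> 1 <= lam ->
  test_cost v (lam * s) ((2 + 16 * expR 18) * expR (- lam)).
Proof.
move=> s0 vs l1; have l0 : 0 < lam by lra.
set y := expR (- lam).
have y0 : 0 < y by apply: expR_gt0.
have y2 : y <= 2^-1.
  have : (1 + lam) * y <= 1 by apply: expR_neg_le.
  nra.
exists (fun m => if m is 0%N then 2 * y else lam + m%:R); split=> [[|m]|M|].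
- by rewrite mulr_ge0 // ltW.
- by rewrite addr_ge0 // ltW.
- case: M => [|M]; first by rewrite big_ord0.
  rewrite big_ord_recl /=.
  have -> : \sum_(i < M) expR (- (lam + (bump 0 i)%:R)) = y * expR (-1) * \sum_(i < M) expR (- (1 * i%:R)).
    rewrite mulr_sumr; apply: eq_bigr => i _.
    by rewrite -!expRD mul1r /bump /= add1n -natr1; congr expR; ring.
  have g := @geometric_code_sum 1 M ltr01.
  have e1 : expR (-1) <= 2^-1 :> R.
    have : (1 + 1) * expR (-1) <= 1 :> R by apply: expR_neg_le.
    lra.
  have h2 : y * expR (-1) * \sum_(i < M) expR (- (1 * i%:R)) <= y.
    rewrite -mulrA ler_piMr ?(ltW y0) //.
    have := @expR_ge0 R (-1); move: g; rewrite invr1.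
    have : 0 <= \sum_(i < M) expR (- (1 * i%:R)) :> R by apply: sumr_ge0 => i _; apply: expR_ge0.
    nra.
  have h3 : expR (- (2 * y)) <= 1 - y.
    have : (1 + 2 * y) * expR (- (2 * y)) <= 1 by apply: expR_neg_le.
    have := @expR_ge0 R (- (2 * y)); nra.
  lra.
have -> : (2 + 16 * expR 18) * y * 2 ^+ #|I| =
    \sum_(e : {ffun I -> bool}) (2 * y) + 8 * y * (2 * expR 18 * 2 ^+ #|I|).
  rewrite sumr_const card_ffun card_bool -[_ *+ (2 ^ _)%N]mulr_natr natrX; ring.
apply: le_trans (lerD (lexx _) (ler_wpM2l _ (exp3_moment s0 vs))); last by rewrite mulr_ge0 // ltW.
rewrite mulr_sumr -big_split /=; apply: ler_sum => e _.
rewrite invfM mulrA [_ / lam / s]mulrAC; set Z := signed_sum e v / s.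
case E: (code _) => [|m].
  by rewrite lerDl !mulr_ge0 ?expR_ge0 // ltW.
have := @code_gt0 (Z / lam); rewrite E => /(_ isT); rewrite normrM normfV (gtr0_norm l0).
rewrite ler_pdivlMr // => hZ.
have := code_le (Z / lam); rewrite E normrM normfV (gtr0_norm l0) => hc.
have hc' : `|Z| / lam <= `|Z| by rewrite ler_pdivrMr // ler_peMr.
apply: (@le_trans _ _ (8 * `|Z|)); first by lra.
rewrite ler_wpDl ?mulr_ge0 ?(ltW y0) // -mulrA ler_pM2l // -expRD.
have -> : - lam + 3 * `|Z| = (2 * `|Z| - lam) + `|Z| by ring.
rewrite expRD; have := expR_ge1Dx (2 * `|Z| - lam); have := expR_ge1Dx `|Z|.
have := normr_ge0 Z; nra.
Qed.
End PartialColouring.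

(** Used as in Markov's inequality: a set of sign vectors within Hamming distance D of [e] has at
    most 4^D (5/4)^N elements. *)
Lemma hamming_sum (R : realType) (I : finType) (e : {ffun I -> bool}) :
  \sum_(e' : {ffun I -> bool}) (4^-1 : R) ^+ #|[pred i | e i != e' i]| = (5 / 4) ^+ #|I|.
Proof.
transitivity (\sum_(e' : {ffun I -> bool}) \prod_i (if e i != e' i then 4^-1 else 1 : R)).
  by apply: eq_bigr => e' _; rewrite -big_mkcond /= prodr_const.
rewrite -(bigA_distr_bigA (fun i b => if e i != b then 4^-1 else 1 : R)) /=.
rewrite -prodr_const; apply: eq_bigr => i _.
by rewrite big_bool /=; case: (e i) => /=; field.
Qed.

(** The contradiction closing the count, where 7/5 is 2 divided by 10/7. For D = 0 it needs (7/5)^N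
    > 2, which first holds at N = 3. *)
Lemma hamming_numeric (R : realType) (N D : nat) : (3 <= N)%N -> (8 * D < N)%N ->
  2 * 4 ^+ D < (7 / 5) ^+ N :> R.
Proof.
move=> N3 DN.
have h75 : 1 <= 7 / 5 :> R by lra.
case: D DN => [|D] DN.
  by apply: lt_le_trans (_ : _ < (7 / 5) ^+ 3) _; rewrite ?ler_weXn2l //; lra.
apply: lt_le_trans (_ : _ < (7 / 5) ^+ (8 * D.+1)) _; last by rewrite ler_weXn2l // ltnW.
rewrite exprM; apply: lt_le_trans (_ : _ < (2 * 4) ^+ D.+1 * (3 / 2)) _.
  rewrite exprMn; have : 2 <= 2 ^+ D.+1 :> R by rewrite exprS ler_peMr // exprn_ege1 //; lra.
  have : 0 < 4 ^+ D.+1 :> R by apply: exprn_gt0.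
  set a := 4 ^+ _; set b := 2 ^+ _ => a0 b2; nra.
have -> : (7 / 5) ^+ 8 = 8 * ((7 / 5) ^+ 8 / 8) :> R by field.
have -> : 2 * 4 = 8 :> R by ring.
rewrite exprMn [_ * (3 / 2)]mulrC.
rewrite mulrC ler_wpM2l ?exprn_ge0 //.
have h : (3 / 2) <= (7 / 5) ^+ 8 / 8 :> R by lra.
apply: (le_trans h); rewrite -[X in X <= _]expr1 ler_weXn2l //; lra.
Qed.

(* The entropy method in counting form: half of all sign vectors have small total
   code length, hence share at most exp(N/8) codes, and a class of 2^N exp(-N/8)/2
   sign vectors with one code cannot fit in a Hamming ball of radius N/8. *)
Lemma partial_colouring (R : realType) (I J : finType) (v : J -> I -> R) (w c : J -> R) :
  (3 <= #|I|)%N -> (forall j, 0 < w j) -> (forall j, test_cost (v j) (w j) (c j)) ->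
  \sum_j c j <= #|I|%:R / 16 ->
  exists chi : I -> R, [/\ forall i, [\/ chi i = -1, chi i = 0 | chi i = 1],
    (#|I| <= 8 * #|[pred i | chi i != 0%R]|)%N
    & forall j, `|\sum_i chi i * v j i| <= w j].
Proof.
move=> N3 w0 cost csum; set N := #|I| in N3 csum *.
have [kappa kP] := choice cost.
have k0 j m : 0 <= kappa j m by case: (kP j).
pose cd j (e : {ffun I -> bool}) := code (signed_sum e (v j) / w j).
pose tot e := \sum_j kappa j (cd j e).
have totB : \sum_e tot e <= N%:R / 16 * 2 ^+ N.
  rewrite exchange_big /=; apply: le_trans (ler_wpM2r _ csum); last exact: exprn_ge0.
  by rewrite mulr_suml; apply: ler_sum => j _; case: (kP j).
pose good := [pred e | tot e <= N%:R / 8].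
have N0 : 0 < N%:R :> R by rewrite ltr0n (leq_trans _ N3).
have goodB : 2 ^+ N <= 2 * #|good|%:R :> R.
  have cardN : #|good|%:R + #|[predC good]|%:R = 2 ^+ N :> R.
    by rewrite -natrD cardC card_ffun card_bool natrX.
  have : N%:R / 8 * #|[predC good]|%:R <= N%:R / 16 * 2 ^+ N :> R.
    apply: le_trans totB; rewrite mulr_natr -sumr_const big_mkcond /=.
    apply: ler_sum => e _; case: ifP; last by rewrite sumr_ge0.
    by rewrite !inE -ltNge => /ltW.
  rewrite -cardN; set x := #|good|%:R; set y := #|[predC good]|%:R => h.
  have h' : N%:R * y <= N%:R * ((x + y) / 2) by lra.
  by rewrite ler_pM2l // in h'; lra.
pose M := \max_(e : {ffun I -> bool}) \max_j cd j e.
have cdM j e : (cd j e < M.+1)%N.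
  by rewrite ltnS (leq_trans (leq_bigmax (F := cd^~ e) j)) // (leq_bigmax (F := fun e => \max_j cd j e) e).
pose key e : {ffun J -> 'I_M.+1} := [ffun j => Ordinal (cdM j e)].
pose q (u : {ffun J -> 'I_M.+1}) := \prod_j expR (- kappa j (u j)) : R.
have q0 u : 0 <= q u by apply: prodr_ge0 => j _; apply: expR_ge0.
have qsum : \sum_u q u <= 1.
  rewrite -(bigA_distr_bigA (fun j (m : 'I_M.+1) => expR (- kappa j m))).
  apply: prodr_ile1 => j _; case: (kP j) => _ h _.
  by rewrite h sumr_ge0 // => i _; apply: expR_ge0.
have qgood e : good e -> (7 / 8) ^+ N <= q (key e).
  move=> ge; apply: (@le_trans _ _ (expR (- tot e))); last first.
    by rewrite /tot -sumrN expR_sum; apply: ler_prod => j _; rewrite expR_ge0 ffunE /=.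
  apply: (@le_trans _ _ (expR (- (8^-1)) ^+ N)).
    rewrite lerXn2r ?nnegrE ?expR_ge0 //.
    by apply: le_trans (expR_ge1Dx _); lra.
  by rewrite -expRM_natl ler_expR; move: ge; rewrite /= => ge; lra.
(* If two good sign vectors with equal codes are far apart, half their difference is the colouring:
   equal codes bring the two signed sums within [w j]. Otherwise every class of equal codes lies in
   a Hamming ball, which is refuted by counting. *)
have [[[e e'] /= /and3P[ge ge' /andP[/eqP kee' far]]]|close] :=
    pselect (exists u : {ffun I -> bool} * {ffun I -> bool},
      [&& good u.1, good u.2, key u.1 == key u.2 & (N <= 8 * #|[pred i | u.1 i != u.2 i]|)%N]).
  exists (fun i => ((-1) ^+ e i - (-1) ^+ e' i) / 2); split.
  - move=> i; case: (e i); case: (e' i) => /=; rewrite ?expr1 ?expr0.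
    + by apply: Or32; rewrite subrr mul0r.
    + by apply: Or31; field.
    + by apply: Or33; field.
    + by apply: Or32; rewrite subrr mul0r.
  - apply: leq_trans far _; rewrite leq_mul2l /=; apply: subset_leq_card.
    apply/fintype.subsetP => i; rewrite !inE; case: (e i); case: (e' i) => //= _; rewrite ?expr1 ?expr0; apply/eqP => h; lra.
  move=> j.
  have -> : \sum_i ((-1) ^+ e i - (-1) ^+ e' i) / 2 * v j i =
      (signed_sum e (v j) / w j - signed_sum e' (v j) / w j) * (w j / 2).
    rewrite -mulrBl mulrA divfK ?gt_eqF // /signed_sum -sumrB mulr_suml.
    by apply: eq_bigr => i _; rewrite -mulrBl mulrAC.
  have : cd j e = cd j e' by move/ffunP/(_ j): kee'; rewrite !ffunE => /(congr1 val).
  move/code_eq/ltW => h; rewrite normrM [`|w j / 2|]ger0_norm ?divr_ge0 ?(ltW (w0 j)) //.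
  have := w0 j; have := normr_ge0 (signed_sum e (v j) / w j - signed_sum e' (v j) / w j).
  move: h; set z := `|_|; nra.
have near e e' : good e -> good e' -> key e = key e' ->
    (#|[pred i | e i != e' i]| <= N.-1 %/ 8)%N.
  move=> ge ge' k; rewrite leqNgt; apply/negP => h; apply: close; exists (e, e') => /=.
  apply/and4P; split; [exact: ge|exact: ge'|by apply/eqP|].
  by move: h; move: #|_| => a; lia.
set D := (N.-1 %/ 8)%N in near.
have DN : (8 * D < N)%N by rewrite /D; lia.
have classB u : #|[pred e | good e & key e == u]|%:R <= 4 ^+ D * (5 / 4) ^+ N :> R.
  have [[e0 /andP[g0 /eqP k0']]|no] := pselect (exists e, good e && (key e == u)); last first.
    rewrite eq_card0 ?mulr_ge0 ?exprn_ge0 // => e; rewrite !inE; apply/negbTE/negP => h.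
    by apply: no; exists e.
  rewrite -(hamming_sum R e0) mulr_sumr -sumr_const big_mkcond /=.
  apply: ler_sum => e _; case: ifP => [|_]; last by rewrite mulr_ge0 ?exprn_ge0 ?invr_ge0.
  rewrite !inE => /andP[ge /eqP ke].
  have h : (#|[pred i | e0 i != e i]| <= D)%N by apply: near; rewrite // ke.
  rewrite -(subnK h) exprD -mulrA -exprMn mulfV ?pnatr_eq0 // expr1n mulr1.
  by rewrite exprn_ege1 // ler1n.
(* The factor (10/7)^N (7/8)^N = (5/4)^N trades part of the bound for the Kraft weight [q u], so
   that the sum over all keys is controlled by [qsum] and not by their number. *)
have classB' u : #|[pred e | good e & key e == u]|%:R <= 4 ^+ D * (10 / 7) ^+ N * q u :> R.
  have [[e0 /andP[g0 /eqP k0']]|no] := pselect (exists e, good e && (key e == u)); last first.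
    rewrite eq_card0 ?mulr_ge0 ?exprn_ge0 // => e; rewrite !inE; apply/negbTE/negP => h.
    by apply: no; exists e.
  apply: le_trans (classB u) _; rewrite -mulrA ler_wpM2l ?exprn_ge0 //.
  apply: (@le_trans _ _ ((10 / 7) ^+ N * (7 / 8) ^+ N)).
    by rewrite -exprMn; have -> : 10 / 7 * (7 / 8) = 5 / 4 :> R by field.
  by rewrite ler_wpM2l ?exprn_ge0 // -k0' qgood.
have cardgood : #|good|%:R <= 4 ^+ D * (10 / 7) ^+ N :> R.
  have -> : #|good|%:R = \sum_u #|[pred e | good e & key e == u]|%:R :> R.
    rewrite -natr_sum -sum1_card (partition_big key predT) //=; congr _%:R.
    by apply: eq_bigr => u _; rewrite -sum1_card; apply: eq_bigl => e; rewrite !inE.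
  apply: le_trans (ler_sum _ (fun u _ => classB' u)) _.
  by rewrite -mulr_sumr ler_piMr // mulr_ge0 ?exprn_ge0.
exfalso; have := hamming_numeric R N3 DN; apply/negP; rewrite -leNgt.
have h : 0 < (10 / 7) ^+ N :> R by rewrite exprn_gt0 //; lra.
rewrite -(ler_pM2r h) -exprMn; have -> : 7 / 5 * (10 / 7) = 2 :> R by field.
by apply: le_trans goodB _; rewrite -mulrA ler_pM2l.
Qed.

(** * Hyperplanes and nets *)

Lemma linear_dependence (R : realType) (d : nat) (T : finType) (D : {set T}) (g : T -> 'rV[R]_d) :
  (d < #|D|)%N -> exists c : T -> R,
  (exists2 a, a \in D & c a != 0) /\ forall j, \sum_(a in D) c a * g a ord0 j = 0.
Proof.
move=> dD; pose B := \matrix_(i < #|D|, j < d) g (enum_val i) ord0 j.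
have kB : kermx B != 0.
  rewrite kermx_eq0 /row_free; apply/negP => /eqP rB.
  by have := rank_leq_col B; rewrite rB leqNgt dD.
have [u /sub_kermxP uB u0] := rowV0Pn kB.
have [j0 uj0] : exists j, u ord0 j != 0.
  apply/existsP; rewrite -negb_forall; apply: contra u0 => /forallP h.
  by apply/eqP/rowP => j; rewrite mxE; apply/eqP.
pose c a := \sum_(i | enum_val i == a) u ord0 i.
have cE i : c (enum_val i) = u ord0 i.
  by rewrite /c (big_pred1 i) // => j; rewrite (inj_eq enum_val_inj).
exists c; split; first by exists (enum_val j0); rewrite ?enum_valP ?cE.
move=> j; have := congr1 (fun M : 'rV_d => M ord0 j) uB; rewrite !mxE => uBj; rewrite -[RHS]uBj.
by rewrite big_enum_val /=; apply: eq_bigr => i _; rewrite cE mxE.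
Qed.

Section Geometry.
Variables (R : realType) (d : nat).
Implicit Types (x y z : 'rV[R]_d) (p : param R d) (w u : seq 'I_d) (r : R).

Definition aff p x : R := dotv p.1 x + p.2.

Lemma aff_shift p x y : aff p y = aff p x + dotv p.1 (y - x).
Proof.
rewrite /aff addrAC; congr (_ + _); rewrite /dotv -big_split /=.
by apply: eq_bigr => i _; rewrite !mxE; ring.
Qed.

(* A dependency sum_a c_a omega_a = 0 makes sum_a c_a (omega_a.x + b_a) constant in x,
   which excludes one of the sign patterns of c or the all-negative pattern. *)
Lemma aff_shatter (I X : finType) (pt : I -> 'rV[R]_d) (q : X -> param R d)
    s (f : {ffun 'I_s -> X}) (D : {set 'I_s}) :
  shatters [set trace (fun i a => 0 <= aff (q a) (pt i)) f i | i : I]%SET D -> (#|D| <= d)%N.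
Proof.
move=> sh; rewrite leqNgt; apply/negP => dD.
have real (P : pred 'I_s) : exists x, forall a, a \in D -> (0 <= aff (q (f a)) x) = P a.
  have [|A] := sh ([set a in D | P a]%SET).
    by apply/fintype.subsetP => a; rewrite inE => /andP[].
  case/imsetP => i _ -> /setP e; exists (pt i) => a aD.
  by have := e a; rewrite !inE aD andbT.
have [c [[a0 a0D ca0] c0]] := linear_dependence (fun a => (q (f a)).1) dD.
have cst x : \sum_(a in D) c a * aff (q (f a)) x = \sum_(a in D) c a * (q (f a)).2.
  rewrite /aff; under eq_bigr do rewrite mulrDr; rewrite big_split /=.
  rewrite [X in X + _](_ : _ = 0) ?add0r // /dotv.
  under eq_bigr do rewrite mulr_sumr.
  rewrite exchange_big big1 //= => j _.
  by under eq_bigr do rewrite mulrA; rewrite -mulr_suml c0 mul0r.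
(* Here [e] is [c] or its negative, with nonpositive constant value. At a point with sign pattern
   [0 < e a] all terms are nonnegative, so they vanish, and a negative coefficient is impossible
   because its term would be strictly positive. Then the all-negative pattern makes the sum strictly
   negative, below its constant value 0. *)
have main (e : 'I_s -> R) : (forall x, \sum_(a in D) e a * aff (q (f a)) x = \sum_(a in D) e a * (q (f a)).2) ->
    \sum_(a in D) e a * (q (f a)).2 <= 0 -> e a0 != 0 -> False.
  move=> est e_le0 ea0; have [x xP] := real (fun a => 0 < e a).
  have pos a : a \in D -> 0 <= e a * aff (q (f a)) x.
    move=> aD; have := xP a aD; case: (ltP 0 (e a)) => h.
      by move=> h'; rewrite mulr_ge0 // ltW.
    by move=> /negbT; rewrite -ltNge => h'; rewrite nmulr_lge0 // nmulr_rge0.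
  have s0 : \sum_(a in D) e a * aff (q (f a)) x = 0.
    by apply/eqP; rewrite eq_le sumr_ge0 ?andbT // est.
  have epos a : a \in D -> 0 <= e a.
    move=> aD; rewrite leNgt; apply/negP => ea.
    have := xP a aD; rewrite ltNge (ltW ea) /= => /negbT; rewrite -ltNge => h.
    have : 0 < \sum_(a in D) e a * aff (q (f a)) x.
      rewrite (bigD1 a) //= ltr_pwDl //; first by rewrite nmulr_rgt0.
      by apply: sumr_ge0 => b /andP[bD _]; apply: pos.
    by rewrite s0 ltxx.
  have [y yP] := real xpred0.
  have : \sum_(a in D) e a * aff (q (f a)) y < 0.
    have neg a : a \in D -> aff (q (f a)) y < 0.
      by move=> aD; have := yP a aD => /negbT; rewrite -ltNge.
    rewrite (bigD1 a0) //= ltr_nwDl //.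
      by rewrite pmulr_rlt0 ?neg // lt_neqAle eq_sym ea0 epos.
    apply: sumr_le0 => b /andP[bD _]; rewrite mulr_ge0_le0 ?epos // ltW // neg //.
  by rewrite est -(est x) s0 ltxx.
have [h|h] := lerP (\sum_(a in D) c a * (q (f a)).2) 0; first exact: (main c).
apply: (main (fun a => - c a)); rewrite ?oppr_eq0 //.
- by move=> x; under eq_bigr do rewrite mulNr; under [RHS]eq_bigr do rewrite mulNr; rewrite !sumrN cst.
- by under eq_bigr do rewrite mulNr; rewrite sumrN oppr_le0 ltW.
Qed.

Definition nsep (X : finType) (q : X -> param R d) x y : nat :=
  #|[pred a | (0 <= aff (q a) x) != (0 <= aff (q a) y)]|.

Lemma nsepC (X : finType) (q : X -> param R d) x y : nsep q x y = nsep q y x.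
Proof. by apply: eq_card => a; rewrite !inE eq_sym. Qed.

(** A separated sequence of greatest length is a net; the packing bound provides both the maximum
    and its size. *)
Lemma exists_net (X : finType) (q : X -> param R d) (B : set 'rV[R]_d) (m : nat) :
  (0 < #|X|)%N -> (0 < m)%N -> (0 < d)%N -> exists P : seq 'rV[R]_d,
  [/\ forall y, y \in P -> B y, (size P <= 2 * (4 * m * d).+1 ^ d)%N
    & forall x, B x -> exists2 y, y \in P & (m * nsep q x y < #|X|)%N].
Proof.
move=> X0 m0 d0.
pose sep (P : seq 'rV[R]_d) := (forall y, y \in P -> B y) /\
   pairwise (fun x y => #|X| <= m * nsep q x y)%N P.
have sepB P : sep P -> (size P <= 2 * (4 * m * d).+1 ^ d)%N.
  case=> _ pP; pose pt (i : 'I_(size P)) := nth 0 P i.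
  have := @packing_bound X 'I_(size P) (fun i a => 0 <= aff (q a) (pt i)) m d X0 m0 d0.
  rewrite card_ord; apply; last by move=> s f D; apply: aff_shatter.
  move=> i j ij; have lt_case (i' j' : 'I_(size P)) : (i' < j')%N -> (#|X| <= m * nsep q (pt i') (pt j'))%N.
    by move=> ij'; apply: (pairwiseP 0 pP) => //; rewrite inE.
  have : (#|X| <= m * nsep q (pt i) (pt j))%N.
    case: (ltngtP i j) => h; [exact: lt_case|rewrite nsepC; exact: lt_case|].
    by move/eqP: ij; case; apply: val_inj.
  by move/leq_trans; apply; rewrite leq_mul2l /nsep; apply/orP; right; apply: subset_leq_card; apply/fintype.subsetP => a; rewrite !inE.
pose Q n := `[< exists2 P, sep P & size P = n >].
have exQ : exists n, Q n by exists 0%N; apply/asboolP; exists [::].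
have ubQ n : Q n -> (n <= 2 * (4 * m * d).+1 ^ d)%N.
  by move/asboolP => [P sP <-]; apply: sepB.
case: (ex_maxnP exQ ubQ) => n /asboolP[P [PB pP] sP] nmax.
exists P; split => //; first by apply: sepB.
move=> x Bx; apply: contrapT => no.
have : Q n.+1.
  apply/asboolP; exists (x :: P); last by rewrite /= sP.
  split; first by move=> y; rewrite inE => /orP[/eqP->|/PB].
  rewrite /= pP andbT; apply/allP => y yP; rewrite leqNgt; apply/negP => h.
  by apply: no; exists y.
by move/nmax; rewrite ltnn.
Qed.

Definition wpow w (v : 'rV[R]_d) : R := \prod_(i <- w) v ord0 i.

(* Words instead of multi-indices: (omega.h)^n expands over words without
   multinomial coefficients. *)
Fixpoint words n : seq (seq 'I_d) :=
  if n is n'.+1 then [seq i :: u | i <- enum 'I_d, u <- words n'] else [:: [::]].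

Lemma size_words n u : u \in words n -> size u = n.
Proof. by elim: n u => [|n IHn] u /=; [rewrite inE => /eqP ->|case/allpairsP => -[i v] [_ /IHn /= <- ->]]. Qed.

Lemma card_words n : size (words n) = (d ^ n)%N.
Proof. by elim: n => //= n IHn; rewrite size_allpairs IHn size_enum_ord expnS. Qed.

Lemma wpow_cat w u v : wpow (w ++ u) v = wpow w v * wpow u v.
Proof. by rewrite /wpow big_cat. Qed.

Lemma dotv_pow (a b : 'rV[R]_d) n : dotv a b ^+ n = \sum_(u <- words n) wpow u a * wpow u b.
Proof.
elim: n => [|n IHn]; first by rewrite expr0 big_seq1 /wpow !big_nil mulr1.
rewrite exprS IHn /= big_allpairs_dep /dotv mulr_suml big_enum /=.
apply: eq_bigr => i _; rewrite mulr_sumr; apply: eq_bigr => u _.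
by rewrite /wpow !big_cons; ring.
Qed.

Lemma wpow_le u (v : 'rV[R]_d) r : 0 <= r -> (forall i, `|v ord0 i| <= r) -> `|wpow u v| <= r ^+ size u.
Proof.
move=> r0 vr; rewrite /wpow normr_prod.
elim: u => [|i u IHu]; first by rewrite big_nil.
by rewrite big_cons exprS ler_pM // prodr_ge0.
Qed.

Lemma dotv_le (a b : 'rV[R]_d) r : (forall i, `|a ord0 i| <= 1) -> (forall i, `|b ord0 i| <= r) ->
  `|dotv a b| <= d%:R * r.
Proof.
move=> a1 br; apply: le_trans (ler_norm_sum _ _ _) _.
apply: le_trans (ler_sum _ (fun i _ => _ : _ <= r)) _ => [i|].
  by rewrite normrM -[X in _ <= X]mul1r ler_pM.
by rewrite sumr_const card_ord mulr_natl.
Qed.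

Lemma ball_coord x : ball_d x -> forall i, `|x ord0 i| <= 1.
Proof.
rewrite /ball_d /dotv /= => h i; rewrite -(@expr_le1 _ 2) // -normrX ger0_norm ?sqr_ge0 //.
apply: le_trans h; rewrite (bigD1 i) //= -expr2 lerDl; apply: sumr_ge0 => j _.
by rewrite -expr2 sqr_ge0.
Qed.

Lemma dict_coord p : dict_set p -> forall i, `|p.1 ord0 i| <= 1.
Proof. by case=> h _; apply: ball_coord; rewrite /ball_d /= h. Qed.

Lemma aff_le p x : dict_set p -> ball_d x -> `|aff p x| <= d%:R + 1.
Proof.
move=> hp hx; have [_ /=] := hp; rewrite -ler_norml => h2.
rewrite (le_trans (ler_normD _ _)) // lerD // -[X in _ <= X]mulr1.
by apply: dotv_le; [apply: dict_coord|apply: ball_coord].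
Qed.

(** Taylor expansion around [y]. The hypothesis covers all words and powers of the same total
    degree, hence every term of the expansion; the d^j words of length j turn the bounds into a
    binomial sum, which closes up to a power. *)
Lemma expand_at (I : finType) (p : I -> param R d) (a : I -> R) w m y z (A rho r : R) :
  0 <= A -> 0 <= rho -> 0 <= r ->
  (forall w' m', (size w' + m' = size w + m)%N ->
    `|\sum_i a i * wpow w' (p i).1 * aff (p i) y ^+ m'| <= A * rho ^+ m') ->
  (forall c, `|(z - y) ord0 c| <= r) ->
  `|\sum_i a i * wpow w (p i).1 * aff (p i) z ^+ m| <= A * (rho + d%:R * r) ^+ m.
Proof.
move=> A0 rho0 r0 H zy.
have -> : \sum_i a i * wpow w (p i).1 * aff (p i) z ^+ m =
  \sum_(j < m.+1) (\sum_(u <- words j) wpow u (z - y) *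
      (\sum_i a i * wpow (w ++ u) (p i).1 * aff (p i) y ^+ (m - j))) *+ 'C(m, j).
  transitivity (\sum_i \sum_(j < m.+1) (\sum_(u <- words j) wpow u (z - y) *
      (a i * wpow (w ++ u) (p i).1 * aff (p i) y ^+ (m - j))) *+ 'C(m, j)).
    apply: eq_bigr => i _; rewrite (aff_shift _ y) exprDn mulr_sumr; apply: eq_bigr => j _.
    rewrite mulrnAr; congr (_ *+ _); rewrite dotv_pow !mulr_sumr; apply: eq_bigr => u _.
    by rewrite wpow_cat; ring.
  rewrite exchange_big; apply: eq_bigr => j _ /=; rewrite sumrMnl; congr (_ *+ _).
  by rewrite exchange_big; apply: eq_bigr => u _ /=; rewrite mulr_sumr.
rewrite exprDn mulr_sumr; apply: le_trans (ler_norm_sum _ _ _) _; apply: ler_sum => j _.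
rewrite normrMn mulrnAr lerMn2r; apply/orP; right.
apply: le_trans (ler_norm_sum _ _ _) _.
apply: (@le_trans _ _ (\sum_(u <- words j) r ^+ j * (A * rho ^+ (m - j)))).
  rewrite big_seq [X in _ <= X]big_seq; apply: ler_sum => u ju; rewrite normrM ler_pM //.
    by rewrite -(size_words ju) wpow_le.
  apply: H; rewrite size_cat (size_words ju) -addnA subnKC //.
  by rewrite -ltnS ltn_ord.
rewrite big_const_seq count_predT card_words iter_addr_0 -[_ *+ (d ^ _)%N]mulr_natl natrX exprMn.
by rewrite le_eqVlt; apply/orP; left; apply/eqP; ring.
Qed.
End Geometry.

Section Grid.
Variables (R : realType) (d N : nat).
Hypothesis N0 : (0 < N)%N.

(** Coordinate hyperplanes at the heights -1 + 2(j+1)/N, with spacing 2/N, so that the number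
    crossed measures the distance in that coordinate up to rounding. *)
Definition grid_shift (j : 'I_N) : R := 1 - 2 * j.+1%:R / N%:R.
Definition grid_atom (ij : 'I_d * 'I_N) : param R d := (delta_mx ord0 ij.1, grid_shift ij.2).

Lemma aff_grid ij x : aff (grid_atom ij) x = x ord0 ij.1 + grid_shift ij.2.
Proof.
rewrite /aff /dotv (bigD1 ij.1) //= big1 ?addr0; first by rewrite mxE !eqxx mul1r.
by move=> j jn; rewrite mxE (negbTE jn) andbF mul0r.
Qed.

Lemma sum_interval (a b n : nat) : (\sum_(j < n) (a <= j < b) = minn b n - a)%N.
Proof.
elim: n => [|n IHn]; first by rewrite big_ord0 minn0.
by rewrite big_ord_recr IHn /=; case: (leqP a n); case: (ltnP n b); lia.
Qed.

Lemma grid_count (a b : R) : -1 <= a -> a <= b -> b <= 1 ->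
  N%:R * (b - a) / 2 - 1 <= #|[pred j | (0 <= a + grid_shift j) != (0 <= b + grid_shift j)]|%:R.
Proof.
move=> a1 ab b1; have N0' : 0 < N%:R :> R by rewrite ltr0n.
pose u (t : R) := N%:R * (t + 1) / 2.
have u0 t : -1 <= t -> 0 <= u t by move=> ht; rewrite divr_ge0 // mulr_ge0 ?ler0n //; lra.
have uab : u a <= u b by rewrite /u ler_pM2r ?invr_gt0 // ler_pM2l //; lra.
have shiftE t j : (0 <= t + grid_shift j) = (j.+1%:R <= u t).
  rewrite /grid_shift /u addrA subr_ge0 ler_pdivrMr // ler_pdivlMr // mulrC.
  by rewrite [N%:R * _]mulrC.
pose ja := Num.truncn (u a); pose jb := Num.truncn (u b).
have /andP[a2 a3] := truncn_itv (u0 a a1).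
have /andP[b2 b3] := truncn_itv (u0 b (le_trans a1 ab)).
rewrite -/ja -/jb in a2 a3 b2 b3.
have jbN : (jb <= N)%N.
  rewrite -(ler_nat R) (le_trans b2) // /u -mulrA ler_piMr ?ler0n //; lra.
have jab : (ja <= jb)%N.
  by rewrite -ltnS -(ltr_nat R) (le_lt_trans a2) // (le_lt_trans uab).
apply: (@le_trans _ _ (jb - ja)%N%:R).
  rewrite natrB //; have -> : N%:R * (b - a) / 2 = u b - u a by rewrite /u; field.
  by rewrite -natr1 in b3; lra.
rewrite ler_nat -[X in (X - _)%N](minn_idPl jbN) -sum_interval -sum1_card.
rewrite [X in (_ <= X)%N]big_mkcond /=; apply: leq_sum => j _.
case: ifP => [_|/negbT]; first exact: leq_b1.
case: andP => //= -[h1 h2]; rewrite !inE !shiftE negbK.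
have -> : (j.+1%:R <= u a) = false.
  by apply/negbTE; rewrite -ltNge (lt_le_trans a3) // ler_nat ltnS.
by rewrite (le_trans _ b2) // ler_nat.
Qed.
End Grid.

Section Nets.
Variables (R : realType) (d : nat) (I : finType) (p : I -> param R d).
Hypotheses (d0 : (0 < d)%N) (I0 : (0 < #|I|)%N).
Notation N := #|I|.

(* Adding the grid of coordinate hyperplanes makes the number of separating
   hyperplanes control the Euclidean distance as well. *)
Definition with_grid (a : I + 'I_d * 'I_N) : param R d :=
  match a with inl i => p i | inr ij => grid_atom R ij end.

Lemma nsep_with_grid x y : (nsep p x y <= nsep with_grid x y)%N.
Proof.
rewrite /nsep -(fintype.card_image (@inl_inj I ('I_d * 'I_N)%type)).
apply: subset_leq_card; apply/fintype.subsetP => a /fintype.imageP[i]; rewrite !inE => hi ->.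
by rewrite /= hi.
Qed.

Lemma nsep_coord x y i : ball_d x -> ball_d y ->
  `|x ord0 i - y ord0 i| <= 2 * ((nsep with_grid x y)%:R + 1) / N%:R.
Proof.
move=> hx hy; have N0' : 0 < N%:R :> R by rewrite ltr0n.
wlog xy : x y hx hy / x ord0 i <= y ord0 i.
  move=> H; case: (leP (x ord0 i) (y ord0 i)) => h; first exact: H.
  by rewrite distrC nsepC; apply: H => //; apply: ltW.
have /andP[x1 _] : -1 <= x ord0 i <= 1 by rewrite -ler_norml ball_coord.
have /andP[_ y1] : -1 <= y ord0 i <= 1 by rewrite -ler_norml ball_coord.
rewrite distrC ger0_norm ?subr_ge0 // ler_pdivlMr //.
have := @grid_count R _ I0 _ _ x1 xy y1.
have : (#|[pred j : 'I_N | (0 <= x ord0 i + grid_shift R j)%R != (0 <= y ord0 i + grid_shift R j)%R]|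
   <= nsep with_grid x y)%N.
  have inj : injective (fun j : 'I_N => inr (i, j) : I + 'I_d * 'I_N) by move=> j j' [].
  rewrite /nsep -(fintype.card_image inj).
  apply: subset_leq_card; apply/fintype.subsetP => a /fintype.imageP[j]; rewrite !inE => hj ->.
  by rewrite /= !aff_grid.
rewrite -(ler_nat R); lra.
Qed.

Lemma exists_nets : exists net : nat -> seq 'rV[R]_d, forall l,
  [/\ forall y, y \in net l -> ball_d y,
      (size (net l) <= 2 * (4 * d.+1 * d).+1 ^ d * 4 ^ (l * d))%N
    & forall x, ball_d x -> exists2 y, y \in net l & (4 ^ l * nsep with_grid x y < N)%N].
Proof.
suff H l : exists P, [/\ forall y, y \in P -> ball_d y,
      (size P <= 2 * (4 * d.+1 * d).+1 ^ d * 4 ^ (l * d))%N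
    & forall x, ball_d x -> exists2 y, y \in P & (4 ^ l * nsep with_grid x y < N)%N].
  by have [net netP] := choice H; exists net.
have cX : #|{: I + 'I_d * 'I_N}| = (d.+1 * N)%N by rewrite card_sum card_prod !card_ord mulSn.
have X0 : (0 < #|{: I + 'I_d * 'I_N}|)%N by rewrite cX muln_gt0.
(* With the grid there are (d+1) N hyperplanes; the factor [d.+1] turns a fraction of all of them
   into a fraction of N. *)
have m0 : (0 < d.+1 * 4 ^ l)%N by rewrite muln_gt0 expn_gt0.
have [P [P1 P2 P3]] := exists_net with_grid (@ball_d R d) X0 m0 d0.
exists P; split=> // [|x Bx].
  apply: leq_trans P2 _; rewrite -[X in (_ <= X)%N]mulnA leq_mul2l /= expnM -expnMn; apply: leq_expn2r.
  have -> : (4 * (d.+1 * 4 ^ l) * d = 4 * d.+1 * d * 4 ^ l)%N by rewrite mulnA mulnAC.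
  by rewrite mulSn -add1n leq_add2r expn_gt0.
by have [y yP] := P3 x Bx; rewrite cX -mulnA ltn_pmul2l //; exists y.
Qed.

(** The condition on [l] absorbs the rounding term of [nsep_coord]: 2/N is at most 8/4^l, which
    together with the main term 2/4^l gives 10/4^l. *)
Lemma nsep_small l x y : ball_d x -> ball_d y -> (4 ^ l <= 4 * N)%N ->
  (4 ^ l * nsep with_grid x y < N)%N ->
  (forall i, `|(x - y) ord0 i| <= 10 / 4 ^+ l) /\ (nsep p x y)%:R <= N%:R / 4 ^+ l :> R.
Proof.
move=> hx hy; rewrite -(ler_nat R) natrM natrX => hl.
rewrite -(ltr_nat R) natrM natrX => hs.
have N0' : 0 < N%:R :> R by rewrite ltr0n.
have l0 : 0 < 4 ^+ l :> R by rewrite exprn_gt0.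
split=> [i|].
  rewrite !mxE (le_trans (nsep_coord _ hx hy)) //.
  rewrite ler_pdivrMr // mulrAC ler_pdivlMr //.
  move: hl hs; set s := _%:R; set q := _ ^+ _; nra.
rewrite ler_pdivlMr // mulrC (le_trans _ (ltW hs)) // ler_pM2l // ler_nat.
exact: nsep_with_grid.
Qed.
End Nets.

(** * Chaining *)

Section Levels.
Variable R : realType.
Implicit Types (L l K m : nat).

Definition level_decay L l : R := if (l < L)%N then 2^-1 ^+ (L - l) else (3 / 4) ^+ (l - L).

Lemma sum_level_decay L M : \sum_(l < M) level_decay L l <= 5.
Proof.
suff h : \sum_(l < M) level_decay L l <=
    (if (M <= L)%N then 2^-1 ^+ (L - M) else 5 - 4 * (3 / 4) ^+ (M - L)).
  apply: le_trans h _; case: ifP => _; last by rewrite lerBlDr lerDl mulr_ge0 // exprn_ge0.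
  by apply: (@le_trans _ _ 1); rewrite ?exprn_ile1 //; lra.
elim: M => [|M IHM]; first by rewrite big_ord0 /= exprn_ge0.
rewrite big_ord_recr /=; apply: le_trans (lerD IHM (lexx _)) _.
rewrite /level_decay; case: (ltngtP M L) => [ML|ML|<-].
- by rewrite -(subnSK ML) exprS; lra.
- by rewrite subSn ?(ltnW ML) // exprS; lra.
- by rewrite subnn subSnn expr0 expr1; lra.
Qed.

(* Allowed size of an increment at level l relative to its standard deviation; there
   are about N net points at level L. *)
Definition level_width K L l : R := if (l < L)%N then 2^-1 ^+ (K * (L - l)) else (3 / 2) ^+ (l - L).

Lemma level_width_gt0 K L l : 0 < level_width K L l.
Proof. by rewrite /level_width; case: ifP => _; rewrite exprn_gt0. Qed.

(** Below L the width gains 2^-K per level against a loss of 2^(2m+1), so K >= 2m+2 leaves a factor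
    1/2. Above L the growth 3/2 meets a decay of at least 1/2, which leaves 3/4. *)
Lemma level_width_decay K L l m : (2 * m + 2 <= K)%N ->
  2^-1 ^+ (l * (2 * m + 1)) * level_width K L l <= 2^-1 ^+ (L * (2 * m + 1)) * level_decay L l.
Proof.
move=> mK; rewrite /level_width /level_decay; case: ltnP => h.
  rewrite -!exprD ler_wiXn2l //; first by lra.
  have : (L = l + (L - l))%N by lia.
  by move: (L - l)%N => j ->; nia.
have : (l = L + (l - L))%N by lia. move: (l - L)%N => j ->.
rewrite mulnDl exprD -mulrA ler_wpM2l ?exprn_ge0 //.
apply: (@le_trans _ _ (2^-1 ^+ j * (3 / 2) ^+ j)).
  rewrite ler_wpM2r ?exprn_ge0 // ler_wiXn2l //; first by lra.
  by rewrite leq_pmulr // addn1.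
by rewrite -exprMn; have -> : 2^-1 * (3 / 2) = 3 / 4 :> R by field.
Qed.

Definition level_cost K L l : R :=
  if (l < L)%N then ln 2 + 2 + 4 * expR 18 - ln (level_width K L l)
  else (2 + 16 * expR 18) * expR (- level_width K L l).

Lemma level_test_cost (I : finType) (v : I -> R) (s : R) K L l : 0 < s ->
  \sum_i v i ^+ 2 <= s ^+ 2 -> test_cost v (level_width K L l * s) (level_cost K L l).
Proof.
move=> s0 vs; rewrite /level_cost; case: ifP => lL.
  by apply: cost_small; rewrite ?level_width_gt0 // /level_width lL exprn_ile1 //; lra.
by apply: cost_large => //; rewrite /level_width lL exprn_ege1 //; lra.
Qed.

Lemma ln2_le1 : ln 2 <= 1 :> R.
Proof. by have -> : 2 = 1 + 1 :> R by []; apply: le_ln1Dx. Qed.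

Lemma pow_fact_le (y : R) n : 0 <= y -> y ^+ n <= n`!%:R * expR y.
Proof.
case: n => [|n] y0; first by rewrite expr0 fact0 mul1r; have := expR_ge1Dx y; lra.
have := expR_ge1Dxn n y0; have f0 : 0 < (n.+1)`!%:R :> R by rewrite ltr0n fact_gt0.
by rewrite -ler_pdivrMl // mulrC => h; lra.
Qed.

Lemma ler_nat_exp2 j : j%:R <= 2 ^+ j :> R.
Proof. by rewrite -natrX ler_nat ltnW // ltn_expl. Qed.

Definition cost_const K d : R := 4 + 4 * expR 18 + K%:R + (2 + 16 * expR 18) * (6 * d)`!%:R.

Lemma cost_const_gt0 K d : 0 < cost_const K d.
Proof.
have e0 := @expR_gt0 R 18; rewrite /cost_const.
have : 0 <= K%:R :> R by []; have : 0 <= (6 * d)`!%:R :> R by [].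
by move: (K%:R) (_`!%:R) => a b; nra.
Qed.

Lemma level_cost_decay K L l d : (0 < d)%N ->
  4 ^+ (l * d) * level_cost K L l <= 4 ^+ (L * d) * (cost_const K d * level_decay L l).
Proof.
move=> d0; have e0 := @expR_gt0 R 18.
have f0 : 0 <= (6 * d)`!%:R :> R by [].
rewrite /level_cost /level_width /level_decay; case: ltnP => h.
  have -> : (L = l + (L - l))%N by lia. move: (L - l)%N (subn_gt0 l L) h => j h1 h2.
  rewrite addKn mulnDl [4 ^+ (_ + _)]exprD -mulrA ler_pM2l ?exprn_gt0 //.
  rewrite lnXn ?invr_gt0 // lnV ?posrE // mulNrn opprK -[ln 2 *+ _]mulr_natl natrM.
  have l2 := ln2_le1; have l20 : 0 <= ln 2 :> R by rewrite ln_ge0 //; lra.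
  have K0 : 0 <= K%:R :> R by [].
  have j0 : 0 <= j%:R :> R by [].
  apply: (@le_trans _ _ (2 ^+ j * cost_const K d)).
    have j1 := ler_nat_exp2 j; have j2 : 1 <= 2 ^+ j :> R by rewrite exprn_ege1 //; lra.
    have s1 : K%:R * j%:R * ln 2 <= 2 ^+ j * K%:R :> R.
      apply: (@le_trans _ _ (K%:R * j%:R)); first by rewrite ler_piMr // mulr_ge0.
      by rewrite mulrC ler_wpM2r.
    have s2 : ln 2 + 2 + 4 * expR 18 <= 2 ^+ j * (4 + 4 * expR 18) :> R.
      by apply: (@le_trans _ _ (4 + 4 * expR 18)); [lra|rewrite ler_peMl //; lra].
    have s3 : 0 <= 2 ^+ j * ((2 + 16 * expR 18) * (6 * d)`!%:R) :> R.
      by rewrite !mulr_ge0 ?exprn_ge0 // addr_ge0 // mulr_ge0 // ltW.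
    rewrite /cost_const; lra.
  rewrite [cost_const _ _ * _]mulrC mulrA ler_pM2r ?cost_const_gt0 //.
  apply: (@le_trans _ _ (4 ^+ j * 2^-1 ^+ j)); last first.
    rewrite ler_wpM2r ?exprn_ge0 // ler_weXn2l ?leq_pmulr //; lra.
  by rewrite -exprMn; have -> : 4 * 2^-1 = 2 :> R by field.
have -> : (l = L + (l - L))%N by lia. move: (l - L)%N => j {h}.
rewrite addKn mulnDl [4 ^+ (_ + _)]exprD -mulrA ler_pM2l ?exprn_gt0 //.
set y := (3 / 2) ^+ j; have y0 : 0 < y by rewrite exprn_gt0.
(* The exponent 6 d is large enough because (3/2)^6 exceeds 8: the power y^(6d) beats 4^(jd) with a
   geometric factor to spare, and exp(-y) beats y^(6d) up to (6d)!. *)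
have h8 : 4 ^+ (j * d) <= y ^+ (6 * d) * (3 / 4) ^+ j.
  have -> : y ^+ (6 * d) = ((3 / 2) ^+ (6 * d)) ^+ j by rewrite /y -!exprM mulnC.
  have -> : 4 ^+ (j * d) = (4 ^+ d) ^+ j :> R by rewrite -exprM mulnC.
  rewrite -exprMn lerXn2r ?nnegrE ?exprn_ge0 ?mulr_ge0 ?exprn_ge0 //.
  rewrite exprM; apply: (@le_trans _ _ (8 ^+ d * (3 / 4))).
    have -> : 8 = 4 * 2 :> R by ring.
    rewrite exprMn -mulrA ler_peMr ?exprn_ge0 //.
    have : 2 <= 2 ^+ d :> R by rewrite -[X in X <= _]expr1 ler_weXn2l //; lra.
    by move: (2 ^+ d) => t; lra.
  rewrite ler_wpM2r // lerXn2r ?nnegrE ?exprn_ge0 //; lra.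
have h9 := pow_fact_le (6 * d) (ltW y0).
have h10 : 4 ^+ (j * d) * expR (- y) <= (6 * d)`!%:R * (3 / 4) ^+ j.
  apply: le_trans (ler_wpM2r (expR_ge0 _) h8) _.
  rewrite mulrAC ler_wpM2r ?exprn_ge0 // expRN ler_pdivrMr ?expR_gt0 //.
rewrite mulrCA.
apply: (@le_trans _ _ ((2 + 16 * expR 18) * ((6 * d)`!%:R * (3 / 4) ^+ j))).
  by rewrite ler_wpM2l // addr_ge0 // mulr_ge0 // ltW.
rewrite mulrA ler_wpM2r ?exprn_ge0 // /cost_const lerDr !addr_ge0 // mulr_ge0 // ltW.
Qed.
End Levels.

(* The telescoping increments are side y - side (parent y), nonzero only for the atoms
   separating y from its parent; the polynomial factor is evaluated at the end point
   z throughout and expanded around y only when a level is estimated. *)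
Section Chaining.
Variables (R : realType) (d k : nat) (I : finType) (p : I -> param R d) (g : I -> R).
Hypotheses (d0 : (0 < d)%N) (I0 : (0 < #|I|)%N).
Hypothesis hp : forall i, dict_set (p i).
Hypothesis hg : forall i, 0 <= g i <= 1.
Variables (near : nat -> 'rV[R]_d -> 'rV[R]_d).
Hypothesis near_ball : forall l x, ball_d x -> ball_d (near l x).
Hypothesis near_close : forall l x, ball_d x -> (4 ^ l * nsep (with_grid p) x (near l x) < #|I|)%N.
Notation N := #|I|.
Implicit Types (x y z : 'rV[R]_d) (w : seq 'I_d) (l m : nat).

Definition side y i : R := (0 <= aff (p i) y)%R%:R.
(** The chain starts from zero: at level 0 the increment is [side] itself. *)
Definition parent_side l y i : R := if l is l'.+1 then side (near l' y) i else 0.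
Definition test_vec l y w i : R :=
  g i * (side y i - parent_side l y i) * wpow w (p i).1 * aff (p i) y ^+ (k - size w).
(** Bound for the Euclidean norm of a test vector. The parent lies at level l - 1, so at most 4 N /
    4^l atoms separate, and each coordinate moves by at most 10/4^(l-1) = 40/4^l. *)
Definition level_scale l m : R := 2 * Num.sqrt N%:R * 2^-1 ^+ l * (40 * d%:R / 4 ^+ l) ^+ m.

Lemma test_vec_norm l y w : ball_d y -> (forall l', l = l'.+1 -> 4 ^ l' <= 4 * N)%N ->
  \sum_i test_vec l y w i ^+ 2 <= level_scale l (k - size w) ^+ 2.
Proof.
move=> By lN; set m := (k - size w)%N; set rho : R := 40 * d%:R / 4 ^+ l.
have N0' : 0 < N%:R :> R by rewrite ltr0n.
have d1 : 1 <= d%:R :> R by rewrite ler1n.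
have rho0 : 0 <= rho by rewrite divr_ge0 ?exprn_ge0 // mulr_ge0.
have wB i : `|wpow w (p i).1| <= 1.
  by rewrite -(expr1n R (size w)) wpow_le // => c; apply: dict_coord.
(* A separating atom changes sign between [y] and its parent, so its value at [y] is at most its
   change between them. At level 0 the trivial bound d + 1 is below 40 d. *)
have Srho i : side y i != parent_side l y i -> `|aff (p i) y| <= rho.
  rewrite /rho; case: l lN @rho rho0 => [|l] lN rho rho0 /= hS.
    by rewrite expr0 divr1 (le_trans (aff_le (hp i) By)) //; lra.
  have [h1 _] := nsep_small I0 By (near_ball l By) (lN _ erefl) (near_close l By).
  have -> : 40 * d%:R / 4 ^+ l.+1 = d%:R * (10 / 4 ^+ l) :> R.
    by rewrite exprS; field; rewrite expf_neq0.
  have := dotv_le (dict_coord (hp i)) h1.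
  have -> : dotv (p i).1 (y - near l y) = aff (p i) y - aff (p i) (near l y).
    by rewrite (aff_shift _ (near l y) y) addrAC subrr add0r.
  move: hS; rewrite /side; case: (leP 0 (aff (p i) y)) => h; case: (leP 0 (aff (p i) (near l y))) => h'; rewrite ?eqxx // => _.
    by rewrite !ger0_norm; lra.
  by rewrite !ler0_norm; lra.
pose S := [pred i | side y i != parent_side l y i].
have cS : #|S|%:R <= N%:R * (2 * 2^-1 ^+ l) ^+ 2 :> R.
  rewrite /S; case: l lN {rho rho0 Srho S} => [|l] lN.
    rewrite expr0 mulr1; apply: (@le_trans _ _ N%:R); first by rewrite ler_nat max_card.
    by rewrite ler_peMr //; lra.
  have [_ h2] := nsep_small I0 By (near_ball l By) (lN _ erefl) (near_close l By).
  apply: (@le_trans _ _ (nsep p y (near l y))%:R).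
    rewrite ler_nat; apply: subset_leq_card; apply/fintype.subsetP => i; rewrite !inE /= /side.
    by apply: contra => /eqP ->.
  apply: le_trans h2 _; rewrite ler_wpM2l //.
  have -> : 2 * 2^-1 ^+ l.+1 = 2^-1 ^+ l :> R by rewrite exprS mulrA mulfV // mul1r.
  by rewrite -exprM mulnC exprM -exprVn lerXn2r ?nnegrE ?exprn_ge0 //; lra.
apply: (@le_trans _ _ (\sum_(i in S) (rho ^+ m) ^+ 2)).
  rewrite [X in _ <= X]big_mkcond /=; apply: ler_sum => i _.
  rewrite inE; case: ifPn => [hS|]; last first.
    by rewrite negbK /test_vec => /eqP ->; rewrite subrr mulr0 !mul0r expr0n.
  rewrite -real_normK ?num_real // lerXn2r ?nnegrE ?exprn_ge0 // /test_vec.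
  rewrite !normrM normrX -[X in _ <= X]mul1r.
  apply: ler_pM; rewrite ?mulr_ge0 ?exprn_ge0 //; last by rewrite lerXn2r ?nnegrE // Srho.
  rewrite -[X in _ <= X]mul1r; apply: ler_pM; rewrite ?mulr_ge0 //.
  rewrite -[X in _ <= X]mul1r; apply: ler_pM => //.
    by have /andP[g0 g1] := hg i; rewrite ger0_norm.
  rewrite /parent_side /side; case: (l) => [|l']; first by rewrite subr0; case: (0 <= _); rewrite ?normr1 ?normr0.
  by case: (0 <= _); case: (0 <= _); rewrite ?subrr ?subr0 ?sub0r ?normrN ?normr1 ?normr0.
rewrite sumr_const -mulr_natl /level_scale -/rho.
have -> : (2 * Num.sqrt N%:R * 2^-1 ^+ l * rho ^+ m) ^+ 2 =
    N%:R * (2 * 2^-1 ^+ l) ^+ 2 * (rho ^+ m) ^+ 2.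
  by rewrite !exprMn sqr_sqrtr //; ring.
by rewrite ler_wpM2r // sqr_ge0.
Qed.

Variables (chi : I -> R) (width : nat -> R) (L1 : nat).
Hypothesis width0 : forall l, 0 <= width l.
Hypothesis small : forall l x w, (l <= L1)%N -> ball_d x -> (size w <= k)%N ->
  `|\sum_i chi i * test_vec l (near l x) w i| <= width l * level_scale l (k - size w).
Hypotheses (L1N : (4 ^ L1 <= 4 * N)%N) (NL1 : (N <= 4 ^ L1)%N).

(** The colouring controls increments only with the polynomial centred at the net point; [expand_at]
    moves the centre to [z], with 60 = 40 + 20. *)
Lemma level_increment l x z w : (l <= L1)%N -> ball_d x -> (size w <= k)%N ->
  (forall c, `|(z - near l x) ord0 c| <= 20 / 4 ^+ l) ->
  `|\sum_i chi i * g i * (side (near l x) i - parent_side l (near l x) i) * wpow w (p i).1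
       * aff (p i) z ^+ (k - size w)|
    <= width l * (2 * Num.sqrt N%:R * 2^-1 ^+ l) * (60 * d%:R / 4 ^+ l) ^+ (k - size w).
Proof.
move=> lL Bx wk zx; set y := near l x.
have -> : 60 * d%:R / 4 ^+ l = 40 * d%:R / 4 ^+ l + d%:R * (20 / 4 ^+ l) :> R by ring.
have c0 : 0 <= width l * (2 * Num.sqrt N%:R * 2^-1 ^+ l).
  by rewrite !mulr_ge0 ?exprn_ge0 ?sqrtr_ge0 ?width0.
have c1 : 0 <= 40 * d%:R / 4 ^+ l :> R by rewrite divr_ge0 ?exprn_ge0 ?mulr_ge0.
have c2 : 0 <= 20 / 4 ^+ l :> R by rewrite divr_ge0 ?exprn_ge0.
apply: (expand_at (y := y)) => //.
move=> w' m' e; have wk' : (size w' <= k)%N by lia.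
have -> : m' = (k - size w')%N by lia.
rewrite -mulrA.
have -> : 2 * Num.sqrt N%:R * 2^-1 ^+ l * (40 * d%:R / 4 ^+ l) ^+ (k - size w') = level_scale l (k - size w') by [].
apply: le_trans (small lL Bx wk'); rewrite le_eqVlt; apply/orP; left; apply/eqP; congr (`| _ |).
by apply: eq_bigr => i _; rewrite /test_vec; ring.
Qed.

(** The descent goes from [near l.+1 x] to its own nearest point at level [l], not to that of [x],
    since the test vectors compare a net point with its parent. *)
Lemma chain l x z w : (l <= L1)%N -> ball_d x -> (size w <= k)%N ->
  (forall c, `|(z - near l x) ord0 c| <= 20 / 4 ^+ l) ->
  `|\sum_i chi i * g i * side (near l x) i * wpow w (p i).1 * aff (p i) z ^+ (k - size w)|
    <= \sum_(j < l.+1) width j * (2 * Num.sqrt N%:R * 2^-1 ^+ j) * (60 * d%:R / 4 ^+ j) ^+ (k - size w).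
Proof.
elim: l x => [|l IHl] x lL Bx wk zx; rewrite big_ord_recr /=.
  rewrite big_ord0 add0r; apply: le_trans (level_increment lL Bx wk zx).
  rewrite le_eqVlt; apply/orP; left; apply/eqP; congr (`| _ |).
  by apply: eq_bigr => i _; rewrite /= subr0.
set y := near l.+1 x; have By : ball_d y by apply: near_ball.
have -> : \sum_i chi i * g i * side y i * wpow w (p i).1 * aff (p i) z ^+ (k - size w) =
  \sum_i chi i * g i * side (near l y) i * wpow w (p i).1 * aff (p i) z ^+ (k - size w) +
  \sum_i chi i * g i * (side y i - side (near l y) i) * wpow w (p i).1 * aff (p i) z ^+ (k - size w).
  by rewrite -big_split /=; apply: eq_bigr => i _; ring.
apply: le_trans (ler_normD _ _) _; apply: lerD; last exact: (level_increment lL Bx wk zx).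
apply: IHl => //; first exact: ltnW.
(* The radius 20/4^l is stable under passing to the parent: 20/4^(l+1) + 10/4^l is at most
   20/4^l. *)
move=> c; have lN : (4 ^ l <= 4 * N)%N by apply: leq_trans L1N; rewrite leq_exp2l // ltnW.
have [h _] := nsep_small I0 By (near_ball l By) lN (near_close l By).
have -> : z - near l y = (z - y) + (y - near l y) by rewrite addrA subrK.
rewrite mxE; apply: le_trans (ler_normD _ _) _; apply: le_trans (lerD (zx c) (h c)) _.
have : 0 <= (4 ^+ l)^-1 :> R by rewrite invr_ge0 exprn_ge0.
by rewrite exprS invfM; move: ((4 ^+ l)^-1) => t; lra.
Qed.

(** At level [L1] the separation count is below N/4^L1 <= 1, hence zero: [z] and its net point lie
    on the same side of every hyperplane, and the chain ends without a remainder. *)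
Lemma chain_end z w : ball_d z -> (size w <= k)%N ->
  `|\sum_i chi i * g i * side z i * wpow w (p i).1 * aff (p i) z ^+ (k - size w)|
    <= \sum_(j < L1.+1) width j * (2 * Num.sqrt N%:R * 2^-1 ^+ j) * (60 * d%:R / 4 ^+ j) ^+ (k - size w).
Proof.
move=> Bz wk.
have [h1 _] := nsep_small I0 Bz (near_ball L1 Bz) L1N (near_close L1 Bz).
have sE i : side z i = side (near L1 z) i.
  have : nsep (with_grid p) z (near L1 z) = 0%N.
    by apply/eqP; rewrite -leqn0 -ltnS -(ltn_pmul2l (leq_trans I0 NL1)) muln1 (leq_trans (near_close L1 Bz)).
  move/card0_eq/(_ (inl i)); rewrite inE /= => /negbFE /eqP e.
  by rewrite /side e.
under eq_bigr do rewrite sE.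
apply: chain => // c; apply: le_trans (h1 c) _.
by rewrite ler_wpM2r ?invr_ge0 ?exprn_ge0 //; lra.
Qed.
End Chaining.

Lemma level_cost_ge0 (R : realType) K L l : 0 <= level_cost R K L l.
Proof.
have e0 := @expR_gt0 R 18; rewrite /level_cost; case: ifP => h.
  have l20 : 0 <= ln 2 :> R by rewrite ln_ge0 //; lra.
  have : ln (level_width R K L l) <= 0.
    by rewrite ln_le0 // /level_width h exprn_ile1 //; lra.
  lra.
rewrite mulr_ge0 ?expR_ge0 //; lra.
Qed.

Lemma big_option (V : nmodType) (T : finType) (F : option T -> V) :
  \sum_j F j = F None + \sum_t F (Some t).
Proof.
rewrite (bigD1 None) //=; congr (_ + _).
rewrite (reindex_omap (@Some T) id) /=; last by case.
by apply: eq_bigl => t; rewrite eqxx.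
Qed.

Definition all_words d k := flatten [seq words d n | n <- iota 0 k.+1].

Lemma mem_all_words d k (w : seq 'I_d) : (w \in all_words d k) = (size w <= k)%N.
Proof.
have memw n : forall u : seq 'I_d, size u = n -> u \in words d n.
  elim: n => [|n IHn] [|i u] //= [/IHn h].
  by apply/allpairsP; exists (i, u); rewrite /= mem_enum.
apply/flattenP/idP => [[s /mapP[n]]|wk].
  by rewrite mem_iota => /= nk -> /size_words ->; rewrite -ltnS.
by exists (words d (size w)); [apply/mapP; exists (size w); rewrite ?mem_iota|apply: memw].
Qed.

(** The tests are one per level, net point and word, and one more, [None], for the total mass. The
    latter keeps the renormalisation harmless for every order of derivative; its cost is linear in
    L, far below 4^(Ld). *)
Lemma colouring (R : realType) (d k : nat) : (0 < d)%N -> exists2 C : R, 0 < C &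
  forall (I : finType) (p : I -> param R d) (g : I -> R),
  C <= #|I|%:R -> (forall i, dict_set (p i)) -> (forall i, 0 <= g i <= 1) ->
  exists (chi : I -> R) (L : nat),
  [/\ forall i, [\/ chi i = -1, chi i = 0 | chi i = 1],
      (#|I| <= 8 * #|[pred i | chi i != 0%R]|)%N,
      #|I|%:R <= C * 4 ^+ (L * d),
      forall (w : seq 'I_d) z, (size w <= k)%N -> ball_d z ->
       `|\sum_i chi i * g i * side p z i * wpow w (p i).1 * aff (p i) z ^+ (k - size w)|
         <= C * Num.sqrt #|I|%:R * 2^-1 ^+ (L * (2 * (k - size w) + 1))
    & `|\sum_i chi i * g i| <= Num.sqrt #|I|%:R * 2^-1 ^+ (L * (2 * k + 1))].
Proof.
move=> d0; pose K := (2 * k + 2)%N; pose W := all_words d k.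
pose P0 := (2 * (4 * d.+1 * d).+1 ^ d)%N.
(* [A0] times 4^(Ld) bounds the total cost: the first summand is for the nets, with 5 from
   [sum_level_decay], the second for the mass test. *)
pose A0 : R := (P0 * size W)%:R * cost_const R K d * 5 + (4 + 4 * expR 18 + (2 * k + 1)%:R).
have e0 := @expR_gt0 R 18.
have cc0 := cost_const_gt0 R K d.
have A1 : 1 <= A0.
  have : 0 <= (P0 * size W)%:R * cost_const R K d * 5 by rewrite !mulr_ge0 // ltW.
  have : 0 <= (2 * k + 1)%:R :> R by [].
  by rewrite /A0; lra.
have B0 : 0 <= 10 * (60 * d%:R) ^+ k :> R by rewrite mulr_ge0 // exprn_ge0 // mulr_ge0.
have D1 : 1 <= 4 ^+ d :> R by rewrite exprn_ege1 //; lra.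
have DA : 16 * A0 <= 16 * A0 * 4 ^+ d by rewrite ler_peMr // mulr_ge0 //; lra.
pose C : R := 3 + 16 * A0 * 4 ^+ d + 10 * (60 * d%:R) ^+ k.
exists C => [|I p g CN hp hg]; first by rewrite /C; lra.
set N := #|I| in CN *.
have N3 : (3 <= N)%N by rewrite -(ler_nat R) (le_trans _ CN) // /C; lra.
have I0 : (0 < #|I|)%N by rewrite -/N (leq_trans _ N3).
(* The largest level at which the total cost stays within the N/16 allowed by [partial_colouring];
   maximality gives the converse bound of N by 4^(Ld). *)
have [L LN LN'] : exists2 L, 16 * A0 * 4 ^+ (L * d) <= N%:R & N%:R < 16 * A0 * 4 ^+ (L.+1 * d).
  pose Q L := 16 * A0 * 4 ^+ (L * d) <= N%:R.
  have exQ : exists L, Q L by exists 0%N; rewrite /Q mul0n expr0 mulr1 (le_trans _ CN) // /C; lra.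
  have ubQ L : Q L -> (L <= N)%N.
    rewrite /Q => h; rewrite -(ler_nat R) (le_trans _ h) //.
    apply: (@le_trans _ _ (4 ^+ (L * d))); last by rewrite ler_peMl ?exprn_ge0 //; lra.
    rewrite -natrX ler_nat (leq_trans (leq_pmulr L d0)) // ltnW // ltn_expl //.
  case: (ex_maxnP exQ ubQ) => L QL Lmax; exists L => //.
  by rewrite ltNge; apply/negP => /Lmax; rewrite ltnn.
(* The finest level: 4^L1 >= N for [chain_end], and at most 4 N for [nsep_small]. *)
have [L1 NL1 L1N] : exists2 L1, (N <= 4 ^ L1)%N & (4 ^ L1 <= 4 * N)%N.
  have exQ : exists L1, (N <= 4 ^ L1)%N by exists N; rewrite ltnW // ltn_expl.
  case: (ex_minnP exQ) => -[|L1] h1 h2; first by exists 0%N; rewrite // expn0 muln_gt0.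
  exists L1.+1 => //; rewrite expnS leq_mul2l /= leqNgt; apply/negP => h.
  by have := h2 L1 (ltnW h); rewrite ltnn.
have [net netP] := exists_nets p d0 I0.
have [near nearP] : exists near : nat * 'rV[R]_d -> 'rV[R]_d, forall lx, ball_d lx.2 ->
    near lx \in net lx.1 /\ (4 ^ lx.1 * nsep (with_grid p) lx.2 (near lx) < #|I|)%N.
  suff H lx : exists y, ball_d lx.2 ->
      y \in net lx.1 /\ (4 ^ lx.1 * nsep (with_grid p) lx.2 y < #|I|)%N.
    by have [near nearP] := choice H; exists near.
  case: lx => l x /=.
  have [Bx|nBx] := pselect (ball_d x); last by exists 0.
  by have [_ _ /(_ x Bx)[y yn yc]] := netP l; exists y.
pose nr l x := near (l, x).
have nr_net l x : ball_d x -> nr l x \in net l by move=> Bx; have [] := nearP (l, x) Bx.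
have nr_close l x : ball_d x -> (4 ^ l * nsep (with_grid p) x (nr l x) < #|I|)%N.
  by move=> Bx; have [] := nearP (l, x) Bx.
have nr_ball l x : ball_d x -> ball_d (nr l x).
  by move=> Bx; have [h _ _] := netP l; apply/h/nr_net.
pose T := {l : 'I_L1.+1 & ('I_(size (net l)) * 'I_(size W))%type}.
pose ty (s : T) := nth 0 (net (tag s)) (tagged s).1.
pose tw (s : T) := nth [::] W (tagged s).2.
pose v (j : option T) := if j is Some s then test_vec k p g nr (tag s) (ty s) (tw s) else g.
pose mw : R := 2^-1 ^+ (L * (2 * k + 1)).
pose wd (j : option T) := if j is Some s then
  level_width R K L (tag s) * level_scale R d I (tag s) (k - size (tw s)) else mw * Num.sqrt N%:R.
pose cs (j : option T) := if j is Some s then level_cost R K L (tag s)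
  else ln 2 + 2 + 4 * expR 18 - ln mw.
have N0 : 0 < N%:R :> R by rewrite ltr0n.
have sN0 : 0 < Num.sqrt N%:R :> R by rewrite sqrtr_gt0.
have mw0 : 0 < mw by rewrite exprn_gt0.
have sc0 l m : 0 < level_scale R d I l m.
  by rewrite /level_scale !mulr_gt0 ?exprn_gt0 // divr_gt0 ?exprn_gt0 // mulr_gt0 // ltr0n.
have wd0 j : 0 < wd j.
  by case: j => [s|]; rewrite /wd mulr_gt0 // level_width_gt0.
have ty_ball s : ball_d (ty s).
  by have [h _ _] := netP (tag s); apply/h/mem_nth.
have cost j : test_cost (v j) (wd j) (cs j).
  case: j => [s|] /=.
    apply: level_test_cost; first exact: sc0.
    apply: test_vec_norm => // l' e; apply: leq_trans L1N.
    by rewrite leq_exp2l // -ltnS -e ltnW.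
  apply: cost_small => //; last by rewrite exprn_ile1 //; lra.
  rewrite (sqr_sqrtr (ltW N0)) -[X in _ <= X]mulr1 mulr_natl -sumr_const; apply: ler_sum => i _.
  by have /andP[h1 h2] := hg i; rewrite exprn_ile1.
have csum : \sum_j cs j <= #|I|%:R / 16.
  rewrite -/N ler_pdivlMr // mulrC; apply: le_trans LN; rewrite -mulrA ler_pM2l //.
  rewrite big_option /= addrC /A0 [(_ + _) * _ ^+ _]mulrDl; apply: lerD.
    pose F (l : 'I_L1.+1) (ab : 'I_(size (net l)) * 'I_(size W)) := level_cost R K L l.
    rewrite -(sig_big_dep predT (fun _ => predT) F) /=.
    apply: (@le_trans _ _ (\sum_(l < L1.+1) (P0 * size W)%:R * (4 ^+ (L * d) * (cost_const R K d * level_decay R L l)))).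
      apply: ler_sum => l _; rewrite /F sumr_const card_prod !card_ord -[_ *+ (_ * _)%N]mulr_natl.
      apply: (@le_trans _ _ ((P0 * size W)%:R * (4 ^+ (l * d) * level_cost R K L l))).
        rewrite [X in _ <= X]mulrA ler_wpM2r ?level_cost_ge0 // -natrX -natrM ler_nat.
        by rewrite mulnAC leq_mul2r; have [_ -> _] := netP l; rewrite orbT.
      by rewrite ler_wpM2l // level_cost_decay.
    rewrite -!mulr_sumr mulrCA [X in _ <= X]mulrC ler_pM2l ?exprn_gt0 // mulrA.
    by rewrite ler_wpM2l ?sum_level_decay // mulr_ge0 // ltW.
  rewrite /mw lnXn ?invr_gt0 // lnV ?posrE // mulNrn opprK -[ln 2 *+ _]mulr_natl.
  have l2 := ln2_le1 R; have l20 : 0 <= ln 2 :> R by rewrite ln_ge0 //; lra.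
  have L4 : L%:R <= 4 ^+ (L * d) :> R.
    by rewrite -natrX ler_nat (leq_trans (leq_pmulr L d0)) // ltnW // ltn_expl.
  have L4' : 1 <= 4 ^+ (L * d) :> R by rewrite exprn_ege1 //; lra.
  have s1 : (L * (2 * k + 1))%:R * ln 2 <= 4 ^+ (L * d) * (2 * k + 1)%:R :> R.
    apply: (@le_trans _ _ ((L * (2 * k + 1))%:R)); first by rewrite ler_piMr.
    by rewrite natrM ler_wpM2r.
  rewrite [(_ + _) * _ ^+ _]mulrDl [_%:R * 4 ^+ _]mulrC.
  have : ln 2 + 2 + 4 * expR 18 <= (4 + 4 * expR 18) * 4 ^+ (L * d) :> R.
    by apply: (@le_trans _ _ (4 + 4 * expR 18)); [lra|rewrite ler_peMr //; lra].
  lra.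
have [chi [chi1 chi2 chi3]] := partial_colouring N3 wd0 cost csum.
exists chi, L; split => //.
- apply: le_trans (ltW LN') _; rewrite mulSn exprD mulrA ler_pM2r ?exprn_gt0 // /C; lra.
- move=> w z wk Bz.
  have small l x u : (l <= L1)%N -> ball_d x -> (size u <= k)%N ->
     `|\sum_i chi i * test_vec k p g nr l (nr l x) u i| <=
     level_width R K L l * level_scale R d I l (k - size u).
    rewrite -ltnS => lL Bx uk.
    have yn : (index (nr l x) (net l) < size (net l))%N by rewrite index_mem nr_net.
    have un : (index u W < size W)%N by rewrite index_mem mem_all_words.
    pose s : T := existT _ (Ordinal lL) (Ordinal yn, Ordinal un).
    have := chi3 (Some s); rewrite /v /wd /tw /ty /= !nth_index ?mem_all_words //.
    exact: nr_net.
  apply: le_trans (chain_end d0 I0 nr_ball nr_close (fun l => ltW (level_width_gt0 R K L l)) small L1N NL1 Bz wk) _.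
  set m := (k - size w)%N.
  apply: (@le_trans _ _ (\sum_(j < L1.+1) 2 * Num.sqrt N%:R * (60 * d%:R) ^+ k *
     (2^-1 ^+ (L * (2 * m + 1)) * level_decay R L j))).
    apply: ler_sum => j _.
    have -> : level_width R K L j * (2 * Num.sqrt N%:R * 2^-1 ^+ j) * (60 * d%:R / 4 ^+ j) ^+ m =
       2 * Num.sqrt N%:R * (60 * d%:R) ^+ m * (2^-1 ^+ (j * (2 * m + 1)) * level_width R K L j).
      have -> : 2^-1 ^+ (j * (2 * m + 1)) = 2^-1 ^+ j * (4^-1 ^+ j) ^+ m :> R.
        rewrite mulnDr muln1 addnC exprD; congr (_ * _).
        by rewrite -exprM mulnCA exprM; congr (_ ^+ _); field.
      by rewrite exprMn -[(4 ^+ j)^-1]exprVn; ring.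
    apply: ler_pM; rewrite ?mulr_ge0 ?exprn_ge0 ?sqrtr_ge0 ?(ltW (level_width_gt0 _ _ _ _)) //.
      rewrite ler_pM2l ?mulr_gt0 // ler_weXn2l // ?leq_subr //.
      have : 1 <= d%:R :> R by rewrite ler1n.
      lra.
    by rewrite level_width_decay // leq_add2r leq_mul2l leq_subr orbT.
  rewrite -!mulr_sumr; have := sum_level_decay R L L1.+1.
  set S := \sum_(j < _) _; set b := (60 * d%:R) ^+ k; set h := 2^-1 ^+ _; set a := Num.sqrt _ => S5.
  have -> : 2 * a * b * (h * S) = a * h * (2 * b * S) by ring.
  have -> : C * a * h = a * h * C by ring.
  apply: ler_wpM2l; first by rewrite mulr_ge0 ?exprn_ge0 // sqrtr_ge0.
  apply: (@le_trans _ _ (2 * b * 5)); last by rewrite /C -/b; lra.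
  by rewrite ler_wpM2l // mulr_ge0 // exprn_ge0 // mulr_ge0.
by have := chi3 None; rewrite /v /wd mulrC.
Qed.

(** * Removing a fraction of the points *)

Section Rate.
Variables (R : realType) (d : nat).
Hypothesis d0 : (0 < d)%N.
Implicit Types N m : nat.

Definition rate N m : R := N%:R `^ (- (2^-1 + (2 * m + 1)%:R / (2 * d)%:R)).
(** The 2d-th root of N: in terms of it the rates involve only natural powers and a square root. *)
Definition root2d N : R := N%:R `^ ((2 * d)%:R^-1).

Lemma root2d_gt0 N : (0 < N)%N -> 0 < root2d N.
Proof. by move=> N0; rewrite powR_gt0 // ltr0n. Qed.

Lemma root2dK N : root2d N ^+ (2 * d) = N%:R.
Proof.
by rewrite -powR_mulrn ?powR_ge0 // -powRrM mulVf ?powRr1 // pnatr_eq0 muln_eq0 /= -lt0n.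
Qed.

Lemma rateE N m : (0 < N)%N -> rate N m = (Num.sqrt N%:R)^-1 * (root2d N ^+ (2 * m + 1))^-1.
Proof.
move=> N0; have N0' : N%:R != 0 :> R by rewrite pnatr_eq0 -lt0n.
rewrite /rate powRN powRD; last by rewrite N0' implybT.
rewrite invfM powR12_sqrt //; congr (_ * _^-1).
by rewrite -powR_mulrn ?powR_ge0 // -powRrM mulrC.
Qed.

Lemma rate_gt0 N m : (0 < N)%N -> 0 < rate N m.
Proof. by move=> N0; rewrite powR_gt0 // ltr0n. Qed.

Lemma root2d_le N N' : (N <= N')%N -> root2d N <= root2d N'.
Proof.
by move=> h; rewrite /root2d ge0_ler_powR ?nnegrE ?invr_ge0 // ler_nat.
Qed.

Lemma rate_le N N' m : (0 < N)%N -> (N <= N')%N -> rate N' m <= rate N m.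
Proof.
move=> N0 h; have N0' := leq_trans N0 h; rewrite !rateE //.
have s0 n : (0 < n)%N -> 0 < Num.sqrt n%:R :> R by move=> n0; rewrite sqrtr_gt0 ltr0n.
apply: ler_pM; rewrite ?invr_ge0 ?exprn_ge0 ?sqrtr_ge0 ?powR_ge0 //.
  by rewrite lef_pV2 ?posrE ?s0 // ler_wsqrtr // ler_nat.
rewrite lef_pV2 ?posrE ?exprn_gt0 ?root2d_gt0 //.
by rewrite lerXn2r ?nnegrE ?powR_ge0 // root2d_le.
Qed.

(** The factor N^(-1/2) alone gives the gain, as (101/100)^2 < 32/31; hence it depends neither on
    [d] nor on [m]. *)
Lemma rate_decrease N N' m : (0 < N)%N -> (32 * N <= 31 * N')%N ->
  101 / 100 * rate N' m <= rate N m.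
Proof.
move=> N0 h; have N0' : (0 < N')%N by lia.
rewrite !rateE // mulrA.
have s0 n : (0 < n)%N -> 0 < Num.sqrt n%:R :> R by move=> n0; rewrite sqrtr_gt0 ltr0n.
apply: ler_pM; rewrite ?mulr_ge0 ?invr_ge0 ?exprn_ge0 ?sqrtr_ge0 ?powR_ge0 //.
  rewrite -[X in _ <= X]mul1r ler_pdivlMr ?s0 // mulrAC ler_pdivrMr ?s0 // mul1r.
  rewrite -(@ler_pXn2r _ 2) ?nnegrE ?mulr_ge0 ?sqrtr_ge0 // exprMn !sqr_sqrtr //.
  have : (32 * N)%:R <= (31 * N')%:R :> R by rewrite ler_nat.
  by rewrite !natrM; have : 0 <= N%:R :> R by []; lra.
rewrite lef_pV2 ?posrE ?exprn_gt0 ?root2d_gt0 //.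
by rewrite lerXn2r ?nnegrE ?powR_ge0 // root2d_le //; lia.
Qed.

(** A single power below the rates of all orders; it absorbs the discretisation error, and trivial
    bounds when N is bounded. *)
Lemma rate_lower N m k : (0 < N)%N -> (m <= k)%N -> (N%:R ^+ k.+1)^-1 <= rate N m.
Proof.
move=> N0 mk; have N1 : 1 <= N%:R :> R by rewrite ler1n.
rewrite -powR_mulrn // -powRN /rate ler_powR // lerN2.
have -> : k.+1%:R = 2^-1 + (2 * k + 1)%:R / 2 :> R.
  by rewrite natrD natrM -natr1; field.
rewrite lerD2l; apply: (@le_trans _ _ ((2 * m + 1)%:R / 2)); last first.
  by rewrite ler_wpM2r // ler_nat; lia.
rewrite ler_wpM2l // lef_pV2 ?posrE ?ltr0n ?muln_gt0 //.
by rewrite natrM ler_peMr // ler1n.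
Qed.

Lemma level_rate N L m (c : R) : (0 < N)%N -> 1 <= c -> N%:R <= c * 4 ^+ (L * d) ->
  2^-1 ^+ (L * (2 * m + 1)) <= c ^+ (2 * m + 1) * (root2d N ^+ (2 * m + 1))^-1.
Proof.
move=> N0 c1 h; have c0 : 0 < c by lra.
have r0 := root2d_gt0 N0.
have h1 : root2d N <= c * 2 ^+ L.
  rewrite -(@ler_pXn2r _ (2 * d)) ?nnegrE ?mulr_ge0 ?exprn_ge0 ?powR_ge0 ?muln_gt0 ?(ltW c0) //.
  rewrite root2dK exprMn; apply: le_trans h _.
  have -> : (2 ^+ L) ^+ (2 * d) = 4 ^+ (L * d) :> R.
    rewrite -exprM mulnCA exprM; congr (_ ^+ _); ring.
  rewrite ler_wpM2r ?exprn_ge0 // -[X in X <= _]expr1 ler_weXn2l // muln_gt0 //.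
rewrite exprM -expr_div_n lerXn2r ?nnegrE ?exprn_ge0 ?divr_ge0 ?(ltW c0) ?(ltW r0) //.
rewrite ler_pdivlMr // exprVn mulrC ler_pdivrMr ?exprn_gt0 //.
Qed.
End Rate.

Section Step.
Variables (R : realType) (d k : nat) (I : finType) (p : I -> param R d).
Hypotheses (d0 : (0 < d)%N) (hp : forall i, dict_set (p i)).
Implicit Types (a b : I -> R) (w : seq 'I_d).

(** Up to the factor k!/(k-|w|)!, the derivative along the word [w] of the integral of sigma_k
    against the measure with weights [a] at the points [p]. *)
Definition fint a w z : R :=
  \sum_i a i * side p z i * wpow w (p i).1 * aff (p i) z ^+ (k - size w).

Definition supp_size a := #|[pred i | a i != 0%R]|.

Definition is_distr a := (forall i, 0 <= a i) /\ \sum_i a i = 1.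

Lemma atom_le w z i : (size w <= k)%N -> ball_d z ->
  `|side p z i * wpow w (p i).1 * aff (p i) z ^+ (k - size w)| <= (d%:R + 1) ^+ k.
Proof.
move=> wk Bz; rewrite !normrM normrX -[X in _ <= X]mul1r.
have d1 : 1 <= d%:R + 1 :> R by rewrite lerDr.
apply: ler_pM; rewrite ?mulr_ge0 ?exprn_ge0 //.
  rewrite -[X in _ <= X]mul1r; apply: ler_pM => //.
    by rewrite /side; case: (0 <= _); rewrite ?normr1 ?normr0.
  by rewrite -(expr1n R (size w)) wpow_le // => c; apply: dict_coord.
apply: (@le_trans _ _ ((d%:R + 1) ^+ (k - size w))).
  have d2 : 0 <= d%:R + 1 :> R by lra.
  by rewrite lerXn2r ?nnegrE ?aff_le.
by rewrite ler_weXn2l // leq_subr.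
Qed.

Lemma fint_le a w z : (forall i, 0 <= a i) -> (size w <= k)%N -> ball_d z ->
  `|fint a w z| <= (d%:R + 1) ^+ k * \sum_i a i.
Proof.
move=> a0 wk Bz; rewrite mulr_sumr; apply: le_trans (ler_norm_sum _ _ _) _.
apply: ler_sum => i _; rewrite -!mulrA normrM (ger0_norm (a0 i)) mulrC ler_wpM2r //.
by rewrite mulrA atom_le.
Qed.

Lemma fintB a b w z : fint a w z - fint b w z = fint (fun i => a i - b i) w z.
Proof. by rewrite /fint -sumrB; apply: eq_bigr => i _; ring. Qed.

Lemma fintZ a w z c : fint (fun i => c * a i) w z = c * fint a w z.
Proof. by rewrite /fint mulr_sumr; apply: eq_bigr => i _; rewrite !mulrA. Qed.

Lemma point_mass a : is_distr a -> exists2 b, is_distr b & supp_size b = 1%N.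
Proof.
move=> [a0 a1].
have [i0 _] : exists i : I, True.
  apply: contrapT => no; have : \sum_i a i = 0 by rewrite big1 // => i; case: no; exists i.
  by rewrite a1 => /eqP; rewrite oner_eq0.
exists (fun i => (i == i0)%:R); first split => //.
  by rewrite (bigD1 i0) //= eqxx big1 ?addr0 // => i /negbTE ->.
rewrite /supp_size -(card1 i0); apply: eq_card => i; rewrite !inE.
by case: (i == i0); rewrite ?oner_eq0 ?eqxx.
Qed.

End Step.

(** Markov's inequality: at most half of the points weigh more than twice the average. *)
Lemma light_points (R : realType) (I : finType) (a : I -> R) : is_distr a ->
  (supp_size a <= 2 * #|[pred i | (a i != 0%R) && (a i * (supp_size a)%:R <= 2%:R)%R]|)%N.
Proof.
move=> [a0 a1]; set N := supp_size a; set Q := [pred i | _].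
pose H := [pred i | (2 < a i * N%:R)%R].
have cN : (N <= #|Q| + #|H|)%N.
  rewrite -cardUI; apply: leq_trans (leq_addr _ _); apply: subset_leq_card.
  apply/fintype.subsetP => i; rewrite !inE => h; rewrite h /=.
  by case: (lerP (a i * N%:R) 2).
have hH : (2 * #|H| <= N)%N.
  have NE : N%:R = \sum_i a i * N%:R :> R by rewrite -mulr_suml a1 mul1r.
  rewrite -(ler_nat R) natrM [X in _ <= X]NE mulr_natr -sumr_const big_mkcond /=.
  by apply: ler_sum => i _; rewrite inE; case: ifP => [/ltW|_]; rewrite ?mulr_ge0.
lia.
Qed.

Lemma sum_insub (R : realType) (I : finType) (Q : pred I) (chi : {i | Q i} -> R) (f : I -> R) :
  \sum_i (if insub i is Some t then chi t else 0) * f i = \sum_(t : {i | Q i}) chi t * f (val t).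
Proof.
rewrite (bigID Q) /= [X in _ + X]big1 ?addr0; last first.
  by move=> i Qi; rewrite insubN // mul0r.
rewrite (reindex_omap (val : {i | Q i} -> I) insub) /=; last first.
  by move=> i Qi; rewrite insubT /=.
apply: eq_big => [t|t _]; first by rewrite valK eqxx (valP t).
by rewrite valK.
Qed.

(** Half of the points are light, an eighth of those are coloured, and for one of the two signs a
    sixteenth of them get colour -1 and disappear; this removes 1/32 of all points. On light points
    a = (2/N) g with [g] in [0, 1], so errors are 2/N times discrepancies. *)
Lemma halving_step (R : realType) (d k : nat) : (0 < d)%N -> exists2 C : R, 0 < C &
  forall (I : finType) (p : I -> param R d) (a : I -> R), (forall i, dict_set (p i)) ->
  is_distr a -> (2 <= supp_size a)%N ->
  exists b, [/\ is_distr b, (32 * supp_size b <= 31 * supp_size a)%N &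
    forall (w : seq 'I_d) z, (size w <= k)%N -> ball_d z ->
    `|fint k p a w z - fint k p b w z| <= C * rate R d (supp_size a) (k - size w)].
Proof.
have half_sqrt (s : R) : 4 <= s -> 2 <= 2^-1 * s by lra.
have sign_count (x y u t : nat) : (t <= 8 * x -> 16 * y < t -> x <= y + u -> t <= 16 * u)%N by lia.
have one_point (n : nat) : (2 <= n -> 32 * 1 <= 31 * n)%N by lia.
have supp_count (x y t n : nat) : (x + y <= n -> t <= 16 * y -> n <= 2 * t -> 32 * x <= 31 * n)%N by lia.
have half1 : 2^-1 <= 1 :> R by lra.
have half_pos (x : R) : `|x| <= 2^-1 -> 0 < 1 + x by rewrite ler_norml; lra.
move=> d0; have [C0 C00 col] := colouring R k d0.
(* From N >= c follow at least C0 light points, as [colouring] requires, and sqrt(N) >= 4, which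
   keeps the change of mass [delta] within 1/2. *)
pose c : R := 2 * C0 + 16; pose D : R := (d%:R + 1) ^+ k.
have cmul (x t : R) : 0 <= t -> x <= C0 * t -> 2 * x <= c * t by rewrite /c; nra.
have c1 : 1 <= c by rewrite /c; lra.
have D1 : 1 <= D by rewrite exprn_ege1 // lerDr.
have ck n : 1 <= c ^+ n by rewrite exprn_ege1.
pose Cs := 2 * D * c ^+ k.+1; pose Cb := 2 * (C0 + D) * c ^+ (2 * k + 1).
have ck0 n : 0 < c ^+ n by rewrite (lt_le_trans ltr01).
have D0 : 0 < D by lra.
have CD0 : 0 < C0 + D by lra.
have Cs0 : 0 < Cs by rewrite !mulr_gt0.
have Cb0 : 0 < Cb by rewrite /Cb !mulr_gt0.
exists (Cs + Cb) => [|I p a hp da N2]; first exact: addr_gt0.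
have [a0 a1] := da; set N := supp_size a in N2 *.
have N0 : (0 < N)%N by rewrite ltnW.
have N0' : 0 < N%:R :> R by rewrite ltr0n.
(* For bounded N any point mass will do: the error is at most 2 D, and the rate is at least
   c^-(k+1). *)
have [Nc|cN] := ltP N%:R c.
  have [b db sb] := point_mass da; exists b; split => //; first by rewrite sb one_point.
  move=> w z wk Bz; have [b0 b1] := db.
  have h1 := fint_le hp a0 wk Bz; have h2 := fint_le hp b0 wk Bz.
  rewrite a1 b1 mulr1 -/D in h1 h2.
  apply: le_trans (ler_normB _ _) _; apply: (@le_trans _ _ (2 * D)); first by lra.
  apply: (@le_trans _ _ (Cs * rate R d N (k - size w))); last first.
    by rewrite ler_wpM2r ?(ltW (rate_gt0 _ _ _ N0)) // lerDl ltW.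
  apply: le_trans (ler_wpM2l (ltW Cs0) (rate_lower R d0 N0 (leq_subr (size w) k))).
  rewrite -[Cs / _]mulrA ler_peMr //; first by rewrite mulr_ge0 //; lra.
  rewrite ler_pdivlMr ?exprn_gt0 // mul1r lerXn2r ?nnegrE ?(ltW Nc) //; lra.
pose Q := [pred i | (a i != 0) && (a i * N%:R <= 2)].
have MN : (N <= 2 * #|Q|)%N := light_points da.
pose T : finType := {i | Q i}.
have cT : #|T| = #|Q| by rewrite card_sig.
pose g (t : T) : R := a (val t) * N%:R / 2.
have hg t : 0 <= g t <= 1.
  have /andP[_ h] := valP t; rewrite /g divr_ge0 ?mulr_ge0 //=.
  by rewrite ler_pdivrMr // mul1r.
have MN' : N%:R <= 2 * #|T|%:R :> R by rewrite cT -natrM ler_nat.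
have CT : C0 <= #|T|%:R by rewrite /c in cN; lra.
have [chi0 [L [v0 n0 NL bnd0 mass0]]] := col T (fun t => p (val t)) g CT (fun t => hp _) hg.
have [chi [v1 n1 bnd mass]] : exists chi : T -> R, [/\ forall i, [\/ chi i = -1, chi i = 0 | chi i = 1],
      (#|T| <= 16 * #|[pred i | chi i == (-1)%R]|)%N,
      forall (w : seq 'I_d) z, (size w <= k)%N -> ball_d z ->
       `|\sum_i chi i * g i * side (fun t => p (val t)) z i * wpow w (p (val i)).1 * aff (p (val i)) z ^+ (k - size w)|
         <= C0 * Num.sqrt #|T|%:R * 2^-1 ^+ (L * (2 * (k - size w) + 1))
    & `|\sum_i chi i * g i| <= Num.sqrt #|T|%:R * 2^-1 ^+ (L * (2 * k + 1))].
  have [h|h] := leqP #|T| (16 * #|[pred i | chi0 i == (-1)%R]|); first by exists chi0.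
  exists (fun t => - chi0 t); split.
  - move=> t; case: (v0 t) => ->; rewrite ?opprK ?oppr0; by [apply: Or33|apply: Or32|apply: Or31].
  - have : (#|[pred i | chi0 i != 0%R]| <= #|[pred i | chi0 i == (-1)%R]| + #|[pred i | - chi0 i == (-1)%R]|)%N.
      rewrite -cardUI; apply: leq_trans (leq_addr _ _); apply: subset_leq_card.
      apply/fintype.subsetP => t; rewrite !inE; case: (v0 t) => ->; rewrite ?eqxx ?orbT //.
    exact: sign_count n0 h.
  - move=> w z wk Bz; rewrite -normrN -sumrN.
    apply: le_trans (bnd0 w z wk Bz); rewrite le_eqVlt; apply/orP; left; apply/eqP; congr (`| _ |).
    by apply: eq_bigr => t _; ring.
  - by rewrite -normrN -sumrN; under eq_bigr do rewrite mulNr opprK.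
pose che i : R := if insub i is Some t then chi t else 0.
have che1 i : [\/ che i = -1, che i = 0 | che i = 1].
  by rewrite /che; case: insubP => [t _ _|_]; [apply: v1|apply: Or32].
have aE t : a (val t) = 2 / N%:R * g t by rewrite /g; field; rewrite gt_eqF.
have sumE (f : I -> R) : \sum_i che i * (a i * f i) = 2 / N%:R * \sum_t chi t * g t * f (val t).
  rewrite sum_insub mulr_sumr; apply: eq_bigr => t _; rewrite aE; ring.
pose delta := \sum_i che i * a i.
have dE : delta = 2 / N%:R * \sum_t chi t * g t.
  rewrite /delta; have := sumE (fun _ => 1).
  by under eq_bigr do rewrite mulr1; under [in X in _ = X -> _]eq_bigr do rewrite mulr1.
have sN0 : 0 < Num.sqrt N%:R :> R by rewrite sqrtr_gt0.
have sTN : Num.sqrt #|T|%:R <= Num.sqrt N%:R :> R.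
  rewrite ler_wsqrtr // ler_nat cT; apply: subset_leq_card.
  by apply/fintype.subsetP => i; rewrite !inE => /andP[].
have NE : 2 / N%:R * Num.sqrt N%:R = 2 / Num.sqrt N%:R :> R.
  rewrite -{1}[N%:R](@sqr_sqrtr _ N%:R) //; field; rewrite gt_eqF //.
have scale (x X : R) e : 0 <= X -> `|x| <= X * Num.sqrt #|T|%:R * 2^-1 ^+ e ->
    `|2 / N%:R * x| <= X * (2 / Num.sqrt N%:R) * 2^-1 ^+ e.
  move=> X0 hx; rewrite -NE normrM ger0_norm ?divr_ge0 //.
  have -> : X * (2 / N%:R * Num.sqrt N%:R) * 2^-1 ^+ e = 2 / N%:R * (X * Num.sqrt N%:R * 2^-1 ^+ e) by ring.
  rewrite ler_wpM2l ?divr_ge0 // (le_trans hx) // ler_wpM2r ?exprn_ge0 // ler_wpM2l //.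
have dB : `|delta| <= 2 / Num.sqrt N%:R * 2^-1 ^+ (L * (2 * k + 1)).
  by rewrite dE -[X in _ <= X * _]mul1r; apply: scale => //; rewrite mul1r.
have s4 : 4 <= Num.sqrt N%:R :> R.
  rewrite -(@ler_pXn2r _ 2) ?nnegrE ?sqrtr_ge0 // sqr_sqrtr // (le_trans _ cN) // /c; lra.
have dhalf : `|delta| <= 2^-1.
  apply: le_trans dB _; apply: (@le_trans _ _ (2 / Num.sqrt N%:R * 1)).
    by rewrite ler_wpM2l ?divr_ge0 ?sqrtr_ge0 // exprn_ile1.
  by rewrite mulr1 ler_pdivrMr // half_sqrt.
have d1 : 0 < 1 + delta := half_pos _ dhalf.
pose b0 i := a i * (1 + che i).
have b00 i : 0 <= b0 i by rewrite mulr_ge0 //; case: (che1 i) => ->; rewrite ?subrr ?addr0 ?addr_ge0.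
have b0s : \sum_i b0 i = 1 + delta.
  by rewrite -a1 /delta -big_split /=; apply: eq_bigr => i _; rewrite /b0; ring.
exists (fun i => (1 + delta)^-1 * b0 i); split.
- split=> [i|]; first by rewrite mulr_ge0 // invr_ge0 ltW.
  by rewrite -mulr_sumr b0s mulVf // gt_eqF.
- have : (supp_size (fun i => (1 + delta)^-1 * b0 i)%R + #|[pred i | chi i == (-1)%R]| <= N)%N.
    rewrite -(@fintype.card_image _ _ (val : T -> I) val_inj [pred i | chi i == -1]).
    rewrite -cardUI addnC -[X in (_ <= X)%N]add0n; apply: leq_add.
      rewrite leqn0 eq_card0 // => i; rewrite !inE; apply/negbTE/negP => /andP[h /fintype.imageP[t]].
      rewrite inE => /eqP ct iE; move/eqP: h; apply.
      by rewrite /b0 /che iE valK ct subrr mulr0 mulr0.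
    apply: subset_leq_card; apply/fintype.subsetP => i; rewrite !inE => /orP[|/fintype.imageP[t _ ->]].
      by apply: contra => /eqP ai; rewrite /b0 ai mul0r mulr0.
    by have /andP[] := valP t.
  by move=> h; apply: supp_count h n1 _; rewrite cT.
move=> w z wk Bz; rewrite fintZ; set m := (k - size w)%N.
(* The second term is the cost of normalising. As [b0] has mass 1 + delta, it is at most D |delta|,
   and the mass test has the width of the smallest error, the one with m = k. *)
have e1 : fint k p a w z - (1 + delta)^-1 * fint k p b0 w z =
   (fint k p a w z - fint k p b0 w z) + delta / (1 + delta) * fint k p b0 w z.
  by field; rewrite gt_eqF.
rewrite e1; apply: le_trans (ler_normD _ _) _.
have h1 : `|fint k p a w z - fint k p b0 w z| <= C0 * (2 / Num.sqrt N%:R) * 2^-1 ^+ (L * (2 * m + 1)).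
  rewrite distrC fintB; have -> : fint k p (fun i => b0 i - a i) w z =
      2 / N%:R * \sum_t chi t * g t * (side p z (val t) * wpow w (p (val t)).1 * aff (p (val t)) z ^+ m).
    by rewrite -(sumE (fun i => side p z i * wpow w (p i).1 * aff (p i) z ^+ m)) /fint; apply: eq_bigr => i _; rewrite /b0; ring.
  apply: scale; first exact: ltW.
  apply: le_trans (bnd w z wk Bz); rewrite le_eqVlt; apply/orP; left; apply/eqP; congr (`| _ |).
  by apply: eq_bigr => t _; rewrite /side -/m; ring.
have h2 : `|delta / (1 + delta) * fint k p b0 w z| <= D * (2 / Num.sqrt N%:R) * 2^-1 ^+ (L * (2 * m + 1)).
  have hb := fint_le hp b00 wk Bz; rewrite b0s -/D in hb.
  rewrite !normrM normfV (gtr0_norm d1).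
  apply: (@le_trans _ _ (`|delta| * D)).
    rewrite -mulrA ler_wpM2l // mulrC ler_pdivrMr //.
  rewrite mulrC -mulrA ler_wpM2l ?(ltW D0) //.
  apply: le_trans dB _; rewrite ler_wpM2l ?divr_ge0 ?sqrtr_ge0 // ler_wiXn2l //.
  by rewrite leq_mul2l leq_add2r leq_mul2l leq_subr !orbT.
have h3 : 2^-1 ^+ (L * (2 * m + 1)) <= c ^+ (2 * k + 1) * (root2d R d N ^+ (2 * m + 1))^-1.
  apply: (@le_trans _ _ (c ^+ (2 * m + 1) * (root2d R d N ^+ (2 * m + 1))^-1)).
    apply: level_rate => //; apply: le_trans MN' _.
    by apply: cmul => //; rewrite exprn_ge0.
  by rewrite ler_wpM2r ?invr_ge0 ?exprn_ge0 ?powR_ge0 // ler_weXn2l // leq_add2r leq_mul2l leq_subr orbT.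
apply: (@le_trans _ _ (Cb * rate R d N m)); last first.
  by rewrite ler_wpM2r ?(ltW (rate_gt0 _ _ _ N0)) // lerDr ltW.
apply: le_trans (lerD h1 h2) _; rewrite -mulrDl -mulrDl rateE //.
have -> : Cb * ((Num.sqrt N%:R)^-1 / root2d R d N ^+ (2 * m + 1)) =
   (C0 + D) * (2 / Num.sqrt N%:R) * (c ^+ (2 * k + 1) / root2d R d N ^+ (2 * m + 1)).
  by rewrite /Cb; ring.
by rewrite ler_wpM2l // mulr_ge0 ?divr_ge0 ?sqrtr_ge0 // ltW.
Qed.

(** A step from N to N' points costs C rate(N), at most 100 C (rate(N') - rate(N)) by
    [rate_decrease]. These costs telescope while N' > n; the last step, which may fall below n,
    costs at most C rate(n). *)
Lemma sparsify (R : realType) (d k : nat) : (0 < d)%N -> exists2 C : R, 0 < C &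
  forall (I : finType) (p : I -> param R d) (a : I -> R) n, (forall i, dict_set (p i)) ->
  is_distr a -> (0 < n)%N ->
  exists b, [/\ is_distr b, (supp_size b <= n)%N &
    forall (w : seq 'I_d) z, (size w <= k)%N -> ball_d z ->
    `|fint k p a w z - fint k p b w z| <= C * rate R d n (k - size w)].
Proof.
move=> d0; have [C C0 step] := halving_step R k d0.
exists (101 * C) => [|I p a n hp da n0]; first by rewrite mulr_gt0.
suff [b [db sb eb]] : exists b, [/\ is_distr b, (supp_size b <= n)%N &
    forall (w : seq 'I_d) z, (size w <= k)%N -> ball_d z ->
    `|fint k p a w z - fint k p b w z| <= C * rate R d n (k - size w) +
      100 * C * (rate R d n (k - size w) - rate R d (maxn n (supp_size a)) (k - size w))].
  exists b; split => // w z wk Bz; apply: le_trans (eb w z wk Bz) _.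
  have := rate_gt0 R d (k - size w) (leq_trans n0 (leq_maxl n (supp_size a))).
  move: (rate _ _ _ _) (rate _ _ _ _) => u v; nra.
have [N] := ubnP (supp_size a); elim: N a da => // N IHN a da /ltnSE aN.
have [an|an] := leqP (supp_size a) n.
  exists a; split => // w z _ _; rewrite subrr normr0 subrr mulr0 addr0.
  by rewrite mulr_ge0 ?(ltW C0) // ltW // rate_gt0.
have a2 : (2 <= supp_size a)%N by lia.
have [b [db sb eb]] := step I p a hp da a2.
have [bn|bn] := leqP (supp_size b) n.
  exists b; split => // w z wk Bz; apply: le_trans (eb w z wk Bz) _.
  have := rate_le R d (k - size w) n0 (ltnW an).
  move: (rate _ _ _ _) (rate _ _ _ _) => u v; nra.
have bN : (supp_size b < N)%N by lia.
have [c [dc sc ec]] := IHN b db bN.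
exists c; split => // w z wk Bz.
have -> : fint k p a w z - fint k p c w z =
  (fint k p a w z - fint k p b w z) + (fint k p b w z - fint k p c w z) by ring.
apply: le_trans (ler_normD _ _) _; apply: le_trans (lerD (eb w z wk Bz) (ec w z wk Bz)) _.
rewrite (maxn_idPr (ltnW bn)).
have := rate_decrease R d0 (k - size w) (ltn_trans n0 bn) sb.
move: (rate R d n _) (rate R d (supp_size a) _) (rate R d (supp_size b) _) => u v t.
nra.
Qed.

(** * Discretisation of a general measure *)

Section Cells.
Context {disp : measure_display} {Om : measurableType disp} {R : realType}.
Variable mu : probability Om R.
Implicit Types (D E B : set Om) (m : nat) (eps delta h : R).

Definition measurable_code (T : finType) (c : Om -> T) := forall t, measurable (c @^-1` [set t]).

Lemma measurable_code_preimage (T : finType) (c : Om -> T) (A : set T) :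
  measurable_code c -> measurable (c @^-1` A).
Proof.
move=> mc; have -> : c @^-1` A = \bigcup_(t in A) (c @^-1` [set t]).
  by apply/seteqP; split=> [x /= Ax|x /= [t At ->] //]; exists (c x).
by apply: fin_bigcup_measurable => //; apply: sub_finite_set (subsetT A) _; exact: finite_finset.
Qed.

Lemma measurable_bits (S : finType) (b : S -> set Om) : (forall s, measurable (b s)) ->
  measurable_code (fun x => [ffun s => `[< b s x >]]).
Proof.
move=> mb t; have -> : (fun x => [ffun s => `[< b s x >]]) @^-1` [set t] =
    \bigcap_(s in [set: S]) (if t s then b s else ~` b s).
  apply/seteqP; split=> [x /= <- s _|x hx /=].
    by rewrite ffunE; case: asboolP.
  apply/ffunP => s; rewrite ffunE; have := hx s I; case: (t s) => h; first by apply/asboolP.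
  by apply/negbTE/asboolP.
apply: fin_bigcap_measurable => [|s _]; first exact: finite_finset.
by case: (t s); [|apply: measurableC].
Qed.

Lemma measurable_code_pair (T T' : finType) (c : Om -> T) (c' : Om -> T') :
  measurable_code c -> measurable_code c' -> measurable_code (fun x => (c x, c' x)).
Proof.
move=> mc mc' [t t'].
have -> : (fun x => (c x, c' x)) @^-1` [set (t, t')] = (c @^-1` [set t]) `&` (c' @^-1` [set t']).
  by apply/seteqP; split=> [x /= [-> ->]|x /= [-> ->]].
exact: measurableI.
Qed.

Lemma measurable_code_sum (T T' : finType) (c : Om -> T) (c' : Om -> T') E : measurable E ->
  measurable_code c -> measurable_code c' ->
  measurable_code (fun x => if `[< E x >] then inl (c x) else inr (c' x) : T + T').
Proof.
move=> mE mc mc' [t|t'].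
  have -> : (fun x => if `[< E x >] then inl (c x) else inr (c' x) : T + T') @^-1` [set inl t]
      = E `&` (c @^-1` [set t]).
    apply/seteqP; split=> [x /=|x /= [Ex <-]]; first by case: asboolP => // Ex [].
    by case: asboolP.
  exact: measurableI.
have -> : (fun x => if `[< E x >] then inl (c x) else inr (c' x) : T + T') @^-1` [set inr t']
    = ~` E `&` (c' @^-1` [set t']).
  apply/seteqP; split=> [x /=|x /= [Ex <-]]; first by case: asboolP => // Ex [].
  by case: asboolP.
by apply: measurableI => //; apply: measurableC.
Qed.

Lemma grid_code m (f : 'I_m -> Om -> R) D delta : 0 < delta ->
  (forall j, measurable_fun setT (f j)) -> (forall x j, D x -> `|f j x| <= 1) ->
  exists (T : finType) (c : Om -> T), measurable_code c /\
    forall x y, D x -> D y -> c x = c y -> forall j, `|f j x - f j y| <= delta.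
Proof.
move=> d0 mf Df; pose M := (Num.truncn (2 / delta)).+2.
pose g (i : nat) : R := -1 + i%:R * delta.
pose b (s : 'I_m * 'I_M) : set Om := [set x | g s.2 <= f s.1 x].
exists {ffun 'I_m * 'I_M -> bool}, (fun x => [ffun s => `[< b s x >]]); split.
  apply: measurable_bits => -[j i]; rewrite /b /=.
  have -> : [set x | g i <= f j x] = setT `&` (f j @^-1` `[g i, +oo[%classic).
    by rewrite setTI; apply/seteqP; split=> x /=; rewrite in_itv /= andbT.
  exact: mf.
move=> x y Dx Dy /ffunP cxy j.
wlog xy : x y Dx Dy cxy / f j x <= f j y.
  move=> H; case: (leP (f j x) (f j y)) => h; first exact: H.
  by rewrite distrC; apply: H => //; exact: ltW.
rewrite distrC ger0_norm ?subr_ge0 // leNgt; apply/negP => h.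
have /andP[x1 x2] : -1 <= f j x <= 1 by rewrite -ler_norml Df.
have x0 : 0 <= (f j x + 1) / delta by rewrite divr_ge0 ?(ltW d0) //; lra.
have /andP[t1 t2] := truncn_itv x0; set i := Num.truncn _ in t1 t2.
have iM : (i.+1 < M)%N.
  rewrite /M !ltnS; apply: le_truncn; rewrite ler_pM2r ?invr_gt0 //; lra.
have := cxy (j, Ordinal iM); rewrite !ffunE /b /= => e.
have gx : f j x < g i.+1.
  by rewrite /g; move: t2; rewrite ltr_pdivrMr //; lra.
have gy : g i.+1 <= f j y.
  by rewrite /g -natr1; move: t1; rewrite ler_pdivlMr //; lra.
move: e; case: asboolP; first by rewrite leNgt gx.
by case: asboolP.
Qed.

Definition lin m (f : 'I_m -> Om -> R) (v : 'rV[R]_m) x : R := \sum_j v ord0 j * f j x.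

Lemma measurable_lin m (f : 'I_m -> Om -> R) v : (forall j, measurable_fun setT (f j)) ->
  measurable_fun setT (lin f v).
Proof. by move=> mf; apply: measurable_sum => j; apply: measurable_funM. Qed.

Lemma lin_close m (f : 'I_m -> Om -> R) (u v : 'rV[R]_m) x eps :
  (forall j, `|f j x| <= 1) -> (forall j, `|u ord0 j - v ord0 j| <= eps) ->
  `|lin f u x - lin f v x| <= m%:R * eps.
Proof.
move=> fx uv; rewrite /lin -sumrB; apply: le_trans (ler_norm_sum _ _ _) _.
apply: (@le_trans _ _ (\sum_(j < m) eps)); last by rewrite sumr_const card_ord mulr_natl.
by apply: ler_sum => j _; rewrite -mulrBl normrM -[X in _ <= X]mulr1 ler_pM.
Qed.

Lemma measurable_slab m (f : 'I_m -> Om -> R) v D eps : measurable D ->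
  (forall j, measurable_fun setT (f j)) -> measurable (D `&` [set x | `|lin f v x| <= eps]).
Proof.
move=> mD mf; apply: measurableI => //.
have -> : [set x | `|lin f v x| <= eps] = setT `&` (lin f v @^-1` `[- eps, eps]%classic).
  by rewrite setTI; apply/seteqP; split=> x /=; rewrite in_itv /= ler_norml.
exact: measurable_lin.
Qed.

Lemma measurable_zeros m (f : 'I_m -> Om -> R) v : (forall j, measurable_fun setT (f j)) ->
  measurable [set x | lin f v x = 0].
Proof.
move=> mf; have -> : [set x | lin f v x = 0] = setT `&` (lin f v @^-1` [set 0]).
  by rewrite setTI.
exact: measurable_lin.
Qed.

Definition unit_row m : set 'rV[R]_m := [set v | `|v| = 1].

Lemma compact_unit_row m : compact (@unit_row m).
Proof.
apply: bounded_closed_compact.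
  by exists 1; split => // M M1 v /= ->; exact: ltW.
have -> : @unit_row m = (fun v : 'rV[R]_m => `|v|) @^-1` [set 1] by [].
by apply: closed_comp => [v _|]; [exact: norm_continuous|exact: closed_eq].
Qed.

Lemma row_coord_le m (v : 'rV[R]_m) j : `|v ord0 j| <= `|v|.
Proof.
rewrite [leRHS]/Num.norm /= mx_normrE; apply/bigmax_geP; right => /=.
by exists (ord0, j).
Qed.

(** Compactness: if slabs of widths 1/(n+1) all had mass above [h], their directions would cluster
    at some [v0], every slab around the hyperplane of [v0] would have mass at least [h], and so
    would the hyperplane by continuity from above. *)
Lemma slab_uniform m (f : 'I_m -> Om -> R) D h :
  measurable D -> (forall j, measurable_fun setT (f j)) -> (forall x j, D x -> `|f j x| <= 1) ->
  (forall v, v != 0 -> (mu (D `&` [set x | lin f v x = 0%R]) < h%:E)%E) ->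
  exists2 eta : R, 0 < eta &
    forall v, unit_row v -> (mu (D `&` [set x | `|lin f v x| <= eta]%R) <= h%:E)%E.
Proof.
move=> mD mf Df small; apply: contrapT => no.
have [v vP] : exists v : nat -> 'rV[R]_m, forall n, unit_row (v n) /\
    (h%:E < mu (D `&` [set x | (`|lin f (v n) x| <= n.+1%:R^-1)%R]))%E.
  suff H n : exists u : 'rV[R]_m, unit_row u /\
      (h%:E < mu (D `&` [set x | (`|lin f u x| <= n.+1%:R^-1)%R]))%E.
    by have [v vP] := choice H; exists v.
  apply: contrapT => no'; apply: no; exists (n.+1%:R^-1) => // u u1.
  by rewrite leNgt; apply/negP => hu; apply: no'; exists u.
have [v0 [v01 clv]] : (@unit_row m `&` cluster (v @ \oo)) !=set0.
  by apply: compact_unit_row; exists 0%N => // n _; have [] := vP n.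
pose F n : set Om := D `&` [set x | `|lin f v0 x| <= n.+1%:R^-1].
have mF n : measurable (F n) by apply: measurable_slab.
have hF n : (h%:E <= mu (F n))%E.
  have e0 : 0 < n.+1%:R^-1 / 2 / m.+1%:R :> R by rewrite !divr_gt0.
  set e := n.+1%:R^-1 / 2 / m.+1%:R in e0.
  have [N hN] : exists N : nat, N.+1%:R^-1 <= n.+1%:R^-1 / 2 :> R.
    exists (2 * n.+1)%N; rewrite -invfM lef_pV2 ?posrE // mulrC -natrM ler_nat; lia.
  have nbN : (v @ \oo) [set u | exists2 j, (N <= j)%N & u = v j].
    by exists N => // j /= Nj; exists j.
  have [u [[j Nj ->] uB]] := clv _ _ nbN (nbhsx_ballx v0 e e0).
  apply: le_trans (ltW (vP j).2) _; apply: le_measure; rewrite ?inE //; first exact: measurable_slab.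
  move=> x [Dx /= hx]; split=> //=.
  have hj : j.+1%:R^-1 <= n.+1%:R^-1 / 2 :> R.
    by apply: le_trans hN; rewrite lef_pV2 ?posrE // ler_nat.
  have hc : `|lin f v0 x - lin f (v j) x| <= m%:R * e.
    apply: lin_close => [i|i]; first exact: Df.
    have := row_coord_le (v0 - v j) i; rewrite !mxE => /le_trans; apply.
    by move: uB; rewrite -ball_normE /= => /ltW.
  have hm : m%:R * e <= n.+1%:R^-1 / 2.
    by rewrite /e mulrCA ler_piMr ?divr_ge0 // ler_pdivrMr // mul1r ler_nat.
  rewrite -(subrK (lin f (v j) x) (lin f v0 x)); apply: le_trans (ler_normD _ _) _.
  by apply: le_trans (lerD (le_trans hc hm) (le_trans hx hj)) _; rewrite -splitr.
have cF := @nonincreasing_cvg_mu _ _ _ mu F.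
have capF : \bigcap_n F n = D `&` [set x | lin f v0 x = 0].
  apply/seteqP; split=> [x hx|x [Dx /= lx] n _]; last by split=> //=; rewrite lx normr0.
  split; first by have [] := hx 0%N I.
  apply/eqP; rewrite -normr_le0 leNgt; apply/negP => /= l0.
  have [_ /=] := hx (Num.truncn (`|lin f v0 x|^-1)) I; apply/negP; rewrite -ltNge.
  by rewrite invf_plt ?posrE // truncnS_gt.
have mcap : measurable (\bigcap_n F n).
  by rewrite capF; apply: measurableI => //; exact: measurable_zeros.
have v00 : v0 != 0.
  by apply/eqP => v0E; move: v01; rewrite /unit_row /= v0E normr0 => /esym/eqP; rewrite oner_eq0.
have F0fin : (mu (F 0%N) < +oo)%E by rewrite -ge0_fin_numE ?fin_num_measure.
have Fdec : {homo F : a b / (a <= b)%N >-> (b <= a)%O}.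
  move=> a b ab; apply/subsetPset => x [Dx /= hx]; split => //=.
  by apply: le_trans hx _; rewrite lef_pV2 ?posrE // ler_nat.
have cvgF := cF F0fin mF mcap Fdec.
have lim : (h%:E <= mu (\bigcap_n F n))%E.
  rewrite -(cvg_lim _ cvgF) //; apply: lime_ge; first exact: cvgP cvgF.
  by apply: nearW => n; exact: hF.
by have := small _ v00; rewrite -capF ltNge lim.
Qed.

(** Only the exceptional set depends on [v]. The code serves all half-spaces at once, since one
    discrete measure must work for every x. *)
Definition sign_code m (f : 'I_m -> Om -> R) D eps (T : finType) (c : Om -> T) :=
  measurable_code c /\ forall v, exists B, [/\ measurable B, (mu B <= eps%:E)%E &
    forall x y, D x -> D y -> ~ B x -> c x = c y -> (0 <= lin f v x) = (0 <= lin f v y)].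

Lemma lin_scale m (f : 'I_m -> Om -> R) v (a : R) x : lin f (a *: v) x = a * lin f v x.
Proof. by rewrite /lin mulr_sumr; apply: eq_bigr => j _; rewrite mxE mulrA. Qed.

(** Outside a slab of half-width [eta], which is uniformly light, a form moves by at most [eta]/2
    within a grid cell and so keeps its sign. *)
Lemma sign_code_light m (f : 'I_m -> Om -> R) D h : 0 < h ->
  measurable D -> (forall j, measurable_fun setT (f j)) -> (forall x j, D x -> `|f j x| <= 1) ->
  (forall v, v != 0 -> (mu (D `&` [set x | lin f v x = 0%R]) < h%:E)%E) ->
  exists (T : finType) (c : Om -> T), sign_code f D h c.
Proof.
move=> h0 mD mf Df small; have [eta eta0 slab] := slab_uniform mD mf Df small.
have d0 : 0 < eta / 2 / m.+1%:R by rewrite !divr_gt0.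
have [T [c [mc cc]]] := grid_code d0 mf Df.
exists T, c; split=> // v; have [->|v0] := eqVneq v 0.
  exists set0; split; rewrite ?measure0 ?lee_fin ?(ltW h0) // => x y _ _ _ _.
  by rewrite /lin !big1 // => j _; rewrite mxE mul0r.
pose u := `|v|^-1 *: v.
have nv0 : 0 < `|v| by rewrite normr_gt0.
have u1 : unit_row u.
  by rewrite /unit_row /= normrZ normfV normr_id mulVf ?gt_eqF.
exists (D `&` [set x | `|lin f u x| <= eta]); split; first exact: measurable_slab.
  exact: slab.
move=> x y Dx Dy nB cxy.
have signE z : (0 <= lin f v z) = (0 <= lin f u z).
  by rewrite /u lin_scale pmulr_rge0 // invr_gt0.
rewrite !signE.
have hx : eta < `|lin f u x| by rewrite ltNge; apply/negP => h'; apply: nB.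
have hxy : `|lin f u x - lin f u y| <= eta / 2.
  rewrite /lin -sumrB; apply: le_trans (ler_norm_sum _ _ _) _.
  apply: (@le_trans _ _ (\sum_(j < m) eta / 2 / m.+1%:R)).
    apply: ler_sum => j _; rewrite -mulrBr normrM -[X in _ <= X]mul1r ler_pM //.
      by rewrite -u1 row_coord_le.
    exact: cc.
  rewrite sumr_const card_ord -[_ *+ m]mulr_natl mulrCA ler_piMr ?divr_ge0 ?(ltW eta0) //.
  by rewrite ler_pdivrMr // mul1r ler_nat.
move: hx hxy; rewrite ler_norml; case: (leP 0 (lin f u x)) => h1 h2 /andP[h3 h4].
  by apply/esym; rewrite ger0_norm // in h2; lra.
by apply/esym/negbTE; rewrite -ltNge; rewrite ltr0_norm // in h2; lra.
Qed.

Lemma sign_code_split m (f : 'I_m -> Om -> R) D E eps eps' (T T' : finType) (c : Om -> T) (c' : Om -> T') :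
  measurable E -> sign_code f (D `&` E) eps c -> sign_code f (D `\` E) eps' c' ->
  exists (T : finType) (c : Om -> T), sign_code f D (eps + eps') c.
Proof.
move=> mE [mc hc] [mc' hc'].
exists (T + T')%type, (fun x => if `[< E x >] then inl (c x) else inr (c' x)); split.
  exact: measurable_code_sum.
move=> v; have [B [mB Be hB]] := hc v; have [B' [mB' Be' hB']] := hc' v.
exists (B `|` B'); split; first exact: measurableU.
  by apply: (@le_trans _ _ (mu B + mu B')%E); [exact: measureU2|rewrite EFinD leeD].
move=> x y Dx Dy nB; case: asboolP => Ex; case: asboolP => Ey // [cxy].
  by apply: hB => // Bx; apply: nB; left.
by apply: hB' => // Bx; apply: nB; right.
Qed.

(* If some hyperplane v.f = 0 is heavy, one coordinate of f can be eliminated on it;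
   only boundedly many heavy pieces can be split off. *)
Lemma exists_sign_code m : forall (f : 'I_m -> Om -> R) D eps, 0 < eps ->
  measurable D -> (forall j, measurable_fun setT (f j)) -> (forall x j, D x -> `|f j x| <= 1) ->
  exists (T : finType) (c : Om -> T), sign_code f D eps c.
Proof.
elim: m => [|m IHm] f D eps eps0 mD mf Df.
  exists unit, (fun _ => tt); split.
    by case; rewrite (_ : _ @^-1` _ = setT) //; apply/seteqP; split.
  move=> v; exists set0; split; rewrite ?measure0 ?lee_fin ?(ltW eps0) // => x y _ _ _ _.
  by rewrite /lin !big_ord0.
(* Each heavy piece has mass at least [h], so K >= 1/h of them exhaust the measure. A piece may lose
   e = h/K and the final light part [h], in total [eps]. *)
pose h := eps / 2; have h0 : 0 < h by rewrite divr_gt0.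
pose K := (Num.truncn h^-1).+1.
have K0 : 0 < K%:R :> R by rewrite ltr0n.
have hK : 1 <= K%:R * h.
  rewrite -ler_pdivrMr // mul1r ltW // /K truncnS_gt //.
pose e := h / K%:R; have e0 : 0 < e by rewrite divr_gt0.
suff : forall n D, measurable D -> (forall x j, D x -> `|f j x| <= 1) ->
    (mu D <= (n%:R * h)%:E)%E -> exists (T : finType) (c : Om -> T), sign_code f D (n%:R * e + h) c.
  move=> /(_ K D mD Df) []; first by apply: le_trans (probability_le1 _ _) _; rewrite ?lee_fin.
  move=> T [c hc]; exists T, c.
  have -> : eps = K%:R * e + h by rewrite /e mulrC divfK ?gt_eqF // /h -splitr.
  exact: hc.
move=> {D mD Df}; elim=> [|n IHn] D mD Df muD.
  exists unit, (fun _ => tt); split.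
    by case; rewrite (_ : _ @^-1` _ = setT) //; apply/seteqP; split.
  move=> v; exists D; split => //.
  by apply: le_trans muD _; rewrite !mul0r add0r lee_fin ltW.
have [light|heavy] := pselect (forall v, v != 0 -> (mu (D `&` [set x | lin f v x = 0%R]) < h%:E)%E).
  have [T [c [mc hc]]] := sign_code_light h0 mD mf Df light.
  exists T, c; split=> // v; have [B [mB Be hB]] := hc v; exists B; split => //.
  by apply: le_trans Be _; rewrite lee_fin lerDr mulr_ge0 // ltW.
have [v v0 hv] : exists2 v, v != 0 & (h%:E <= mu (D `&` [set x | lin f v x = 0%R]))%E.
  apply: contrapT => no; apply: heavy => v v0; rewrite ltNge; apply/negP => hv.
  by apply: no; exists v.
pose E : set Om := [set x | lin f v x = 0].
have mE : measurable E by apply: measurable_zeros.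
have [j0 vj0] : exists j, v ord0 j != 0.
  apply: contrapT => no; move/eqP: v0; apply; apply/rowP => j; rewrite mxE.
  by apply: contrapT => /eqP h'; apply: no; exists j.
have mDE : measurable (D `&` E) by apply: measurableI.
have [T [c [mc hc]]] : exists (T : finType) (c : Om -> T), sign_code (fun j => f (lift j0 j)) (D `&` E) e c.
  by apply: IHm => // x j [Dx _]; apply: Df.
have code1 : sign_code f (D `&` E) e c.
  (* On [E] the relation v.f = 0 expresses [f j0] by the other coordinates; [u'] is the form [u]
     after this substitution. *)
  split=> // u; pose u' : 'rV[R]_m := \row_j (u ord0 (lift j0 j) - u ord0 j0 / v ord0 j0 * v ord0 (lift j0 j)).
  have [B [mB Be hB]] := hc u'; exists B; split => // x y [Dx Ex] [Dy Ey] nB cxy.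
  have linE z : E z -> lin f u z = lin (fun j => f (lift j0 j)) u' z.
    rewrite /E /= /lin (bigD1_ord j0) //= => ez; rewrite [LHS](bigD1_ord j0) //=.
    have -> : f j0 z = - (\sum_(j < m) v ord0 (lift j0 j) * f (lift j0 j) z) / v ord0 j0.
      by rewrite -[X in - X](addKr (v ord0 j0 * f j0 z)) ez addr0 opprK mulrC mulKf.
    rewrite mulNr mulrN mulr_suml mulr_sumr -sumrN -big_split /=; apply: eq_bigr => j _.
    by rewrite mxE; ring.
  by rewrite !linE //; apply: hB.
have [T' [c' code2]] : exists (T : finType) (c : Om -> T), sign_code f (D `\` E) (n%:R * e + h) c.
  apply: IHn; first exact: measurableD.
    by move=> x j [Dx _]; apply: Df.
  rewrite measureD //; last by rewrite -ge0_fin_numE ?fin_num_measure.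
  rewrite lee_subel_addr ?fin_num_measure //.
  apply: le_trans muD _; apply: le_trans (leeD2l _ hv).
  by rewrite -EFinD lee_fin -natr1 mulrDl mul1r.
have -> : n.+1%:R * e + h = e + (n%:R * e + h) by rewrite -natr1; ring.
exact: sign_code_split mE code1 code2.
Qed.
End Cells.

Section Measurability.
Variables (R : realType) (d : nat).
Notation Om := (param R d).
Implicit Types (z : 'rV[R]_d) (w : seq 'I_d).

Lemma continuous_measurable_param (f : ('rV[R]_d * R)%type -> R) : continuous f ->
  measurable_fun setT (f : Om -> R).
Proof.
move=> cf; apply: (measurability _ (RGenOInfty.measurableE R)) => _ [_ [x ->] <-].
rewrite setTI; apply: sub_sigma_algebra.
by move/continuousP : cf; apply; exact: interval_open.
Qed.

Lemma measurable_weight (i : 'I_d) : measurable_fun setT (fun P : Om => P.1 ord0 i).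
Proof.
apply: continuous_measurable_param => P.
apply: (@continuous_comp _ _ _ fst (fun v : 'rV[R]_d => v ord0 i)); first exact: cvg_fst.
exact: coord_continuous.
Qed.

Lemma measurable_bias : measurable_fun setT (fun P : Om => P.2).
Proof. by apply: continuous_measurable_param => P; exact: cvg_snd. Qed.

Lemma measurable_aff z : measurable_fun setT (fun P : Om => aff P z).
Proof.
apply: measurable_funD; last exact: measurable_bias.
apply: measurable_sum => i; apply: measurable_funM => //; exact: measurable_weight.
Qed.

Definition atom k w z (P : Om) : R := (0 <= aff P z)%R%:R * wpow w P.1 * aff P z ^+ (k - size w).

Lemma measurable_atom k w z : measurable_fun setT (atom k w z).
Proof.
apply: measurable_funM; last by apply: measurable_funX; exact: measurable_aff.
apply: measurable_funM; last by apply: measurable_prod => i _; exact: measurable_weight.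
have -> : (fun P : Om => (0 <= aff P z)%R%:R : R) = (fun P => if 0 <= aff P z then 1 else 0).
  by apply/funext => P; case: (0 <= _).
apply: measurable_fun_ifT => //; apply: measurable_fun_ler => //; exact: measurable_aff.
Qed.

Lemma measurable_dict_set : measurable (@dict_set R d).
Proof.
have -> : @dict_set R d = (setT `&` (fun P : Om => dotv P.1 P.1) @^-1` [set 1]) `&`
   (setT `&` (fun P : Om => P.2) @^-1` `[-1, 1]%classic).
  by rewrite !setTI; apply/seteqP; split=> P /=; rewrite in_itv.
apply: measurableI; last by apply: measurable_bias.
have h : measurable_fun setT (fun P : Om => dotv P.1 P.1).
  by apply: measurable_sum => i; apply: measurable_funM; exact: measurable_weight.
exact: h.
Qed.

Lemma dict_set_nonempty : (0 < d)%N -> exists P : Om, dict_set P.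
Proof.
case: d => // d' _; exists (delta_mx ord0 ord0, 0); split => /=; last by rewrite lerN10 ler01.
rewrite /sphere_d /= /dotv (bigD1 ord0) //= big1 ?addr0; first by rewrite mxE !eqxx mul1r.
by move=> i i0; rewrite mxE (negbTE i0) andbF mul0r.
Qed.

Lemma wpow_close w (u v : 'rV[R]_d) delta : (forall i, `|u ord0 i| <= 1) -> (forall i, `|v ord0 i| <= 1) ->
  (forall i, `|u ord0 i - v ord0 i| <= delta) -> `|wpow w u - wpow w v| <= (size w)%:R * delta.
Proof.
move=> u1 v1 uv; rewrite /wpow; elim: w => [|i w IHw]; first by rewrite !big_nil subrr normr0 mul0r.
have w1 : `|wpow w v| <= 1 by rewrite -(expr1n R (size w)) wpow_le.
rewrite !big_cons /= -natr1 mulrDl mul1r.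
have -> : u ord0 i * \prod_(j <- w) u ord0 j - v ord0 i * \prod_(j <- w) v ord0 j =
  u ord0 i * (\prod_(j <- w) u ord0 j - \prod_(j <- w) v ord0 j) + (u ord0 i - v ord0 i) * wpow w v.
  by rewrite /wpow; ring.
apply: le_trans (ler_normD _ _) _; apply: lerD; rewrite normrM.
  by apply: le_trans IHw; rewrite ler_piMl.
by apply: le_trans (uv i); rewrite ler_piMr.
Qed.

Lemma pow_close (s t X : R) m : 1 <= X -> `|s| <= X -> `|t| <= X ->
  `|s ^+ m - t ^+ m| <= m%:R * X ^+ m * `|s - t|.
Proof.
move=> X1 sX tX; have X0 : 0 <= X by lra.
elim: m => [|m IHm]; first by rewrite !expr0 subrr normr0 !mul0r.
have -> : s ^+ m.+1 - t ^+ m.+1 = s * (s ^+ m - t ^+ m) + (s - t) * t ^+ m by rewrite !exprS; ring.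
apply: le_trans (ler_normD _ _) _; rewrite !normrM normrX.
have h1 : `|s| * `|s ^+ m - t ^+ m| <= X * (m%:R * X ^+ m * `|s - t|) by apply: ler_pM.
have h2 : `|s - t| * `|t| ^+ m <= `|s - t| * X ^+ m.+1.
  rewrite ler_wpM2l // exprS; apply: (@le_trans _ _ (X ^+ m)).
    by rewrite lerXn2r.
  by rewrite ler_peMl ?exprn_ge0.
apply: le_trans (lerD h1 h2) _; rewrite -natr1 exprS le_eqVlt; apply/orP; left; apply/eqP; ring.
Qed.

Lemma atom_close k w z (P Q : Om) delta : 0 <= delta -> (size w <= k)%N -> ball_d z ->
  dict_set P -> dict_set Q ->
  (forall i, `|P.1 ord0 i - Q.1 ord0 i| <= delta) -> `|P.2 - Q.2| <= delta ->
  (0 <= aff P z) = (0 <= aff Q z) ->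
  `|atom k w z P - atom k w z Q| <= 2 * k%:R * (d%:R + 1) ^+ k.+1 * delta.
Proof.
move=> de0 wk Bz hP hQ h1 h2 e.
have X1 : 1 <= d%:R + 1 :> R by rewrite lerDr.
set X := d%:R + 1 in X1 *; have X0 : 0 <= X by lra.
rewrite /atom -e; set m := (k - size w)%N.
have bound : 0 <= 2 * k%:R * X ^+ k.+1 * delta by rewrite !mulr_ge0 ?exprn_ge0.
case: (0 <= aff P z); last by rewrite !mul0r subrr normr0.
rewrite !mul1r.
have -> : wpow w P.1 * aff P z ^+ m - wpow w Q.1 * aff Q z ^+ m =
  (wpow w P.1 - wpow w Q.1) * aff P z ^+ m + wpow w Q.1 * (aff P z ^+ m - aff Q z ^+ m) by ring.
have aP : `|aff P z| <= X := aff_le hP Bz.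
have aQ : `|aff Q z| <= X := aff_le hQ Bz.
have aPQ : `|aff P z - aff Q z| <= X * delta.
  have -> : aff P z - aff Q z = dotv z (P.1 - Q.1) + (P.2 - Q.2).
    rewrite /aff /dotv opprD addrACA; congr (_ + _); rewrite -sumrB.
    by apply: eq_bigr => i _; rewrite !mxE; ring.
  rewrite /X mulrDl mul1r; apply: le_trans (ler_normD _ _) (lerD _ h2).
  by apply: dotv_le => [|i]; [exact: ball_coord|rewrite !mxE].
have wP := wpow_close w (dict_coord hP) (dict_coord hQ) h1.
have wQ : `|wpow w Q.1| <= 1 by rewrite -(expr1n R (size w)) wpow_le // => c; apply: dict_coord.
have mk : (m <= k)%N by apply: leq_subr.
have Xm : X ^+ m <= X ^+ k.+1 by rewrite ler_weXn2l // leqW.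
have Xm' : X ^+ m * X <= X ^+ k.+1 by rewrite -exprSr ler_weXn2l // ltnS.
apply: le_trans (ler_normD _ _) _; rewrite !normrM normrX.
have s1 : `|wpow w P.1 - wpow w Q.1| * `|aff P z| ^+ m <= k%:R * delta * X ^+ k.+1.
  apply: ler_pM => //.
    by apply: le_trans wP _; rewrite ler_wpM2r // ler_nat.
  by apply: le_trans Xm; rewrite lerXn2r.
have s2 : `|wpow w Q.1| * `|aff P z ^+ m - aff Q z ^+ m| <= k%:R * X ^+ k.+1 * delta.
  apply: (@le_trans _ _ (`|aff P z ^+ m - aff Q z ^+ m|)); first by rewrite ler_piMl.
  apply: le_trans (pow_close m X1 aP aQ) _.
  apply: (@le_trans _ _ (m%:R * X ^+ m * (X * delta))).
    by rewrite ler_wpM2l // mulr_ge0 ?exprn_ge0.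
  rewrite [X in X <= _](_ : _ = m%:R * (X ^+ m * X) * delta); last by ring.
  rewrite ler_wpM2r //; apply: ler_pM => //; first by rewrite mulr_ge0 ?exprn_ge0.
  by rewrite ler_nat.
apply: le_trans (lerD s1 s2) _; rewrite le_eqVlt; apply/orP; left; apply/eqP; ring.
Qed.
End Measurability.

Section FiniteIntegrals.
Context {disp : measure_display} {Om : measurableType disp} {R : realType}.
Variable mu : probability Om R.

Lemma bounded_integrable (F : Om -> R) (X : R) : measurable_fun setT F -> (forall x, `|F x| <= X) ->
  mu.-integrable setT (EFin \o F).
Proof.
move=> mF FX; apply: measurable_bounded_integrable => //.
  by rewrite -ge0_fin_numE ?fin_num_measure.
exists X; split; first exact: num_real.
by move=> M XM x _ /=; exact: le_trans (FX x) (ltW XM).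
Qed.

Lemma Rintegral_indicator (A : set Om) : measurable A -> Rintegral mu setT (\1_A) = fine (mu A).
Proof. by move=> mA; rewrite /Rintegral integral_indic // setIT. Qed.

Lemma indic_le1 (A : set Om) x : `|\1_A x : R| <= 1.
Proof. by rewrite indicE; case: (x \in A); rewrite ?normr1 ?normr0. Qed.

Lemma Rintegral_indicator_sum (I : finType) (h : I -> R) (A : I -> set Om) (s : seq I) :
  (forall i, measurable (A i)) ->
  Rintegral mu setT (fun x => \sum_(i <- s) h i * \1_(A i) x) = \sum_(i <- s) h i * fine (mu (A i)).
Proof.
move=> mA.
have mI i : measurable_fun setT (\1_(A i) : Om -> R) by apply/measurable_indicP.
have iI i : mu.-integrable setT (EFin \o (\1_(A i) : Om -> R)).
  by apply: (@bounded_integrable _ 1) => // x; exact: indic_le1.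
elim: s => [|i s IHs].
  rewrite big_nil; under eq_Rintegral do rewrite big_nil.
  by rewrite Rintegral_cst // mul0r.
rewrite big_cons -IHs -Rintegral_indicator // -RintegralZl //.
under eq_Rintegral do rewrite big_cons.
rewrite RintegralD //.
  apply: (@bounded_integrable _ `|h i|); first exact: measurable_funM.
  by move=> x; rewrite normrM ler_piMr // indic_le1.
apply: (@bounded_integrable _ (\sum_(j <- s) `|h j|)).
  by apply: measurable_sum => j; apply: measurable_funM.
move=> x; apply: le_trans (ler_norm_sum _ _ _) _; apply: ler_sum => j _.
  by rewrite normrM ler_piMr // indic_le1.
exact: iI.
Qed.

Lemma Rintegral_code (T : finType) (c : Om -> T) (h : T -> R) : measurable_code c ->
  Rintegral mu setT (fun x => h (c x)) = \sum_t fine (mu (c @^-1` [set t])) * h t.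
Proof.
move=> mc; under [RHS]eq_bigr do rewrite mulrC.
rewrite -Rintegral_indicator_sum //; apply: eq_Rintegral => x _.
rewrite (bigD1 (c x)) //= indicE mem_set // mulr1 big1 ?addr0 // => t tc.
by rewrite indicE memNset ?mulr0 // => /esym/eqP; rewrite (negbTE tc).
Qed.
End FiniteIntegrals.

Lemma discretise (R : realType) (d k : nat) (tau : probability (param R d) R) (eps : R) :
  (0 < d)%N -> tau (~` @dict_set R d) = 0%E -> 0 < eps ->
  exists (I : finType) (p : I -> param R d) (a : I -> R),
  [/\ forall i, dict_set (p i), is_distr a &
    forall (w : seq 'I_d) z (s : R), (size w <= k)%N -> ball_d z ->
      `|Rintegral tau setT (fun P => s * atom k w z P) - s * fint k p a w z| <= `|s| * eps].
Proof.
move=> d0 tau0 eps0; pose X : R := (d%:R + 1) ^+ k; pose Lp : R := 2 * k%:R * (d%:R + 1) ^+ k.+1.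
have X1 : 1 <= X by rewrite exprn_ege1 // lerDr.
have X0 : 0 < X by lra.
have Lp0 : 0 <= Lp by rewrite !mulr_ge0 ?exprn_ge0.
(* Half of [eps] is for the variation of an atom within a cell. The other half is for the
   exceptional set, where the difference is at most 2 X, hence the mass eps/(4 X). *)
pose delta := eps / 2 / (Lp + 1); have delta0 : 0 < delta by rewrite !divr_gt0 //; lra.
pose e1 := eps / (4 * X); have e10 : 0 < e1 by rewrite divr_gt0 // mulr_gt0.
(* Bias first, then weights: [aff P z] becomes the linear form with coefficients (1, z), so sign
   codes apply without a constant term. *)
pose f (j : 'I_d.+1) (P : param R d) : R := if unlift ord0 j is Some i then P.1 ord0 i else P.2.
have mf j : measurable_fun setT (f j).
  by rewrite /f; case: (unlift ord0 j) => [i|]; [exact: measurable_weight|exact: measurable_bias].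
have mdict := @measurable_dict_set R d.
have fB P j : dict_set P -> `|f j P| <= 1.
  move=> hP; rewrite /f; case: (unlift ord0 j) => [i|]; first exact: dict_coord.
  by have [_] := hP; rewrite ler_norml.
have [T1 [c1 [mc1 hc1]]] := exists_sign_code tau e10 mdict mf fB.
have [T2 [c2 [mc2 hc2]]] := grid_code delta0 mf fB.
pose c P := (c1 P, c2 P); have mc : measurable_code c by apply: measurable_code_pair.
have [P0 hP0] := dict_set_nonempty R d0.
(* Each cell is represented by one of its points in the dictionary; a cell without such points gets
   the default [P0]. *)
have [p pP] : exists p : T1 * T2 -> param R d, forall t, dict_set (p t) /\
    (forall P, dict_set P -> c P = t -> c (p t) = t).
  suff H t : exists Q, dict_set Q /\ (forall P, dict_set P -> c P = t -> c Q = t).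
    by have [p pP] := choice H; exists p.
  have [[Q [hQ cQ]]|no] := pselect (exists Q, dict_set Q /\ c Q = t); first by exists Q.
  by exists P0; split => // P hP cP; case: no; exists P.
have hp t : dict_set (p t) by have [] := pP t.
pose a t := fine (tau (c @^-1` [set t])).
exists (T1 * T2)%type, p, a; split => //.
  split=> [t|]; first by rewrite fine_ge0.
  have := @Rintegral_code _ _ _ tau _ c (fun _ => 1) mc.
  rewrite Rintegral_cst // mul1r; have -> : fine (tau setT) = 1 by rewrite probability_setT.
  by move=> ->; under [RHS]eq_bigr do rewrite mulr1.
move=> w z s wk Bz.
pose S P := s * atom k w z (p (c P)).
have SE : s * fint k p a w z = Rintegral tau setT S.
  rewrite (Rintegral_code tau (fun t => s * atom k w z (p t)) mc) mulr_sumr.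
  by apply: eq_bigr => t _; rewrite /atom /side /a; ring.
have aX P : dict_set P -> `|atom k w z P| <= X.
  by move=> hP; apply: (@atom_le R d k unit (fun _ => P) (fun _ => hP) w z tt wk Bz).
pose Fd P := s * atom k w z P * \1_(@dict_set R d) P.
have mat := measurable_atom k w z.
have mF : measurable_fun setT (fun P => s * atom k w z P) by apply: measurable_funM.
have mFd : measurable_fun setT Fd.
  by apply: measurable_funM => //; apply/measurable_indicP.
have FE : Rintegral tau setT (fun P => s * atom k w z P) = Rintegral tau setT Fd.
  rewrite /Rintegral; congr fine; apply: ae_eq_integral => //; first exact/measurable_EFinP.
    exact/measurable_EFinP.
  exists (~` @dict_set R d); split => //; first exact: measurableC.
  move=> P /= h hP; apply: h => _; rewrite /Fd indicE mem_set // mulr1 //.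
have FdX P : `|Fd P| <= `|s| * X.
  rewrite /Fd indicE; have [hP|hP] := pselect (dict_set P).
    by rewrite mem_set // mulr1 normrM ler_wpM2l // aX.
  by rewrite memNset // mulr0 normr0 mulr_ge0 // ltW.
have SX P : `|S P| <= `|s| * X by rewrite /S normrM ler_wpM2l // aX.
have mS : measurable_fun setT S.
  move=> _ Y _; rewrite setTI.
  exact: (measurable_code_preimage ((fun t => s * atom k w z (p t)) @^-1` Y) mc).
have iF := bounded_integrable tau mFd FdX.
have iS := bounded_integrable tau mS SX.
rewrite FE SE -RintegralB //.
pose v : 'rV[R]_d.+1 := \row_j (if unlift ord0 j is Some i then z ord0 i else 1).
have linE P : lin f v P = aff P z.
  rewrite /lin big_ord_recl /v /f !mxE unlift_none mul1r addrC /aff /dotv; congr (_ + _).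
  by apply: eq_bigr => i _; rewrite !mxE liftK mulrC.
have [B [mB Be hB]] := hc1 v.
pose B' := B `|` ~` @dict_set R d.
have mB' : measurable B' by apply: measurableU => //; apply: measurableC.
have B'e : fine (tau B') <= e1.
  rewrite -lee_fin fineK ?fin_num_measure //.
  apply: (@le_trans _ _ (tau B + tau (~` @dict_set R d))%E).
    by apply: measureU2 => //; apply: measurableC.
  by rewrite tau0 adde0.
pose G P := `|s| * (eps / 2) + `|s| * (2 * X) * \1_B' P.
have mB1 : measurable_fun setT (\1_B' : param R d -> R) by apply/measurable_indicP.
have s0 := normr_ge0 s.
have FG P : `|Fd P - S P| <= G P.
  have crude : `|Fd P - S P| <= `|s| * (2 * X).
    by apply: le_trans (ler_normB _ _) _; have := FdX P; have := SX P; lra.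
  have g0 : 0 <= `|s| * (eps / 2) by rewrite mulr_ge0 // divr_ge0 // ltW.
  rewrite /G indicE; have [hB'|nB'] := pselect (B' P).
    by rewrite mem_set // mulr1 (le_trans crude) // lerDr.
  rewrite memNset // mulr0 addr0.
  have hP : dict_set P by apply: contrapT => h; apply: nB'; right.
  have nB : ~ B P by move=> h; apply: nB'; left.
  rewrite /Fd indicE mem_set // mulr1 /S -mulrBr normrM ler_wpM2l //.
  set Q := p (c P).
  have hQ : dict_set Q := hp _.
  have [_ /(_ P hP erefl)] := pP (c P); rewrite -/Q => -[e1' e2'].
  have cf j : `|f j P - f j Q| <= delta by apply: hc2.
  apply: (@le_trans _ _ (Lp * delta)).
    apply: atom_close => //; first exact: ltW.
    - by move=> i; have := cf (lift ord0 i); rewrite /f liftK.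
    - by have := cf ord0; rewrite /f unlift_none.
    - by rewrite -!linE; apply: hB.
  rewrite /delta mulrCA ler_piMr ?divr_ge0 ?(ltW eps0) // ler_pdivrMr; lra.
apply: le_trans (le_normr_Rintegral _ _) _ => //.
  by apply: (bounded_integrable tau (X := `|s| * X + `|s| * X)); [exact: measurable_funB|
    move=> P; apply: le_trans (ler_normB _ _) (lerD (FdX P) (SX P))].
have mG2 : measurable_fun setT (fun P : param R d => `|s| * (2 * X) * \1_B' P) by apply: measurable_funM.
have G2X P : `| (`|s| * (2 * X) * \1_B' P) | <= `|s| * (2 * X).
  by rewrite normrM ger0_norm ?mulr_ge0 ?(ltW X0) // ler_piMr ?mulr_ge0 ?(ltW X0) // indic_le1.
have iG2 := bounded_integrable tau mG2 G2X.
have iG1 : tau.-integrable setT (EFin \o (fun _ : param R d => `|s| * (eps / 2))).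
  by apply: (bounded_integrable tau (X := `|s| * (eps / 2))) => // P; rewrite ger0_norm // mulr_ge0 // divr_ge0 // ltW.
apply: (@le_trans _ _ (Rintegral tau setT G)).
  apply: le_Rintegral => //.
    apply: (bounded_integrable tau (X := `|s| * X + `|s| * X)).
      by apply: measurableT_comp => //; exact: measurable_funB.
    by move=> P; rewrite normr_id; apply: le_trans (ler_normB _ _) (lerD (FdX P) (SX P)).
  apply: (bounded_integrable tau (X := `|s| * (eps / 2) + `|s| * (2 * X))).
    exact: measurable_funD.
  move=> P; apply: le_trans (ler_normD _ _) _; apply: lerD (G2X P).
  by rewrite ger0_norm // mulr_ge0 // divr_ge0 // ltW.
  by move=> P _; exact: FG.
rewrite (RintegralD measurableT iG1 iG2 : Rintegral tau setT G = _) Rintegral_cst //.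
have -> : fine (tau setT) = 1 by rewrite probability_setT.
rewrite mulr1 RintegralZl //; last first.
  by apply: (bounded_integrable tau (X := 1)) => // P; exact: indic_le1.
rewrite Rintegral_indicator //.
have : `|s| * (2 * X) * fine (tau B') <= `|s| * (eps / 2).
  rewrite -mulrA ler_wpM2l //; apply: (@le_trans _ _ (2 * X * e1)).
    by rewrite ler_wpM2l // mulr_ge0 // ltW.
  by rewrite /e1 le_eqVlt; apply/orP; left; apply/eqP; field; rewrite gt_eqF.
lra.
Qed.

(** * Finitely supported probability measures and the conclusion *)

Lemma finite_probability (disp : measure_display) (Om : measurableType disp) (R : realType)
    (N : nat) (q : nat -> Om) (b : nat -> R) :
  (forall i, 0 <= b i) -> \sum_(i < N) b i = 1 ->
  exists P : probability Om R,
    (forall A : set Om, (forall i, (i < N)%N -> A (q i)) -> P (~` A) = 0%E) /\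
    (forall f : Om -> R, measurable_fun setT f ->
      Rintegral P setT f = \sum_(i < N) b i * f (q i)).
Proof.
move=> b0 b1.
pose m_ i : {measure set Om -> \bar R} := mscale (NngNum (b0 i)) (dirac (q i)).
pose mu : {measure set Om -> \bar R} := msum m_ N.
have muE A : mu A = (\sum_(i < N) (b i)%:E * dirac (q i) A)%E by [].
have mu1 : mu setT = 1%E.
  rewrite muE (eq_bigr (fun i : 'I_N => (b i)%:E)); last by move=> i _; rewrite diracT mule1.
  by rewrite sumEFin b1.
(* The mass is already 1, so normalising only supplies the probability structure; its default, a
   Dirac mass, is never reached. *)
pose P : probability Om R := mnormalize mu (dirac (q 0%N)).
have PE A : P A = mu A.
  rewrite /P /= /mnormalize mu1 /=.
  have -> : ((1%E : \bar R) == 0%E) = false by rewrite onee_eq0.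
  by rewrite /= invr1 mule1.
exists P; split=> [A hA|f mf].
  rewrite PE muE big1 // => i _.
  rewrite diracE memNset ?mule0 // => h; apply: h; exact: hA.
have ge0 (g : Om -> \bar R) : measurable_fun setT g -> (forall x, (0 <= g x)%E) ->
    (\int[P]_x g x = \sum_(i < N) (b i)%:E * g (q i))%E.
  move=> mg g0; rewrite (eq_measure_integral mu); last by move=> A _ _; exact: PE.
  rewrite ge0_integral_measure_sum //; apply: eq_bigr => i _.
  rewrite ge0_integral_mscale // integral_dirac // diracT mul1e //.
have mf' : measurable_fun setT (EFin \o f) by apply/measurable_EFinP.
rewrite /Rintegral integralE ge0 ?ge0 //; last 2 first.
- exact: measurable_funeneg.
- exact: measurable_funepos.
have fp g : (\sum_(i < N) (b i)%:E * (g (q i))%:E = (\sum_(i < N) b i * g (q i))%:E)%E.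
  by rewrite -sumEFin; apply: eq_bigr => i _; rewrite EFinM.
rewrite (eq_bigr (fun i : 'I_N => (b i)%:E * (Num.max (f (q i)) 0)%:E)%E); last first.
  by move=> i _; rewrite funeposE -EFin_max.
rewrite [X in (_ - X)%E](eq_bigr (fun i : 'I_N => (b i)%:E * (Num.max (- f (q i)) 0)%:E)%E); last first.
  by move=> i _; rewrite funenegE -EFin_max.
rewrite (fp (fun x => Num.max (f x) 0)) (fp (fun x => Num.max (- f x) 0)) -EFinB /= -sumrB.
apply: eq_bigr => i _; rewrite -mulrBr; congr (_ * _).
by rewrite !maxEle; case: (leP (f (q i)) 0); case: (leP (- f (q i)) 0); lra.
Qed.

Lemma mi_pow_word (R : realType) (d : nat) (alpha : 'I_d -> nat) :
  exists2 w : seq 'I_d, size w = mi_abs alpha & forall v : 'rV[R]_d, mi_pow alpha v = wpow w v.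
Proof.
exists (flatten [seq nseq (alpha i) i | i <- enum 'I_d]).
  rewrite size_flatten /shape -map_comp sumnE big_map big_enum /mi_abs /=.
  by apply: eq_bigr => i _; rewrite size_nseq.
move=> v; rewrite /wpow big_flatten big_map big_enum /mi_pow /=.
by apply: eq_bigr => i _; rewrite big_nseq iter_mulr_1.
Qed.

Theorem theorem2 (R : realType) (d k : nat) (hd : (1 <= d)%N) :
  exists C : R,
  forall (n : nat), (1 <= n)%N ->
  forall tau : probability (param R d) R,
    tau (~` @dict_set R d) = 0%E ->
  exists (tau' : probability (param R d) R) (pts : 'I_n -> param R d),
    (forall i, @dict_set R d (pts i)) /\
    tau' (~` range pts) = 0%E /\
    forall alpha : 'I_d -> nat, (mi_abs alpha <= k)%N ->
    forall x : 'rV[R]_d, ball_d x ->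
      `| dint k alpha tau x - dint k alpha tau' x |
        <= C * (n%:R `^ (- (2^-1 + ((2 * (k - mi_abs alpha) + 1)%:R / (2 * d)%:R)))).
Proof.
have [C0 C00 sparse] := sparsify R k hd.
exists ((k`!)%:R * (C0 + 1)) => n n0 tau tau0.
(* The discretisation is made finer than the rate of every order at once, by [rate_lower]; it
   accounts for the 1 in C0 + 1. *)
have eps0 : 0 < (n%:R ^+ k.+1)^-1 :> R by rewrite invr_gt0 exprn_gt0 // ltr0n.
have [I [p [a [hp da tauE]]]] := @discretise R d k tau _ hd tau0 eps0.
have [b [[b0 b1] sb eb]] := sparse I p a n hp da n0.
have [P0 hP0] := dict_set_nonempty R hd.
have [i0 _] : exists i : I, True.
  apply: contrapT => no; have : \sum_i b i = 0 by rewrite big1 // => i; case: no; exists i.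
  by rewrite b1 => /eqP; rewrite oner_eq0.
pose l := enum [pred i | b i != 0].
have sl : (size l <= n)%N by rewrite -cardE.
have sumE (g : I -> R) : \sum_(i <- l) b i * g i = \sum_i b i * g i.
  rewrite /l big_enum [RHS](bigID (fun i => b i != 0)) /= [X in _ + X]big1 ?addr0.
    by apply: eq_bigl => i; rewrite inE.
  by move=> i; rewrite negbK => /eqP ->; rewrite mul0r.
(* The support may have fewer than n points; the default [P0] pads the list within the
   dictionary. *)
pose q j := nth P0 [seq p i | i <- l] j.
pose bb j := nth 0 [seq b i | i <- l] j.
have bqE (f : param R d -> R) : \sum_(j < size l) bb j * f (q j) = \sum_i b i * f (p i).
  rewrite -(sumE (fun i => f (p i))) (big_nth i0) big_mkord; apply: eq_bigr => j _.
  by rewrite /bb /q !(nth_map i0).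
have [tau' [supp' int']] : exists P : probability (param R d) R,
    (forall A : set (param R d), (forall i, (i < size l)%N -> A (q i)) -> P (~` A) = 0%E) /\
    (forall f : param R d -> R, measurable_fun setT f ->
      Rintegral P setT f = \sum_(i < size l) bb i * f (q i)).
  apply: finite_probability => [j|].
    rewrite /bb; case: (ltnP j (size l)) => hj; last by rewrite nth_default ?size_map.
    by rewrite (nth_map i0).
  by have := bqE (fun _ => 1); under eq_bigr do rewrite mulr1; under [RHS]eq_bigr do rewrite mulr1; rewrite b1.
have hq j : dict_set (q j).
  rewrite /q; case: (ltnP j (size l)) => hj; last by rewrite nth_default ?size_map.
  by rewrite (nth_map i0).
exists tau', (fun j : 'I_n => q j); split=> [j|]; first exact: hq.
split.
  by apply: supp' => j jl; exists (Ordinal (leq_trans jl sl)).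
move=> alpha ak x Bx; have [w ws wE] := mi_pow_word R alpha.
have wk : (size w <= k)%N by rewrite ws.
pose s : R := (k`!)%:R / ((k - size w)`!)%:R.
have datE : datom k alpha x = (fun P => s * atom k w x P).
  apply/funext => P; rewrite /datom /atom -ws /s wE /aff.
  by case: (0 <= _); rewrite ?mul1r ?mul0r ?mulr0 //; ring.
have s0 : 0 <= s by rewrite divr_ge0.
have sk : s <= (k`!)%:R by rewrite ler_pdivrMr ?ltr0n ?fact_gt0 // ler_peMr // ler1n fact_gt0.
have e1 := tauE w x s wk Bx.
have e2 : Rintegral tau' setT (fun P => s * atom k w x P) = s * fint k p b w x.
  rewrite int'; last by apply: measurable_funM => //; exact: measurable_atom.
  rewrite (bqE (fun P => s * atom k w x P)) mulr_sumr; apply: eq_bigr => i _.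
  by rewrite /atom /side; ring.
rewrite /dint datE e2 -ws.
have -> : n%:R `^ (- (2^-1 + (2 * (k - size w) + 1)%:R / (2 * d)%:R)) = rate R d n (k - size w) by [].
have r0 := rate_lower R hd n0 (leq_subr (size w) k).
have e3 := eb w x wk Bx.
rewrite (ger0_norm s0) in e1.
set J := Rintegral _ _ _ in e1 *; set r := rate _ _ _ _ in r0 e3 *.
have -> : J - s * fint k p b w x = (J - s * fint k p a w x) + s * (fint k p a w x - fint k p b w x) by ring.
apply: le_trans (ler_normD _ _) _; rewrite normrM (ger0_norm s0).
apply: (@le_trans _ _ (s * ((C0 + 1) * r))); last first.
  by rewrite -mulrA ler_wpM2r // mulr_ge0 ?(le_trans (ltW eps0) r0) //; lra.
apply: (@le_trans _ _ (s * (n%:R ^+ k.+1)^-1 + s * (C0 * r))); first by rewrite lerD // ler_wpM2l.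
by rewrite -mulrDr ler_wpM2l // mulrDl mul1r addrC lerD2l.
Qed.
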